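(* Consider the model $Y=\mu+\epsilon$ described in the context, suppose $\sigma_\mu^2>0$ and assumptions (C1)–(C3) hold. Let $\hat\sigma_\mu^2$ denote any one of $$\hat\sigma_{\mu,I}^2=\frac1n\|\hat\mu\|^2,\qquad \hat\sigma_{\mu,II}^2=\frac1n\sum_{m\in\mathcal M_{u_\gamma}}w_m\|P_mY\|^2,\qquad \hat\sigma_{\mu,III}^2=\frac1n\big(\|Y\|^2-\|Y-\hat\mu\|^2\big).$$ Then $\sqrt n(\hat\sigma_\mu^2-\sigma_\mu^2)\xrightarrow{d}\mathcal N(0,\kappa_\mu+4\sigma_\epsilon^2\sigma_\mu^2)$.
   Context: Asymptotics are as $n\to\infty$; $p=p_n$ and other quantities may depend on $n$. Notation: for $u\in\mathbb N$, $\mathcal M_u=\{m\subseteq\{1,\dots,p\}:|m|=u\}$; $Z_m$ is the submatrix of $Z\in\mathbb R^{n\times p}$ with columns in $m$, $P_m$ the orthogonal projection onto its column space, $P_m^\perp=I_n-P_m$. A random sequence $v\in\mathbb R^n$ is weakly sparse relative to $Z$ in probability with sparsity $s$ at rate $k$ if there are sets $S\in\mathcal M_s$ with $\|P_S^\perp v\|^2=o_p(k)$. A mean-zero real random variable is sub-Gaussian with parameter $K$ if $\mathbb E\exp(\lambda\xi)\le\exp(K^2\lambda^2/2)$ for all $\lambda\in\mathbb R$. Model: $Y=\mu+\epsilon$ with $Y,\mu,\epsilon\in\mathbb R^n$ and $Z$ observed along with $Y$. $\sigma_\mu^2=\mathrm{Var}(\mu_1)$, $\kappa_\mu=\mathrm{Var}(\mu_1^2)$,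 $\sigma_\epsilon^2=\mathrm{Var}(\epsilon_1)$, $\kappa_\epsilon=\mathrm{Var}(\epsilon_1^2)$. (C1) The entries of $\mu$ are i.i.d. with mean zero and finite fourth moment. (C2) $\epsilon$ is independent of $(Z,\mu)$, with i.i.d. sub-Gaussian entries with parameter $K_\epsilon$. (C3) $\mu$ is weakly sparse relative to $Z$ in probability with sparsity $s_\gamma$ at rate $\sqrt n$; the chosen integer $u_\gamma$ satisfies $u_\gamma\ge s_\gamma$ for all large $n$ and $u_\gamma=o(\sqrt n/\log p)$. Estimator: fix $\alpha_Y>4K_\epsilon^2$; $w_m=\exp(-\|P_m^\perp Y\|^2/\alpha_Y)/\sum_{k\in\mathcal M_{u_\gamma}}\exp(-\|P_k^\perp Y\|^2/\alpha_Y)$ for $m\in\mathcal M_{u_\gamma}$, and $\hat\mu=\sum_{m\in\mathcal M_{u_\gamma}}w_mP_mY$. *)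

(* Defs.v *)
From HB Require Import structures.
From mathcomp Require Import all_boot all_order all_algebra.
From mathcomp Require Import all_classical all_reals all_analysis.
Set Implicit Arguments. Unset Strict Implicit. Unset Printing Implicit Defensive.
Import Order.TTheory GRing.Theory Num.Theory.
Import numFieldNormedType.Exports.
Local Open Scope classical_set_scope.
Local Open Scope ring_scope.

Definition sqn {R : realType} {n : nat} (v : 'cV[R]_n) : R :=
  \sum_(i < n) (v i 0) ^+ 2.

(* P_m y : orthogonal projection of y onto the column space of Z_m, the
   submatrix of Z with the columns indexed by m, i.e. the unique v in
   span{col j Z | j in m} with (col j Z)^T (y - v) = 0 for all j in m. *)
Definition proj_cols {R : realType} {n p : nat} (Z : 'M[R]_(n, p))
    (m : {set 'I_p}) (y : 'cV[R]_n) : 'cV[R]_n :=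
  xget 0 [set v : 'cV[R]_n |
    (exists c : 'cV[R]_p, (forall j, j \notin m -> c j 0 = 0) /\ v = Z *m c) /\
    (forall j, j \in m -> (col j Z)^T *m (y - v) = 0)].

Definition projperp_cols {R : realType} {n p : nat} (Z : 'M[R]_(n, p))
    (m : {set 'I_p}) (y : 'cV[R]_n) : 'cV[R]_n := y - proj_cols Z m y.

Definition wgt {R : realType} {n p : nat} (alpha : R) (u : nat)
    (Z : 'M[R]_(n, p)) (y : 'cV[R]_n) (m : {set 'I_p}) : R :=
  expR (- sqn (projperp_cols Z m y) / alpha) /
  \sum_(k : {set 'I_p} | #|k| == u) expR (- sqn (projperp_cols Z k y) / alpha).

Definition muhat {R : realType} {n p : nat} (alpha : R) (u : nat)
    (Z : 'M[R]_(n, p)) (y : 'cV[R]_n) : 'cV[R]_n :=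
  \sum_(m : {set 'I_p} | #|m| == u) wgt alpha u Z y m *: proj_cols Z m y.

Definition sig2_I {R : realType} {n p : nat} (alpha : R) (u : nat)
    (Z : 'M[R]_(n, p)) (y : 'cV[R]_n) : R :=
  sqn (muhat alpha u Z y) / n%:R.

Definition sig2_II {R : realType} {n p : nat} (alpha : R) (u : nat)
    (Z : 'M[R]_(n, p)) (y : 'cV[R]_n) : R :=
  (\sum_(m : {set 'I_p} | #|m| == u) wgt alpha u Z y m * sqn (proj_cols Z m y))
  / n%:R.

Definition sig2_III {R : realType} {n p : nat} (alpha : R) (u : nat)
    (Z : 'M[R]_(n, p)) (y : 'cV[R]_n) : R :=
  (sqn y - sqn (y - muhat alpha u Z y)) / n%:R.

Definition mutually_indep {d} {T : measurableType d} {R : realType}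
    (P : probability T R) {I : finType} (X : I -> T -> R) : Prop :=
  forall (J : {set I}) (B : I -> set R), (forall i, measurable (B i)) ->
  P (\bigcap_(i in [set` J]) (X i @^-1` B i)) =
    (\prod_(i in J) P (X i @^-1` B i))%E.

(* Independence of two finite families of real random variables, i.e. of
   the sigma-algebras they generate (checked on finite-dimensional cylinders,
   which form a generating pi-system). *)
Definition indep_families {d} {T : measurableType d} {R : realType}
    (P : probability T R) {I J : finType} (X : I -> T -> R) (Y : J -> T -> R)
    : Prop :=
  forall (A : {set I}) (B : {set J}) (F : I -> set R) (G : J -> set R),
  (forall i, measurable (F i)) -> (forall j, measurable (G j)) ->
  P ((\bigcap_(i in [set` A]) (X i @^-1` F i)) `&`
     (\bigcap_(j in [set` B]) (Y j @^-1` G j))) =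
  (P (\bigcap_(i in [set` A]) (X i @^-1` F i)) *
   P (\bigcap_(j in [set` B]) (Y j @^-1` G j)))%E.

Definition normal0_integral {R : realType} (v : R) (f : R -> R) : \bar R :=
  if v == 0 then (f 0)%:E
  else (\int[normal_prob 0 (Num.sqrt v)]_y (f y)%:E)%E.

Definition cvg_dist_normal0 {d} {T : measurableType d} {R : realType}
    (P : probability T R) (X : nat -> T -> R) (v : R) : Prop :=
  forall f : R -> R, continuous f -> (exists M : R, forall y, `|f y| <= M) ->
  (\int[P]_x (f (X n x))%:E)%E @[n --> \oo] --> normal0_integral v f.

(* Main.v *)
Require Import Defs.
From HB Require Import structures.
From mathcomp Require Import all_boot all_order all_algebra.
From mathcomp Require Import all_classical all_reals all_analysis.
From mathcomp Require Import measurable_realfun.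
From mathcomp Require Import ring lra.
Set Implicit Arguments. Unset Strict Implicit. Unset Printing Implicit Defensive.
Import Order.TTheory GRing.Theory Num.Theory.
Import numFieldNormedType.Exports.
Local Open Scope classical_set_scope.
Local Open Scope ring_scope.

(** Writing M for the Gibbs mean of |P_m Y|^2 and V for the Gibbs mean of |P_m Y - muhat|^2, the
    three estimators are, up to the factor 1/n, M - V, M and M + V.  The Gibbs variational
    principle bounds the Gibbs mean of |P_m^perp Y|^2 by the residual of a model containing the
    sparse set S plus alpha ln #|M_u| <= alpha u ln p.  If the noise energies of the spaces
    span(mu, Z_m) and |P_S^perp mu|^2 are all at most b, it follows that M is within O(b + u ln p)
    of |mu|^2 + 2 <mu, eps> and that V is of the same order.  For b = e sqrt n the exceptional
    event has vanishing probability, by an exponential moment bound for the noise energy conditionally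
    on (Z, mu), so sqrt n (estimator - sigma^2) is asymptotically equivalent to the normalized sum of
    the i.i.d. variables mu_i^2 + 2 mu_i eps_i - sigma^2, of variance kappa_mu + 4 sigma_eps^2 sigma_mu^2.
    The central limit theorem for this sum is proved by Trotter's semigroup comparison. *)

(** * Exponential inequalities and densities *)

(** The Gibbs weights are built from the noise that they average, so no expectation over eps can be
    taken at fixed weights. The estimators are therefore bounded pathwise, on one event where every
    model of size u, good or bad, has small noise energy. The union over at most p^u models costs u
    ln p, which (C3) makes negligible against sqrt n. Residuals are of order n; only after
    subtracting |eps|^2, which all models share, is their Gibbs mean of order b + u ln p.

    Projections are computed by Gram-Schmidt with zero vectors kept: the formula is measurable in
    (Z, Y), the number of vectors is known whatever the rank, and the system is frozen once (Z, mu)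
    is.

    In the central limit theorem the summand has two moments only, as mu_i^2 enters it. A slight
    Gaussian smoothing gives a Lipschitz test function a second order Taylor expansion, uniform in
    the base point, with remainder controlled by min (y^2, |y|^3): integrable with two moments, yet
    o(1/n) in mean at scale 1 / sqrt n. Convolution operators commute and contract, so the n
    one-step errors merely add up. *)

Section exp_ineq.
Context {R : realType}.
Implicit Types u x y : R.

Lemma expR_sub1_le u : `|expR u - 1| <= `|u| * expR `|u|.
Proof.
have h1 := expR_ge1Dx u; have h2 := expR_ge1Dx (- u).
have e0 := expR_gt0 u; have e1 := expRxMexpNx_1 u.
have H : expR u - 1 <= u * expR u.
  have : expR u * (1 - u) <= expR u * expR (- u) by rewrite ler_wpM2l// ltW.
  by rewrite e1; lra.
have [u0|u0] := ger0P u.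
  by rewrite ger0_norm//; lra.
have lt1 : expR u < 1 by rewrite expR_lt1.
rewrite ltr0_norm; last lra.
have : 1 <= expR (- u) by rewrite -expR0 ler_expR; lra.
move=> h3; have : - u * 1 <= - u * expR (- u) by rewrite ler_wpM2l//; lra.
lra.
Qed.

Let dexp (a b x u : R) : is_derive x (1:R)
  (fun t : R => expR (t * u) - 1 - a * (t * u) - b * (t * u) ^+ 2 / 2)
  (u * (expR (x * u) - a - b * (x * u))).
Proof.
apply: is_derive_eq; rewrite /GRing.scale/=.
by field.
Qed.

(** The mean value theorem along t -> t u. The choice (a, b) = (1, 0) gives the remainder of order
    one, (1, 1) that of order two; the derivative is [u] times the remainder one order lower at
    [c * u], so each bound follows from the previous one. *)
Let expR_mvt (a b u : R) : exists2 c, 0 <= c <= 1 &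
  expR u - 1 - a * u - b * u ^+ 2 / 2 = u * (expR (c * u) - a - b * (c * u)).
Proof.
have [||c] := @MVT_segment R (fun t : R => expR (t * u) - 1 - a * (t * u) - b * (t * u) ^+ 2 / 2)
  (fun x => u * (expR (x * u) - a - b * (x * u))) 0 1 ler01.
- by move=> x _; exact: dexp.
- apply: continuous_subspaceT => x.
  have h := dexp a b x u; apply/differentiable_continuous/derivable1_diffP.
  exact: ex_derive.
rewrite in_itv/= => c01; rewrite !mul0r !mul1r expr0n/= expR0 => h.
exists c => //; rewrite subr0 mulr1 in h; rewrite -h; lra.
Qed.

Lemma expR_sub1D_le u : `|expR u - 1 - u| <= `|u| ^+ 2 * expR `|u|.
Proof.
have [c /andP[c0 c1]] := expR_mvt 1 0 u.
rewrite mul1r !mul0r !subr0 => ->; rewrite normrM.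
have h := expR_sub1_le (c * u).
have : `|c * u| <= `|u| by rewrite normrM ger0_norm// ler_piMl.
move=> h1; rewrite expr2 -mulrA ler_wpM2l//.
by apply: (le_trans h); apply: ler_pM; rewrite ?expR_ge0 ?ler_expR.
Qed.

Lemma expR_taylor2 u :
  `|expR u - 1 - u - u ^+ 2 / 2| <= `|u| ^+ 3 * expR `|u|.
Proof.
have [c /andP[c0 c1]] := expR_mvt 1 1 u.
rewrite !mul1r => ->; rewrite normrM.
have h := expR_sub1D_le (c * u).
have : `|c * u| <= `|u| by rewrite normrM ger0_norm// ler_piMl.
move=> h1; rewrite exprS -mulrA ler_wpM2l//.
apply: (le_trans h); apply: ler_pM => //; rewrite ?expR_ge0 ?exprn_ge0//.
  by rewrite lerXn2r ?nnegrE.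
by rewrite ler_expR.
Qed.

Lemma norm_le_expR x : `|x| <= expR `|x|.
Proof. by have := expR_ge1Dx `|x|; lra. Qed.

Lemma sqr_le_expR x : x ^+ 2 <= 2 * expR `|x|.
Proof.
have := @expR_ge1Dxn _ `|x| 1 (normr_ge0 x); rewrite real_normK ?num_real//.
by rewrite (_ : 2`! = 2)//; lra.
Qed.

Lemma cube_le_expR x : `|x| ^+ 3 <= 6 * expR `|x|.
Proof.
have := @expR_ge1Dxn _ `|x| 2 (normr_ge0 x).
by rewrite (_ : 3`! = 6)//; lra.
Qed.

Lemma expR_norm_le x : expR `|x| <= expR x + expR (- x).
Proof.
have := expR_gt0 x; have := expR_gt0 (-x).
by have [x0|x0] := ger0P x; lra.
Qed.

End exp_ineq.
Section density.
Context d (T : measurableType d) (R : realType).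
Variables (nu mu : {measure set T -> \bar R}) (f : T -> R).
Hypotheses (mf : measurable_fun setT f) (f0 : forall x, 0 <= f x).
Hypothesis nuE : forall A, measurable A ->
  (nu A = \int[mu]_(x in A) (f x)%:E)%E.

Import HBNNSimple.
Local Open Scope ereal_scope.

(** [nu] is known only through its values on measurable sets, so the identity is checked on simple
    functions and carried over by monotone convergence on both sides. *)
Lemma ge0_integral_density (g : T -> \bar R) : measurable_fun setT g ->
  (forall x, 0 <= g x) -> \int[nu]_x g x = \int[mu]_x (g x * (f x)%:E).
Proof.
move=> mg g0; pose g_ := nnsfun_approx measurableT mg.
have mEf : measurable_fun setT (EFin \o f) by exact/measurable_EFinP.
have cvg_g x : (EFin \o g_ ^~ x) @ \oo --> g x.
  by apply: cvg_nnsfun_approx => // *; exact: g0.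
transitivity (limn (fun n => \int[nu]_x (g_ n x)%:E)).
  rewrite -monotone_convergence//.
  - by apply: eq_integral => y _; apply/esym/cvg_lim => //; exact: cvg_g.
  - by move=> n; exact/measurable_EFinP.
  - by move=> n y _; rewrite lee_fin.
  - by move=> y _ m n mn; rewrite lee_fin; exact/lefP/nd_nnsfun_approx.
transitivity (limn (fun n => \int[mu]_x ((g_ n x)%:E * (f x)%:E))); last first.
  rewrite -monotone_convergence//.
  - apply: eq_integral => y _; apply/cvg_lim => //.
    by apply: cvgeZr => //; exact: cvg_g.
  - move=> n; apply: emeasurable_funM => //; exact/measurable_EFinP.
  - by move=> n y _; rewrite mule_ge0 ?lee_fin.
  - move=> y _ m n mn; rewrite lee_pmul// ?lee_fin//.
    exact/lefP/nd_nnsfun_approx.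
congr (limn _); apply/funext => n.
have mn r : measurable (g_ n @^-1` [set r]) by [].
transitivity (\sum_(k \in range (g_ n))
    \int[nu]_x (k * \1_(g_ n @^-1` [set k]) x)%:E).
  under eq_integral do rewrite fimfunE -fsumEFin//.
  rewrite ge0_integral_fsum//.
  - by move=> y; exact/measurable_EFinP/measurable_funM.
  - by move=> y x _; rewrite nnfun_muleindic_ge0.
transitivity (\sum_(k \in range (g_ n))
    \int[mu]_x ((k * \1_(g_ n @^-1` [set k]) x)%:E * (f x)%:E)).
  apply: eq_fsbigr => r rr; rewrite integralZl_indic_nnsfun// integral_indic//=.
  have r0 : (0 <= r)%R by move: rr; rewrite inE => -[x _ <-].
  rewrite setIT nuE//.
  under [RHS]eq_integral do rewrite EFinM -muleA.
  rewrite ge0_integralZl//; last 2 first.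
    apply: emeasurable_funM => //; exact/measurable_EFinP.
    by move=> x _; rewrite mule_ge0 ?lee_fin// indicE.
  congr (_ * _); rewrite [LHS]integral_mkcond; apply: eq_integral => x _.
  rewrite patchE indicE; case: ifPn => _; first by rewrite mul1e.
  by rewrite mul0e.
rewrite -ge0_integral_fsum//.
- apply: eq_integral => x _; rewrite [in RHS]fimfunE -fsumEFin//.
  by rewrite ge0_mule_fsuml// => y; rewrite nnfun_muleindic_ge0.
- move=> r; apply: emeasurable_funM => //.
  by apply/measurable_EFinP/measurable_funM.
- by move=> r x _; rewrite mule_ge0 ?lee_fin// -lee_fin nnfun_muleindic_ge0.
Qed.

End density.

Section translation.
Context {R : realType}.
Local Notation leb := (@lebesgue_measure R).
Local Open Scope ereal_scope.

Lemma lebesgue_measure_translate (a : R) (A : set R) : measurable A ->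
  pushforward leb ((fun x => x + a)%R : measurableTypeR R -> measurableTypeR R) A = leb A.
Proof.
move=> mA; apply/esym/lebesgue_measure_unique => //=.
  by apply: measurable_funD.
move=> ? _ [[x y]] _ <-.
rewrite /pushforward (_ : _ @^-1` _ = `](x - a)%R, (y - a)%R]%classic).
  rewrite !lebesgue_measure_itv/= !lte_fin ltrD2r.
  by case: ifPn => // _; rewrite -!EFinB; congr (_%:E); ring.
apply/seteqP; split => z /=; rewrite !in_itv/= => /andP[].
  by rewrite ltrBlDr lerBrDr => -> ->.
by rewrite ltrBlDr lerBrDr => -> ->.
Qed.

Lemma ge0_integral_translate (a : R) (f : R -> \bar R) :
  measurable_fun setT f -> (forall x, 0 <= f x) ->
  \int[leb]_x f (x + a)%R = \int[leb]_x f x.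
Proof.
move=> mf f0.
pose t : measurableTypeR R -> measurableTypeR R := (fun x => x + a)%R.
have mt : measurable_fun setT t by apply: measurable_funD.
transitivity (\int[pushforward leb t]_x f x).
  by rewrite ge0_integral_pushforward// => x _; exact: f0.
by apply: eq_measure_integral => A mA _; exact: lebesgue_measure_translate.
Qed.

End translation.

(** * Gaussian integrals *)

Section integrable_aux.
Context d (T : measurableType d) (R : realType) (mu : {measure set T -> \bar R}).

Lemma integrable_le (f g : T -> R) : mu.-integrable setT (EFin \o g) ->
  measurable_fun setT f -> (forall x, `|f x| <= g x) ->
  mu.-integrable setT (EFin \o f).
Proof.
move=> ig mf fg; apply: le_integrable ig => //; first exact/measurable_EFinP.
move=> x _ /=; rewrite lee_fin; apply: (le_trans (fg x)); exact: ler_norm.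
Qed.

Lemma ge0_integrable (f : T -> R) : measurable_fun setT f ->
  (forall x, 0 <= f x) -> (\int[mu]_x (f x)%:E < +oo)%E ->
  mu.-integrable setT (EFin \o f).
Proof.
move=> mf f0 fi; apply/integrableP; split; first exact/measurable_EFinP.
by under eq_integral do rewrite /= ger0_norm//.
Qed.

Lemma RintegralE (f : T -> R) : mu.-integrable setT (EFin \o f) ->
  (\int[mu]_x (f x)%:E = (\int[mu]_x f x)%:E)%E.
Proof. by move=> fi; rewrite fineK//; exact: integrable_fin_num. Qed.

End integrable_aux.

Section normal.
Context {R : realType}.
Implicit Types (s t y z : R).
Local Notation leb := (@lebesgue_measure R).
Local Notation N s := (normal_prob 0 s).

Local Open Scope ereal_scope.

Lemma ge0_integral_normal (m s : R) (g : R -> \bar R) :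
  measurable_fun setT g -> (forall x, 0 <= g x) ->
  \int[normal_prob m s]_x g x = \int[leb]_x (g x * (normal_pdf m s x)%:E).
Proof.
move=> mg g0; apply: (@ge0_integral_density _ _ R (normal_prob m s) leb
  (normal_pdf m s)) => //; first exact: measurable_normal_pdf.
by move=> x; exact: normal_pdf_ge0.
Qed.

Lemma normal_pdf_shift s (y z : R) : s != 0%R ->
  normal_pdf 0 s (z - y) =
  (expR (z * y / s ^+ 2 - y ^+ 2 / (s ^+ 2 * 2)) * normal_pdf 0 s z)%R.
Proof.
move=> s0; rewrite !normal_pdfE//= mulrCA; congr (_ * _)%R.
by rewrite /normal_fun -expRD; congr expR; rewrite -mulr_natr; field.
Qed.

(** The Cameron-Martin formula. It moves a translation from the integrand, which may be merely
    measurable, to a smooth weight. *)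
Lemma ge0_integral_normal_shift s y (g : R -> \bar R) : s != 0%R ->
  measurable_fun setT g -> (forall x, 0 <= g x) ->
  \int[N s]_z g (z + y)%R =
  \int[N s]_z (g z * (expR (z * y / s ^+ 2 - y ^+ 2 / (s ^+ 2 * 2)))%:E).
Proof.
move=> s0 mg g0; rewrite !ge0_integral_normal//; last 3 first.
- apply: emeasurable_funM => //; apply/measurable_EFinP.
  apply: measurableT_comp => //; apply: measurable_funB => //.
  by do 2 apply: measurable_funM => //.
- by move=> x; rewrite mule_ge0// lee_fin expR_ge0.
- by apply: measurableT_comp => //; apply: measurable_funD.
pose f z := g z * (expR (z * y / s ^+ 2 - y ^+ 2 / (s ^+ 2 * 2)))%:E *
  (normal_pdf 0 s z)%:E.
rewrite [RHS](_ : _ = \int[leb]_z f z)// -(@ge0_integral_translate _ y f); last 2 first.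
- apply: emeasurable_funM => //; last first.
    by apply/measurable_EFinP; exact: measurable_normal_pdf.
  apply: emeasurable_funM => //; apply/measurable_EFinP.
  apply: measurableT_comp => //; apply: measurable_funB => //.
  by do 2 apply: measurable_funM => //.
- by move=> x; rewrite !mule_ge0// lee_fin ?expR_ge0 ?normal_pdf_ge0.
apply: eq_integral => z _.
by rewrite /f -muleA -EFinM -normal_pdf_shift// addrK.
Qed.

(** The shifted Gaussian still has mass one; the shift [l * s ^+ 2] is the one whose weight is
    proportional to exp (l z). *)
Lemma normal_mgf s (l : R) : s != 0%R ->
  \int[N s]_z (expR (l * z))%:E = (expR (l ^+ 2 * s ^+ 2 / 2))%:E.
Proof.
move=> s0.
have := @ge0_integral_normal_shift s (l * s ^+ 2)%R (cst 1) s0 (measurable_cst _) (fun _ => lee01).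
rewrite integral_cst//= mul1e probability_setT => H.
rewrite -[RHS]mule1 H -ge0_integralZl//; last first.
  apply: emeasurable_funM => //; apply/measurable_EFinP.
  apply: measurableT_comp => //; apply: measurable_funB => //.
  by do 2 apply: measurable_funM => //.
apply: eq_integral => z _; rewrite mul1e -EFinM -expRD; congr ((expR _)%:E).
by field.
Qed.

(** Completing the square: the joint density of [y] and the sum [z] is the density of [z] times the
    conditional density of [y] given [z], which is Gaussian of mean s^2 z / r^2 and deviation s t /
    r. *)
Lemma normal_pdf_mul (s t r y z : R) : (0 < s)%R -> (0 < t)%R -> (0 < r)%R ->
  (r ^+ 2 = s ^+ 2 + t ^+ 2)%R ->
  (normal_pdf 0 t (z - y) * normal_pdf 0 s y =
    normal_pdf 0 r z * normal_pdf (s ^+ 2 / r ^+ 2 * z) (s * t / r) y)%R.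
Proof.
move=> s0 t0 r0 rE.
have sn0 : s != 0%R by rewrite gt_eqF.
have tn0 : t != 0%R by rewrite gt_eqF.
have rn0 : r != 0%R by rewrite gt_eqF.
rewrite !normal_pdfE//; last by rewrite !mulf_neq0// invr_neq0.
rewrite /= [LHS](_ : _ = (normal_peak t * normal_peak s) *
   (normal_fun 0 t (z - y) * normal_fun 0 s y))%R; last by ring.
rewrite [RHS](_ : _ = (normal_peak r * normal_peak (s * t / r)) *
   (normal_fun 0 r z * normal_fun (s ^+ 2 / r ^+ 2 * z) (s * t / r) y))%R; last by ring.
congr (_ * _)%R.
  (* Abstracting pi into a non-negative [q] leaves an algebraic identity under the square roots. *)
  have [q q0 peakE] : exists2 q : R, (0 <= q)%R &
      forall u : R, normal_peak u = (Num.sqrt (u ^+ 2 * q *+ 2))^-1%R.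
    by exists pi => //; exact: pi_ge0.
  rewrite !peakE -!invfM -!sqrtrM ?mulrn_wge0 ?mulr_ge0 ?sqr_ge0//; first last.
  1-4: exact: ltW.
  have -> // : (t ^+ 2 * q *+ 2 * (s ^+ 2 * q *+ 2) =
    r ^+ 2 * q *+ 2 * ((s * t / r) ^+ 2 * q *+ 2))%R.
  by field.
rewrite /normal_fun -!expRD; congr expR.
rewrite [((s * t / r) ^+ 2)%R]expr_div_n exprMn rE.
field.
by rewrite -rE sn0 tn0 expf_neq0.
Qed.

(** By Tonelli [y] is integrated first: its conditional density given the sum has mass one, and the
    density of deviation [r] remains. *)
Lemma ge0_integral_normal_convolution (s t r : R) (g : R -> \bar R) :
  (0 < s)%R -> (0 < t)%R -> (0 < r)%R -> (r ^+ 2 = s ^+ 2 + t ^+ 2)%R ->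
  measurable_fun setT g -> (forall x, 0 <= g x) ->
  \int[N s]_y \int[N t]_z g (y + z)%R = \int[N r]_z g z.
Proof.
move=> s0 t0 r0 rE mg g0.
have sn0 : s != 0%R by rewrite gt_eqF.
have tn0 : t != 0%R by rewrite gt_eqF.
have rn0 : r != 0%R by rewrite gt_eqF.
have mpdf (u m : R) : measurable_fun setT (fun z : R => (normal_pdf m u z)%:E).
  by apply/measurable_EFinP; exact: measurable_normal_pdf.
have mF : measurable_fun setT (fun yz : R * R => g yz.2 * (normal_pdf 0 t (yz.2 - yz.1))%:E
    * (normal_pdf 0 s yz.1)%:E).
  apply: emeasurable_funM; last first.
    by apply: (measurableT_comp (mpdf s 0%R)); exact: measurable_fst.
  apply: emeasurable_funM.
    by apply: measurableT_comp mg _; exact: measurable_snd.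
  apply: (measurableT_comp (mpdf t 0%R)).
  by apply: measurable_funB; [exact: measurable_snd|exact: measurable_fst].
have F0 (yz : R * R) : 0 <= g yz.2 * (normal_pdf 0 t (yz.2 - yz.1))%:E
    * (normal_pdf 0 s yz.1)%:E.
  by rewrite !mule_ge0// lee_fin normal_pdf_ge0.
have inner y : \int[N t]_z g (y + z)%R =
    \int[leb]_z (g z * (normal_pdf 0 t (z - y))%:E).
  have mgy : measurable_fun setT (fun z => g (y + z)%R).
    by apply: (measurableT_comp mg); apply: measurable_funD.
  rewrite (ge0_integral_normal 0 t mgy); last by move=> z; exact: g0.
  pose f z := g z * (normal_pdf 0 t (z - y))%:E.
  have mf : measurable_fun setT f.
    apply: emeasurable_funM; first exact: mg.
    by apply: (measurableT_comp (mpdf t 0%R)); apply: measurable_funB.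
  have f0 z : 0 <= f z by rewrite mule_ge0// lee_fin normal_pdf_ge0.
  transitivity (\int[leb]_z f (z + y)%R); last exact: ge0_integral_translate.
  by apply: eq_integral => z _; rewrite /f addrK addrC.
transitivity (\int[leb]_y \int[leb]_z (g z * (normal_pdf 0 t (z - y))%:E
    * (normal_pdf 0 s y)%:E)).
  under eq_integral do rewrite inner.
  rewrite ge0_integral_normal//; last 2 first.
  - have := @measurable_fun_fubini_tonelli_F _ _ _ _ R leb (fun yz : R * R =>
      g yz.2 * (normal_pdf 0 t (yz.2 - yz.1))%:E).
    apply.
    + apply: emeasurable_funM.
        by apply: measurableT_comp mg _; exact: measurable_snd.
      apply: (measurableT_comp (mpdf t 0%R)).
      by apply: measurable_funB; [exact: measurable_snd|exact: measurable_fst].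
    + by move=> x; rewrite mule_ge0// lee_fin normal_pdf_ge0.
  - by move=> y; apply: integral_ge0 => z _; rewrite mule_ge0// lee_fin normal_pdf_ge0.
  apply: eq_integral => y _; rewrite ge0_integralZr//.
  - apply: emeasurable_funM => //.
    by apply: (measurableT_comp (mpdf t 0%R)); apply: measurable_funB.
  - by move=> z _; rewrite mule_ge0// lee_fin normal_pdf_ge0.
  - by rewrite lee_fin normal_pdf_ge0.
rewrite (@fubini_tonelli _ _ _ _ _ leb leb (fun yz : R * R => g yz.2 * (normal_pdf 0 t (yz.2 - yz.1))%:E
    * (normal_pdf 0 s yz.1)%:E))//= ge0_integral_normal//.
apply: eq_integral => z _.
under eq_integral => y _ do rewrite -muleA -EFinM (normal_pdf_mul y z s0 t0 r0 rE) EFinM muleA.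
rewrite ge0_integralZl.
- by rewrite integral_normal_pdf mule1.
- exact: measurableT.
- exact: mpdf.
- by move=> y _; rewrite lee_fin normal_pdf_ge0.
- by rewrite mule_ge0// lee_fin normal_pdf_ge0.
Qed.

End normal.

(** * Integrability tools and moments of the centred Gaussian *)

Lemma integrable_scale d (T : measurableType d) (R : realType)
    (mu : {measure set T -> \bar R}) (k : R) (f : T -> R) :
  mu.-integrable setT (EFin \o f) -> mu.-integrable setT (EFin \o (fun x => k * f x)).
Proof. by move=> fi; exact: (integrableZl measurableT k fi). Qed.

Lemma integrable_bM d (T : measurableType d) (R : realType)
    (mu : {measure set T -> \bar R}) (f g : T -> R) (M : R) :
  mu.-integrable setT (EFin \o f) -> measurable_fun setT g ->
  (forall x, `|g x| <= M) -> mu.-integrable setT (EFin \o (fun x => g x * f x)).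
Proof.
move=> fi mg gM; have mf : measurable_fun setT f.
  by apply/measurable_EFinP; exact: measurable_int fi.
apply: (@integrable_le _ _ _ _ _ (fun x => M * `|f x|)).
- by apply: integrable_scale; exact: integrable_norm.
- exact: measurable_funM.
- by move=> x; rewrite normrM ler_wpM2r.
Qed.

(** The dominating [g] is integrated in the extended reals, so that a bound on its integral suffices
    and its integrability need not be shown separately. *)
Lemma le_Rintegral_bound d (T : measurableType d) (R : realType)
    (mu : {measure set T -> \bar R}) (f g : T -> R) (c : R) :
  mu.-integrable setT (EFin \o f) -> (forall x, `|f x| <= g x) ->
  measurable_fun setT g -> (\int[mu]_x (g x)%:E <= c%:E)%E ->
  `|\int[mu]_x f x| <= c.
Proof.
move=> fi fg mg gc.
have g0 x : 0 <= g x by exact: le_trans (fg x).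
apply: (le_trans (le_normr_Rintegral measurableT fi)).
rewrite -lee_fin -RintegralE; last exact: integrable_norm.
apply: le_trans gc; apply: ge0_le_integral => //.
- apply/measurable_EFinP/measurableT_comp => //.
  by apply/measurable_EFinP; exact: measurable_int fi.
- exact/measurable_EFinP.
- by move=> x _; rewrite lee_fin.
Qed.

Section normal_moments.
Context {R : realType}.
Variable s : R.
Hypothesis s0 : 0 < s.
Local Notation N := (normal_prob 0 s).
Implicit Types (x y z c : R).

Let sn0 : s != 0. Proof. by rewrite gt_eqF. Qed.

Let mexp c : measurable_fun setT (fun z : R => expR (c * z)).
Proof. by apply: measurableT_comp => //; apply: measurable_funM. Qed.

Let mexpn c : measurable_fun setT (fun z : R => expR (c * `|z / s|)).
Proof.
apply: measurableT_comp => //; apply: measurable_funM => //.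
by apply: measurableT_comp => //; apply: measurable_funM.
Qed.

(** All the Gaussian moments used later are dominated by this one. Since exp |x| is at most exp x +
    exp (-x), it follows from the moment generating function; dividing by [s] makes the bound free
    of the scale. *)
Lemma normal_exp_norm_le c : 0 <= c ->
  (\int[N]_z (expR (c * `|z / s|))%:E <= (2 * expR (c ^+ 2 / 2))%:E)%E.
Proof.
move=> c0.
apply: (@le_trans _ _ (\int[N]_z ((expR (c / s * z))%:E + (expR (- (c / s) * z))%:E))%E).
  apply: ge0_le_integral => //.
  - by apply/measurable_EFinP; exact: mexpn.
  - by apply: emeasurable_funD; apply/measurable_EFinP; exact: mexp.
  move=> z _; rewrite -EFinD lee_fin.
  rewrite -{1}(ger0_norm c0) -normrM; apply: (le_trans (expR_norm_le _)).
  have -> : c / s * z = c * (z / s) by field.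
  by have -> : - (c / s) * z = - (c * (z / s)) by field.
rewrite ge0_integralD//; first last.
- by apply/measurable_EFinP; exact: mexp.
- by apply/measurable_EFinP; exact: mexp.
rewrite !normal_mgf// -EFinD lee_fin.
have -> : (c / s) ^+ 2 * s ^+ 2 = c ^+ 2 by field.
have -> : (- (c / s)) ^+ 2 * s ^+ 2 = c ^+ 2 by field.
lra.
Qed.

Lemma integrable_normal_exp_norm c : 0 <= c ->
  N.-integrable setT (EFin \o (fun z : R => expR (c * `|z / s|))).
Proof.
move=> c0; apply: ge0_integrable.
- exact: mexpn.
- by move=> z; exact: expR_ge0.
by apply: (le_lt_trans (normal_exp_norm_le c0)); rewrite ltry.
Qed.

Let mdiv : measurable_fun setT (fun z : R => z / s).
Proof. by apply: measurable_funM. Qed.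

Lemma integrable_normal_id : N.-integrable setT (EFin \o (fun z : R => z / s)).
Proof.
apply: integrable_le (integrable_normal_exp_norm ler01) _ _ => //.
by move=> z; rewrite mul1r norm_le_expR.
Qed.

Lemma integrable_normal_sqr : N.-integrable setT (EFin \o (fun z : R => (z / s) ^+ 2)).
Proof.
have h : N.-integrable setT (EFin \o (fun z : R => 2 * expR (1 * `|z / s|))).
  by apply: integrable_scale; exact: (integrable_normal_exp_norm ler01).
apply: integrable_le h _ _; first exact: measurable_funX.
by move=> z; rewrite ger0_norm ?sqr_ge0// mul1r; exact: sqr_le_expR.
Qed.

Lemma normal_abs_cube_le :
  (\int[N]_z (`|z| ^+ 3)%:E <= (s ^+ 3 * (12 * expR (1 / 2)))%:E)%E.
Proof.
apply: (@le_trans _ _ (\int[N]_z ((6 * s ^+ 3)%:E * (expR (1 * `|z / s|))%:E))%E).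
  apply: ge0_le_integral => //.
  - apply/measurable_EFinP; apply: measurable_funX; exact: normr_measurable.
  - by apply: emeasurable_funM => //; apply/measurable_EFinP; exact: mexpn.
  move=> z _; rewrite -EFinM lee_fin mul1r.
  have := cube_le_expR (z / s); rewrite normrM normfV (ger0_norm (ltW s0)).
  move=> h; have -> : `|z| ^+ 3 = s ^+ 3 * (`|z| / s) ^+ 3 by field.
  by have := ler_wpM2l (exprn_ge0 3 (ltW s0)) h; lra.
rewrite ge0_integralZl//; last 2 first.
- by apply/measurable_EFinP; exact: mexpn.
- by rewrite lee_fin mulr_ge0// exprn_ge0// ltW.
apply: (@le_trans _ _ ((6 * s ^+ 3)%:E * (2 * expR (1 ^+ 2 / 2))%:E)%E).
  apply: lee_wpmul2l; first by rewrite lee_fin mulr_ge0// exprn_ge0// ltW.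
  exact: normal_exp_norm_le.
by rewrite -EFinM lee_fin expr1n; lra.
Qed.

Lemma eq0_of_le_linear (a C : R) :
  (forall t : R, 0 < t <= 1 -> `|a| <= t * C) -> a = 0.
Proof.
move=> H; apply/eqP; rewrite -normr_le0 leNgt; apply/negP => a0.
have C0 : 0 < C by have := H 1; rewrite ltr01 lexx mul1r => /(_ isT); exact: lt_le_trans.
have t0 : 0 < Num.min 1 (`|a| / (2 * C)) by rewrite lt_min ltr01 divr_gt0// mulr_gt0.
have := H (Num.min 1 (`|a| / (2 * C))); rewrite t0 ge_min lexx => /(_ isT).
apply/negP; rewrite -ltNge; apply: (@le_lt_trans _ _ (`|a| / (2 * C) * C)).
  by rewrite ler_pM2r// ge_min lexx orbT.
rewrite (_ : `|a| / (2 * C) * C = `|a| / 2); last by field; rewrite gt_eqF.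
by rewrite ltr_pdivrMr// ltr_pMr// ltr1n.
Qed.

Let m1 := \int[N]_z (z / s).
Let m2 := \int[N]_z (z / s) ^+ 2.

(** The first two moments are read off the generating function: its expansion in [t] is compared
    with that of exp (t^2 / 2). Dividing by t, then by t^2, and letting t tend to 0 forces m1 = 0
    and m2 = 1. *)
Let mexpansion (t : R) : 0 < t <= 1 ->
  `|t * m1 + t ^+ 2 / 2 * (m2 - 1)| <= t ^+ 3 * (12 * expR 2 + expR 1).
Proof.
move=> /andP[t0 t1].
have iexp : N.-integrable setT (EFin \o (fun z : R => expR (t * (z / s)))).
  apply: integrable_le (integrable_normal_exp_norm ler01) _ _ => //.
    by apply: measurableT_comp => //; apply: measurable_funM.
  move=> z; rewrite ger0_norm ?expR_ge0// ler_expR mul1r.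
  apply: (le_trans (ler_norm _)); rewrite normrM (ger0_norm (ltW t0)).
  by rewrite ler_piMl.
have ione : N.-integrable setT (EFin \o (fun z : R => (1 : R))).
  exact: finite_measure_integrable_cst.
have it1 : N.-integrable setT (EFin \o (fun z : R => t * (z / s))).
  by apply: integrable_scale; exact: integrable_normal_id.
have it2 : N.-integrable setT (EFin \o (fun z : R => t ^+ 2 / 2 * (z / s) ^+ 2)).
  by apply: integrable_scale; exact: integrable_normal_sqr.
have iD1 : N.-integrable setT (EFin \o (fun z : R => expR (t * (z / s)) - 1)).
  exact: (integrableB measurableT iexp ione).
have iD2 : N.-integrable setT (EFin \o (fun z : R => expR (t * (z / s)) - 1 - t * (z / s))).
  exact: (integrableB measurableT iD1 it1).
have iD3 : N.-integrable setT (EFin \o (fun z : R => expR (t * (z / s)) - 1 - t * (z / s)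
   - t ^+ 2 / 2 * (z / s) ^+ 2)).
  exact: (integrableB measurableT iD2 it2).
have E1 : \int[N]_z (expR (t * (z / s)) - 1 - t * (z / s) - t ^+ 2 / 2 * (z / s) ^+ 2)
   = expR (t ^+ 2 / 2) - 1 - t * m1 - t ^+ 2 / 2 * m2.
  rewrite (RintegralB measurableT iD2 it2) (RintegralB measurableT iD1 it1).
  rewrite (RintegralB measurableT iexp ione).
  rewrite RintegralZl//; last exact: integrable_normal_id.
  rewrite RintegralZl//; last exact: integrable_normal_sqr.
  have NT : fine (N setT) = 1 by rewrite (@probability_setT _ _ _ N).
  rewrite Rintegral_cst// NT mulr1.
  congr (_ - _ - _ - _).
  have tz (z : R) : t * (z / s) = t / s * z by field.
  rewrite /Rintegral; under eq_integral do rewrite tz.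
  rewrite normal_mgf//=; congr expR; by field.
(* The cubic remainder |t w|^3 exp |t w| is at most t^3 6 exp (2 |w|) for t <= 1, and the mean of
   exp (2 |w|) is at most 2 exp 2; hence 12 exp 2. *)
have := @le_Rintegral_bound _ _ _ N _ (fun z => t ^+ 3 * (6 * expR (2 * `|z / s|)))
   (t ^+ 3 * (12 * expR 2)) iD3.
rewrite E1 => H.
have {}H : `|expR (t ^+ 2 / 2) - 1 - t * m1 - t ^+ 2 / 2 * m2| <= t ^+ 3 * (12 * expR 2).
  apply: H.
  - move=> z; have := expR_taylor2 (t * (z / s)).
    rewrite exprMn (_ : t ^+ 2 / 2 * (z / s) ^+ 2 = t ^+ 2 * (z / s) ^+ 2 / 2); last by field.
    move=> /le_trans; apply.
    rewrite normrM exprMn (ger0_norm (ltW t0)) -(mulrA (t ^+ 3)).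
    rewrite ler_wpM2l ?exprn_ge0 ?(ltW t0)//.
    apply: (@le_trans _ _ (6 * expR `|z / s| * expR `|z / s|)).
      apply: ler_pM; rewrite ?exprn_ge0 ?expR_ge0 ?cube_le_expR//.
      by rewrite ler_expR ler_piMl// ltW.
    have -> : 2 * `|z / s| = `|z / s| + `|z / s| by ring.
    by rewrite expRD mulrA.
  - by do 2 (apply: measurable_funM => //); exact: mexpn.
  - under eq_integral do rewrite mulrA EFinM.
    rewrite ge0_integralZl//; last 2 first.
    + by apply/measurable_EFinP; exact: mexpn.
    + by rewrite lee_fin mulr_ge0// exprn_ge0// ltW.
    apply: (@le_trans _ _ ((t ^+ 3 * 6)%:E * (2 * expR (2 ^+ 2 / 2))%:E)%E).
      apply: lee_wpmul2l; first by rewrite lee_fin mulr_ge0// exprn_ge0// ltW.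
      exact: normal_exp_norm_le.
    rewrite -EFinM lee_fin (_ : 2 ^+ 2 / 2 = 2 :> R); last by field.
    by rewrite le_eqVlt; apply/orP; left; apply/eqP; ring.
have H2 : `|expR (t ^+ 2 / 2) - 1 - t ^+ 2 / 2| <= t ^+ 3 * expR 1.
  have t2 : 0 <= t ^+ 2 / 2 by rewrite divr_ge0// sqr_ge0.
  apply: (le_trans (expR_sub1D_le _)); rewrite (ger0_norm t2).
  apply: ler_pM; rewrite ?exprn_ge0 ?expR_ge0//.
    rewrite expr_div_n -exprM -natrX (_ : (2 * 2 = 3 + 1)%N)// exprD expr1.
    rewrite -mulrA ler_piMr ?exprn_ge0 ?(ltW t0)//.
    by rewrite ler_pdivrMr ?ltr0n// mul1r (le_trans t1)// ler1n.
  rewrite ler_expR ler_pdivrMr// mul1r (@le_trans _ _ 1)// ?ler1n//.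
  by rewrite expr_le1// ltW.
rewrite (_ : t * m1 + _ = (expR (t ^+ 2 / 2) - 1 - t ^+ 2 / 2) -
  (expR (t ^+ 2 / 2) - 1 - t * m1 - t ^+ 2 / 2 * m2)); last by ring.
apply: (le_trans (ler_normB _ _)).
apply: (le_trans (lerD H2 H)).
by rewrite le_eqVlt; apply/orP; left; apply/eqP; ring.
Qed.

Let m1_eq0 : m1 = 0.
Proof.
apply: (@eq0_of_le_linear _ (12 * expR 2 + expR 1 + `|m2 - 1|)) => t /andP[t0 t1].
have := mexpansion; move=> /(_ t); rewrite t0 t1 => /(_ isT) H.
have e0 : 0 <= 12 * expR 2 + expR 1 :> R by rewrite addr_ge0// ?mulr_ge0// expR_ge0.
rewrite -(ler_pM2l t0) -{1}(gtr0_norm t0) -normrM.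
rewrite (_ : t * m1 = (t * m1 + t ^+ 2 / 2 * (m2 - 1)) - t ^+ 2 / 2 * (m2 - 1)); last by ring.
apply: (le_trans (ler_normB _ _)).
have t30 : t ^+ 3 <= t ^+ 2 by rewrite exprS ler_piMl// exprn_ge0// ltW.
have t20 : 0 <= t ^+ 2 by rewrite exprn_ge0// ltW.
have H3 : `|t ^+ 2 / 2 * (m2 - 1)| <= t ^+ 2 * `|m2 - 1|.
  rewrite normrM ler_wpM2r// ger0_norm ?divr_ge0//.
  by rewrite ler_pdivrMr// ler_peMr// ler1n.
have H4 := le_trans H (ler_wpM2r e0 t30).
apply: (le_trans (lerD H4 H3)).
by rewrite le_eqVlt; apply/orP; left; apply/eqP; ring.
Qed.

Let m2_eq1 : m2 = 1.
Proof.
suff : (m2 - 1) / 2 = 0 by move=> ?; lra.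
apply: (@eq0_of_le_linear _ (12 * expR 2 + expR 1)) => t /andP[t0 t1].
have := mexpansion; move=> /(_ t); rewrite t0 t1 m1_eq0 mulr0 add0r => /(_ isT).
rewrite -mulrA (mulrC 2^-1) normrM ger0_norm ?sqr_ge0// => H.
have t20 : 0 < t ^+ 2 by rewrite exprn_gt0.
by rewrite -(ler_pM2l t20) mulrA -exprSr.
Qed.

Lemma normal_mean0 : \int[N]_z z = 0.
Proof.
have -> : \int[N]_z z = \int[N]_z (s * (z / s)).
  by apply: eq_Rintegral => z _; rewrite mulrC divfK.
by rewrite RintegralZl// ?[X in s * X]m1_eq0 ?mulr0//; exact: integrable_normal_id.
Qed.

Lemma normal_second_moment : \int[N]_z z ^+ 2 = s ^+ 2.
Proof.
have -> : \int[N]_z z ^+ 2 = \int[N]_z (s ^+ 2 * (z / s) ^+ 2).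
  by apply: eq_Rintegral => z _; rewrite -exprMn mulrC divfK.
by rewrite RintegralZl// ?[X in _ * X]m2_eq1 ?mulr1//; exact: integrable_normal_sqr.
Qed.

Lemma integrable_normal_sqr_id : N.-integrable setT (EFin \o (fun z : R => z ^+ 2)).
Proof.
rewrite (_ : (fun z => z ^+ 2) = (fun z => s ^+ 2 * (z / s) ^+ 2)).
  by apply: integrable_scale; exact: integrable_normal_sqr.
by apply/funext => z; rewrite -exprMn mulrC divfK.
Qed.

End normal_moments.

(** The convolution operator of [nu]. Independent sums correspond to compositions: the mean of [f]
    over a sum of n i.i.d. terms is the n-th iterate applied to [f] at 0. *)
Definition translate_mean {R : realType} (nu : {measure set (measurableTypeR R) -> \bar R})
    (g : R -> R) (x : R) : R :=
  \int[nu]_z g (x + z).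

(** The size of a second order Taylor remainder: cubic near 0, where it must beat the variance,
    quadratic far away, where only a second moment is available. *)
Definition taylor_gauge {R : realType} (y : R) : R := Num.min (y ^+ 2) (`|y| ^+ 3).

(** * Trotter's central limit theorem *)

Section smoothing.
Context {R : realType}.
Variable s : R.
Hypothesis s0 : 0 < s.
Local Notation N := (normal_prob 0 s).
Variables (g : R -> R) (M : R).
Hypotheses (mg : measurable_fun setT g) (gM : forall x, `|g x| <= M).

Let sn0 : s != 0. Proof. by rewrite gt_eqF. Qed.

Let M0 : 0 <= M. Proof. exact: le_trans (gM 0). Qed.

Let E (y z : R) : R := expR (z / s * (y / s) - (y / s) ^+ 2 / 2).

Let mE y : measurable_fun setT (E y).
Proof.
apply: measurableT_comp => //; apply: measurable_funB => //.
by do 2 (apply: measurable_funM => //).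
Qed.

Let shift_ge0 y (h : R -> R) : measurable_fun setT h -> (forall x, 0 <= h x) ->
  (\int[N]_z (h (z + y))%:E = \int[N]_z (h z * E y z)%:E)%E.
Proof.
move=> mh h0; rewrite (@ge0_integral_normal_shift _ s y (EFin \o h))//; last exact/measurable_EFinP.
apply: eq_integral => z _; rewrite -EFinM /E; congr ((_ * expR _)%:E).
by field.
Qed.

Let intE y : (\int[N]_z (E y z)%:E = 1)%E.
Proof.
have := @shift_ge0 y (cst 1) (measurable_cst _) (fun _ => ler01).
have -> : (\int[N]_z (cst 1 (z + y))%:E = 1)%E.
  by rewrite (integral_cst N measurableT 1%E) mul1e; exact: (@probability_setT _ _ _ N).
by move=> h; rewrite [RHS]h; apply: eq_integral => z _; rewrite mul1r.
Qed.

Let iE y : N.-integrable setT (EFin \o E y).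
Proof.
apply: ge0_integrable; [exact: mE|by move=> z; exact: expR_ge0|].
by rewrite intE ltry.
Qed.

Let mgx x : measurable_fun setT (fun z : R => g (x + z)).
Proof. by apply: (measurableT_comp mg); apply: measurable_funD. Qed.

Let ione : N.-integrable setT (EFin \o (fun z : R => (1 : R))).
Proof. exact: finite_measure_integrable_cst. Qed.

Let shift x y : translate_mean N g (x + y) = \int[N]_z (g (x + z) * E y z).
Proof.
have igx (u : R) : N.-integrable setT (EFin \o (fun z : R => g (u + z))).
  have := integrable_bM ione (mgx u) (fun z => gM _).
  by under [X in _.-integrable _ (_ \o X)]eq_fun do rewrite mulr1.
have igE : N.-integrable setT (EFin \o (fun z : R => g (x + z) * E y z)).
  exact: (integrable_bM (iE y) (mgx x) (fun z => gM _)).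
have icM : N.-integrable setT (EFin \o (fun z : R => M)).
  exact: finite_measure_integrable_cst.
(* Adding [M] makes the integrand non-negative; its contribution cancels since the weight [E y] has
   integral one. *)
have := @shift_ge0 y (fun z : R => g (x + z) + M) (measurable_funD (mgx x) (measurable_cst _)).
have h0 z : 0 <= g (x + z) + M.
  by have := gM (x + z); rewrite ler_norml => /andP[]; lra.
move=> /(_ h0) /(congr1 fine).
rewrite -[LHS]/(\int[N]_z (g (x + (z + y)) + M)).
rewrite -[RHS]/(\int[N]_z ((g (x + z) + M) * E y z)).
under [RHS]eq_Rintegral do rewrite mulrDl.
under [LHS]eq_Rintegral do rewrite (addrC _ y) addrA.
rewrite (RintegralD measurableT (igx _) icM).
rewrite (RintegralD measurableT igE (integrable_scale M (iE y))).
rewrite RintegralZl//.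
rewrite [X in _ = _ + _ * X](_ : _ = 1); last by rewrite /Rintegral intE.
rewrite Rintegral_cst// (_ : fine (N setT) = 1); last by rewrite (@probability_setT _ _ _ N).
by move/addIr.
Qed.

(** With v = y / s and w = z / s, the weight exp (v w - v^2 / 2) generates the Hermite polynomials
    1, w, w^2 - 1; [rem] is what is left after order two in v. *)
Let rem y z := E y z - 1 - (y / s) * (z / s) - (y / s) ^+ 2 / 2 * ((z / s) ^+ 2 - 1).

Let mdiv : measurable_fun setT (fun z : R => z / s).
Proof. by apply: measurable_funM. Qed.

Let isq1 : N.-integrable setT (EFin \o (fun z : R => (z / s) ^+ 2 - 1)).
Proof. exact: (integrableB measurableT (integrable_normal_sqr s0) ione). Qed.

Let i1 y : N.-integrable setT (EFin \o (fun z : R => E y z - 1)).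
Proof. exact: (integrableB measurableT (iE y) ione). Qed.

Let i2 y : N.-integrable setT (EFin \o (fun z : R => E y z - 1 - (y / s) * (z / s))).
Proof.
exact: (integrableB measurableT (i1 y) (integrable_scale (y / s) (integrable_normal_id s0))).
Qed.

Let irem y : N.-integrable setT (EFin \o rem y).
Proof. exact: (integrableB measurableT (i2 y) (integrable_scale ((y / s) ^+ 2 / 2) isq1)). Qed.

Let taylor_rem x y :
  translate_mean N g (x + y) - translate_mean N g x
  - (\int[N]_z (g (x + z) * (z / s))) / s * y
  - (\int[N]_z (g (x + z) * ((z / s) ^+ 2 - 1))) / s ^+ 2 * y ^+ 2 / 2
  = \int[N]_z (g (x + z) * rem y z).
Proof.
have ig f : N.-integrable setT (EFin \o f) -> N.-integrable setT (EFin \o (fun z : R => g (x + z) * f z)).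
  by move=> fi; exact: (integrable_bM fi (mgx x) (fun z => gM _)).
rewrite shift.
have -> : \int[N]_z (g (x + z) * rem y z) = \int[N]_z (g (x + z) * E y z - g (x + z) * 1
    - y / s * (g (x + z) * (z / s)) - (y / s) ^+ 2 / 2 * (g (x + z) * ((z / s) ^+ 2 - 1))).
  by apply: eq_Rintegral => z _; rewrite /rem; ring.
have j1 := ig _ (iE y).
have j2 := ig _ ione.
have j3 := integrable_scale (y / s) (ig _ (integrable_normal_id s0)).
have j4 := integrable_scale ((y / s) ^+ 2 / 2) (ig _ isq1).
have k1 := integrableB measurableT j1 j2.
have k2 := integrableB measurableT k1 j3.
rewrite (RintegralB measurableT k2 j4) (RintegralB measurableT k1 j3) (RintegralB measurableT j1 j2).
rewrite RintegralZl//; last exact: ig _ (integrable_normal_id s0).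
rewrite RintegralZl//; last exact: ig _ isq1.
under [X in _ = _ - X - _ - _]eq_Rintegral do rewrite mulr1.
rewrite /translate_mean.
by field.
Qed.

(** The remainder is at most |v|^3 7 exp (2 (|w| + 1)), where 7 = 6 + 1 and 6 comes from
    [cube_le_expR]; the mean of exp (2 |w|) is at most 2 exp 2. *)
Let C1 : R := 14 * expR 4.
(** The weight has mean 1 <= |v|^2, and the other terms are at most 4 |v|^2 exp |w|, whose mean is
    at most 8 |v|^2 exp (1/2). *)
Let C2 : R := 1 + 8 * expR 1.

Let mexpn (c : R) : measurable_fun setT (fun z : R => expR (c * `|z / s|)).
Proof.
apply: measurableT_comp => //; apply: measurable_funM => //.
by apply: measurableT_comp => //; apply: measurable_funM.
Qed.

Let bound_small x y : `|y| <= s ->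
  `|\int[N]_z (g (x + z) * rem y z)| <= M * (`|y / s| ^+ 3 * C1).
Proof.
move=> ys.
have v1 : `|y / s| <= 1 by rewrite normrM normfV (gtr0_norm s0) ler_pdivrMr// mul1r.
set v := y / s in v1 *.
apply: (@le_Rintegral_bound _ _ _ N _ (fun z : R => M * (`|v| ^+ 3 * (7 * expR 2)) * expR (2 * `|z / s|))).
- exact: (integrable_bM (irem y) (mgx x) (fun z => gM _)).
- move=> z; rewrite normrM -mulrA; apply: ler_pM => //.
  set w := z / s; rewrite /rem /E -/w -/v.
  set u := w * v - v ^+ 2 / 2.
  have uT := expR_taylor2 u.
  have ub : `|u| <= `|v| * (`|w| + 1).
    apply: (le_trans (ler_normB _ _)); rewrite normrM mulrDr mulr1 (mulrC `|w|) lerD//.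
    rewrite ger0_norm ?divr_ge0 ?sqr_ge0// -real_normK ?num_real// expr2 -mulrA ler_piMr//.
    by rewrite ler_pdivrMr// mul1r (le_trans v1)// ler1n.
  have w1 : 0 <= `|w| + 1 by rewrite addr_ge0.
  have ub1 : `|u| <= `|w| + 1 by apply: (le_trans ub); rewrite ler_piMl.
  have u3 : `|u| ^+ 3 * expR `|u| <= `|v| ^+ 3 * (6 * expR (2 * (`|w| + 1))).
    apply: (@le_trans _ _ ((`|v| * (`|w| + 1)) ^+ 3 * expR (`|w| + 1))).
      apply: ler_pM; rewrite ?exprn_ge0 ?expR_ge0 ?ler_expR//.
      by rewrite lerXn2r ?nnegrE ?mulr_ge0.
    rewrite exprMn -(mulrA (`|v| ^+ 3)) ler_wpM2l ?exprn_ge0//.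
    have := cube_le_expR (`|w| + 1); rewrite (ger0_norm w1) => hc.
    have -> : 2 * (`|w| + 1) = (`|w| + 1) + (`|w| + 1) by ring.
    by rewrite (expRD (`|w| + 1) (`|w| + 1)) mulrA ler_wpM2r ?expR_ge0.
  (* In u^2 / 2 with u = w v - v^2 / 2, the terms up to order two in v reproduce the Hermite terms;
     the rest is the explicit multiple of v^3. *)
  have rE : expR u - 1 - v * w - v ^+ 2 / 2 * (w ^+ 2 - 1) =
     (expR u - 1 - u - u ^+ 2 / 2) + v ^+ 3 * (v / 8 - w / 2).
    by rewrite /u; field.
  rewrite rE; apply: (le_trans (ler_normD _ _)).
  have r2 : `|v ^+ 3 * (v / 8 - w / 2)| <= `|v| ^+ 3 * expR (2 * (`|w| + 1)).
    rewrite normrM normrX ler_wpM2l ?exprn_ge0//.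
    apply: (le_trans (ler_normB _ _)).
    have := expR_ge1Dx (2 * (`|w| + 1)).
    have n8 a : `|a / 8| = `|a| / 8 :> R by rewrite normrM normfV (ger0_norm (ler0n R 8)).
    have n2 a : `|a / 2| = `|a| / 2 :> R by rewrite normrM normfV (ger0_norm (ler0n R 2)).
    rewrite n8 n2; have := normr_ge0 w; have := normr_ge0 v.
    lra.
  have eE : expR (2 * (`|w| + 1)) = expR 2 * expR (2 * `|w|).
    by rewrite -expRD; congr expR; ring.
  apply: (le_trans (lerD (le_trans uT u3) r2)); rewrite eE.
  by rewrite le_eqVlt; apply/orP; left; apply/eqP; ring.
- by apply: measurable_funM => //; exact: mexpn.
- under eq_integral do rewrite EFinM.
  have c0 : 0 <= M * (`|v| ^+ 3 * (7 * expR 2)) by rewrite !mulr_ge0// ?exprn_ge0// expR_ge0.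
  rewrite ge0_integralZl//; last by apply/measurable_EFinP; exact: mexpn.
  apply: (@le_trans _ _ ((M * (`|v| ^+ 3 * (7 * expR 2)))%:E * (2 * expR (2 ^+ 2 / 2))%:E)%E).
    by apply: lee_wpmul2l; [rewrite lee_fin|exact: normal_exp_norm_le].
  rewrite -EFinM lee_fin /C1.
  have -> : 2 ^+ 2 / 2 = 2 :> R by field.
  have -> : expR 4 = expR 2 * expR 2 :> R by rewrite -expRD; congr expR; ring.
  by rewrite le_eqVlt; apply/orP; left; apply/eqP; ring.
Qed.

Let bound_large x y : s < `|y| ->
  `|\int[N]_z (g (x + z) * rem y z)| <= M * (`|y / s| ^+ 2 * C2).
Proof.
move=> ys.
have v1 : 1 <= `|y / s| by rewrite normrM normfV (gtr0_norm s0) ler_pdivlMr// mul1r ltW.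
set v := y / s in v1 *.
have v2 : `|v| <= `|v| ^+ 2 by rewrite expr2 ler_peMl.
have v12 : 1 <= `|v| ^+ 2 by exact: le_trans v2.
apply: (@le_Rintegral_bound _ _ _ N _ (fun z : R => M * (E y z + `|v| ^+ 2 * 4 * expR (1 * `|z / s|)))).
- exact: (integrable_bM (irem y) (mgx x) (fun z => gM _)).
- move=> z; rewrite normrM; apply: ler_pM => //.
  rewrite /rem -/v; set w := z / s.
  apply: (le_trans (ler_normB _ _)).
  have h1 : `|E y z - 1 - v * w| <= E y z + 1 + `|v| * `|w|.
    apply: (le_trans (ler_normB _ _)); rewrite normrM lerD//.
    by apply: (le_trans (ler_normB _ _)); rewrite normr1 ger0_norm// expR_ge0.
  have h2 : `|v ^+ 2 / 2 * (w ^+ 2 - 1)| <= `|v| ^+ 2 / 2 * (`|w| ^+ 2 + 1).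
    have n2 : `|v ^+ 2 / 2| = `|v| ^+ 2 / 2.
      by rewrite normrM normfV (ger0_norm (ler0n R 2)) normrX.
    rewrite normrM n2; apply: ler_wpM2l; first by rewrite divr_ge0// exprn_ge0.
    by apply: (le_trans (ler_normB _ _)); rewrite normr1 normrX.
  apply: (le_trans (lerD h1 h2)).
  rewrite -!addrA lerD// mul1r.
  have e1 := norm_le_expR w; have e2 := sqr_le_expR w.
  have e3 : 1 <= expR `|w| by rewrite -expR0 ler_expR.
  rewrite -real_normK ?num_real// in e2.
  have q1 : `|v| * `|w| <= `|v| ^+ 2 * expR `|w| by apply: ler_pM.
  have q2 : `|v| ^+ 2 * (`|w| ^+ 2 + 1) <= `|v| ^+ 2 * (3 * expR `|w|).
    by rewrite ler_wpM2l ?exprn_ge0//; lra.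
  have q3 : 1 <= `|v| ^+ 2 * expR `|w|.
    by rewrite -[1]mulr1; apply: ler_pM.
  lra.
- apply: measurable_funM => //; apply: measurable_funD; first exact: mE.
  by apply: measurable_funM => //; exact: mexpn.
- under eq_integral do rewrite EFinM EFinD EFinM.
  have c0 : 0 <= `|v| ^+ 2 * 4 by rewrite mulr_ge0// exprn_ge0.
  have meE : measurable_fun setT (EFin \o E y) by apply/measurable_EFinP; exact: mE.
  have meX : measurable_fun setT (EFin \o (fun z : R => expR (1 * `|z / s|))).
    by apply/measurable_EFinP; exact: mexpn.
  have meXc : measurable_fun setT (fun z : R => (`|v| ^+ 2 * 4)%:E * (expR (1 * `|z / s|)%R)%:E)%E.
    by apply: emeasurable_funM.
  have meS : measurable_fun setT (fun z : R => (E y z)%:E +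
      (`|v| ^+ 2 * 4)%:E * (expR (1 * `|z / s|)%R)%:E)%E by apply: emeasurable_funD.
  have E0 z : (0 <= (E y z)%:E)%E by rewrite lee_fin expR_ge0.
  rewrite ge0_integralZl//; last by move=> z _; rewrite adde_ge0.
  rewrite ge0_integralD//.
  rewrite intE ge0_integralZl//.
  rewrite [leRHS]EFinM; apply: lee_wpmul2l; first by rewrite lee_fin.
  apply: (@le_trans _ _ (1 + (`|v| ^+ 2 * 4)%:E * (2 * expR (1 ^+ 2 / 2))%:E)%E).
    by apply: leeD2l; apply: lee_wpmul2l; [rewrite lee_fin|exact: normal_exp_norm_le].
  rewrite -EFinM -EFinD lee_fin /C2.
  have -> : `|v| ^+ 2 * (1 + 8 * expR 1) =
     `|v| ^+ 2 + `|v| ^+ 2 * 4 * (2 * expR 1) :> R by ring.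
  apply: lerD => //; apply: ler_wpM2l => //.
  by rewrite ler_wpM2l// ler_expR; lra.
Qed.

(** The witnesses [a] and [b] are the first two derivatives of the smoothed function. All
    differentiation falls on the Gaussian weight, so [g] is only bounded and measurable and [C] is
    uniform in [x]. *)
Lemma normal_smooth_taylor : exists (a b : R -> R) (C : R), 0 <= C /\ forall x y : R,
  `|translate_mean N g (x + y) - translate_mean N g x - a x * y - b x * y ^+ 2 / 2|
    <= C * taylor_gauge y.
Proof.
exists (fun x => (\int[N]_z (g (x + z) * (z / s))) / s).
exists (fun x => (\int[N]_z (g (x + z) * ((z / s) ^+ 2 - 1))) / s ^+ 2).
exists (M * ((C1 + C2) * ((s ^+ 3)^-1 + (s ^+ 2)^-1))).
have C10 : 0 <= C1 by rewrite mulr_ge0// expR_ge0.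
have C20 : 0 <= C2 by rewrite addr_ge0// mulr_ge0// expR_ge0.
have s30 : 0 <= (s ^+ 3)^-1 by rewrite invr_ge0 exprn_ge0// ltW.
have s20 : 0 <= (s ^+ 2)^-1 by rewrite invr_ge0 exprn_ge0// ltW.
split; first by rewrite !mulr_ge0// addr_ge0.
move=> x y; rewrite taylor_rem -mulrA /taylor_gauge minr_pMr; last first.
  by rewrite mulr_ge0// addr_ge0.
have y20 : 0 <= y ^+ 2 by exact: sqr_ge0.
have y30 : 0 <= `|y| ^+ 3 by exact: exprn_ge0.
have yE : y ^+ 2 = `|y| ^+ 2 by rewrite real_normK ?num_real.
have vE k : `|y / s| ^+ k = `|y| ^+ k * (s ^+ k)^-1.
  by rewrite normrM normfV (gtr0_norm s0) exprMn exprVn.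
(* To be read with a = s^-3, b = s^-2, p = |y|^3, q = y^2. In each regime the quantity just bounded
   is the smaller of p a and q b, hence lies below both branches of the minimum after enlarging the
   constant. *)
have key (a b p q : R) : 0 <= a -> 0 <= b -> 0 <= p -> 0 <= q ->
    (p * a <= q * b -> p * a * C1 <= Num.min ((C1 + C2) * (a + b) * q) ((C1 + C2) * (a + b) * p)) /\
    (q * b <= p * a -> q * b * C2 <= Num.min ((C1 + C2) * (a + b) * q) ((C1 + C2) * (a + b) * p)).
  move=> a0 b0 p0 q0.
  have aq1 : 0 <= C1 * a * q by rewrite !mulr_ge0.
  have bq1 : 0 <= C1 * b * q by rewrite !mulr_ge0.
  have ap1 : 0 <= C1 * a * p by rewrite !mulr_ge0.
  have bp1 : 0 <= C1 * b * p by rewrite !mulr_ge0.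
  have aq2 : 0 <= C2 * a * q by rewrite !mulr_ge0.
  have bq2 : 0 <= C2 * b * q by rewrite !mulr_ge0.
  have ap2 : 0 <= C2 * a * p by rewrite !mulr_ge0.
  have bp2 : 0 <= C2 * b * p by rewrite !mulr_ge0.
  split=> h; rewrite le_min; apply/andP; split.
  - by have := ler_wpM2r C10 h; lra.
  - by lra.
  - by lra.
  - by have := ler_wpM2r C20 h; lra.
have [k1 k2] := key _ _ _ _ s30 s20 y30 y20.
have yE3 : `|y| ^+ 3 * (s ^+ 3)^-1 = y ^+ 2 * (s ^+ 2)^-1 * (`|y| / s).
  by rewrite yE; field.
have ys20 : 0 <= y ^+ 2 * (s ^+ 2)^-1 by rewrite mulr_ge0.
have [ys|ys] := leP `|y| s.
  apply: (le_trans (bound_small x ys)); rewrite ler_wpM2l// vE.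
  by apply: k1; rewrite yE3 ler_piMr// ler_pdivrMr// mul1r.
apply: (le_trans (bound_large x ys)); rewrite ler_wpM2l// vE -yE.
by apply: k2; rewrite yE3 ler_peMr// ler_pdivlMr// mul1r ltW.
Qed.

End smoothing.

(** * Convolution operators on bounded measurable functions *)

Lemma bounded_integrable d (T : measurableType d) (R : realType)
    (P : probability T R) (g : T -> R) (M : R) :
  measurable_fun setT g -> (forall x, `|g x| <= M) ->
  P.-integrable setT (EFin \o g).
Proof.
move=> mg gM; apply: (@integrable_le _ _ _ P g (cst M)) => //.
exact: finite_measure_integrable_cst.
Qed.

Lemma probability_Rintegral_cst d (T : measurableType d) (R : realType)
    (P : probability T R) (c : R) : \int[P]_x c = c.
Proof.
by rewrite Rintegral_cst// (_ : fine (P setT) = 1) ?mulr1// (@probability_setT _ _ _ P).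
Qed.

Lemma probability_Rintegral_le d (T : measurableType d) (R : realType)
    (P : probability T R) (g : T -> R) (M : R) :
  measurable_fun setT g -> (forall x, `|g x| <= M) -> `|\int[P]_x g x| <= M.
Proof.
move=> mg gM; apply: (@le_Rintegral_bound _ _ _ P g (cst M)) => //.
  exact: (bounded_integrable P mg gM).
suff -> : (\int[P]_x (cst M x)%:E = M%:E)%E by [].
transitivity (M%:E * P setT)%E; first exact: (integral_cst P measurableT M%:E).
by rewrite (@probability_setT _ _ _ P) mule1.
Qed.

Section translate_mean.
Context {R : realType}.
Local Notation prob := (probability (measurableTypeR R) R).
Implicit Types (nu : prob) (g h : R -> R) (M x y : R).

Definition bounded_measurable g := measurable_fun setT g /\ exists M, forall x, `|g x| <= M.

Lemma measurable_translate g x : measurable_fun setT g ->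
  measurable_fun setT (fun z : R => g (x + z)).
Proof. by move=> mg; apply: (measurableT_comp mg); apply: measurable_funD. Qed.

Lemma integrable_translate nu g x : bounded_measurable g ->
  nu.-integrable setT (EFin \o (fun z : R => g (x + z))).
Proof.
move=> [mg [M gM]]; apply: (@bounded_integrable _ _ _ nu _ M).
  exact: measurable_translate.
by move=> z; exact: gM.
Qed.

Lemma translate_mean_le nu g M : measurable_fun setT g -> (forall x, `|g x| <= M) ->
  forall x, `|translate_mean nu g x| <= M.
Proof.
move=> mg gM x; apply: (@probability_Rintegral_le _ _ _ nu) => //.
exact: measurable_translate.
Qed.

Lemma translate_meanD_EFin nu g M x : measurable_fun setT g -> (forall x, `|g x| <= M) ->
  (\int[nu]_z (g (x + z) + M)%:E)%E = (translate_mean nu g x + M)%:E.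
Proof.
move=> mg gM.
have ig : nu.-integrable setT (EFin \o (fun z : R => g (x + z))).
  by apply: integrable_translate; split => //; exists M.
have ic : nu.-integrable setT (EFin \o (fun z : R => M)).
  exact: finite_measure_integrable_cst.
rewrite (RintegralE (integrableD measurableT ig ic)).
by rewrite (RintegralD measurableT ig ic) probability_Rintegral_cst.
Qed.

Let shifted_ge0 g M x : (forall x, `|g x| <= M) -> 0 <= g x + M.
Proof. by move=> /(_ x); rewrite ler_norml => /andP[]; lra. Qed.

Lemma measurable_translate_mean nu g : bounded_measurable g ->
  measurable_fun setT (translate_mean nu g).
Proof.
move=> [mg [M gM]].
have mF : measurable_fun setT (fun xz : R * R => (g (xz.1 + xz.2) + M)%:E).
  apply/measurable_EFinP; apply: measurable_funD => //.
  apply: (measurableT_comp mg); apply: measurable_funD.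
    exact: measurable_fst.
  exact: measurable_snd.
have F0 xz : (0 <= (g (xz.1 + xz.2) + M)%:E)%E by rewrite lee_fin shifted_ge0.
have := @measurable_fun_fubini_tonelli_F _ _ (measurableTypeR R) (measurableTypeR R) R nu _ mF F0.
rewrite /fubini_F /=; under eq_fun do rewrite (@translate_meanD_EFin nu _ _ _ mg gM).
move=> /measurable_EFinP h.
rewrite (_ : translate_mean nu g = (fun x => (translate_mean nu g x + M) - M)).
  exact: measurable_funB.
by apply/funext => x; rewrite addrK.
Qed.

Lemma bounded_measurable_translate_mean nu g : bounded_measurable g ->
  bounded_measurable (translate_mean nu g).
Proof.
move=> bg; split; first exact: measurable_translate_mean.
by case: bg => mg [M gM]; exists M; exact: translate_mean_le.
Qed.

(** Tonelli, applied to the non-negative function g + M; the constant is removed at the end. *)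
Lemma translate_meanC nu nu' g x : bounded_measurable g ->
  translate_mean nu (translate_mean nu' g) x = translate_mean nu' (translate_mean nu g) x.
Proof.
move=> bg; have [mg [M gM]] := bg.
apply: (@addIr _ M); apply: EFin_inj.
have m1 := measurable_translate_mean nu bg.
have m2 := measurable_translate_mean nu' bg.
rewrite -(translate_meanD_EFin nu x m2 (translate_mean_le nu' mg gM)).
rewrite -(translate_meanD_EFin nu' x m1 (translate_mean_le nu mg gM)).
under eq_integral do rewrite -(translate_meanD_EFin _ _ mg gM).
under [RHS]eq_integral do rewrite -(translate_meanD_EFin _ _ mg gM).
rewrite (@fubini_tonelli _ _ (measurableTypeR R) (measurableTypeR R) R nu nu'
   (fun zw : R * R => (g (x + zw.1 + zw.2) + M)%:E))/=.
- by apply: eq_integral => z _; apply: eq_integral => w _; rewrite addrAC.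
- apply/measurable_EFinP; apply: measurable_funD => //.
  apply: (measurableT_comp mg); apply: measurable_funD.
    by apply: measurable_funD => //; exact: measurable_fst.
  exact: measurable_snd.
- by move=> zw; rewrite lee_fin shifted_ge0.
Qed.

Lemma translate_meanB nu g h x : bounded_measurable g -> bounded_measurable h ->
  translate_mean nu (fun y => g y - h y) x = translate_mean nu g x - translate_mean nu h x.
Proof.
by move=> bg bh; rewrite /translate_mean RintegralB//; exact: integrable_translate.
Qed.

Lemma bounded_measurableB g h : bounded_measurable g -> bounded_measurable h ->
  bounded_measurable (fun y => g y - h y).
Proof.
move=> [mg [M gM]] [mh [M' hM]]; split; first exact: measurable_funB.
by exists (M + M') => x; rewrite (le_trans (ler_normB _ _))// lerD.
Qed.

Lemma bounded_measurable_iter nu g n : bounded_measurable g ->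
  bounded_measurable (iter n (translate_mean nu) g).
Proof. by move=> bg; elim: n => //= n; exact: bounded_measurable_translate_mean. Qed.

Lemma translate_mean_dist nu g h D : bounded_measurable g -> bounded_measurable h ->
  (forall x, `|g x - h x| <= D) ->
  forall x, `|translate_mean nu g x - translate_mean nu h x| <= D.
Proof.
move=> bg bh gh x; rewrite -translate_meanB//; apply: translate_mean_le => //.
by case: (bounded_measurableB bg bh).
Qed.

Lemma iter_translate_mean_dist nu g h D n : bounded_measurable g -> bounded_measurable h ->
  (forall x, `|g x - h x| <= D) ->
  forall x, `|iter n (translate_mean nu) g x - iter n (translate_mean nu) h x| <= D.
Proof.
move=> bg bh gh; elim: n => //= n IH.
by apply: translate_mean_dist => //; exact: bounded_measurable_iter.
Qed.

Lemma iter_translate_meanC nu nu' g n : bounded_measurable g ->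
  iter n (translate_mean nu) (translate_mean nu' g) =
  translate_mean nu' (iter n (translate_mean nu) g).
Proof.
move=> bg; elim: n => //= n ->; apply/funext => x.
by apply: translate_meanC; exact: bounded_measurable_iter.
Qed.

(* Trotter's comparison of two commuting contractions. *)
Lemma iter_translate_mean_compare nu nu' g D n : bounded_measurable g ->
  (forall x, `|translate_mean nu g x - translate_mean nu' g x| <= D) ->
  forall x, `|iter n (translate_mean nu) g x - iter n (translate_mean nu') g x| <= n%:R * D.
Proof.
move=> bg gD; elim: n => [|n IH] x; first by rewrite subrr normr0 mul0r.
(* The pivot is n steps of [nu] after one step of [nu']. Against n + 1 steps of [nu] it errs by [D],
   by contraction; against n + 1 steps of [nu'] the single step commutes to the outside and the
   induction hypothesis applies. *)
rewrite [iter n.+1 (translate_mean nu) g]iterSr.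
rewrite -(subrK (iter n (translate_mean nu) (translate_mean nu' g) x) (iter n _ _ x)).
rewrite -addrA -natr1 mulrDl mul1r addrC.
apply: (le_trans (ler_normD _ _)); apply: lerD; last first.
  by apply: iter_translate_mean_dist => //; exact: bounded_measurable_translate_mean.
rewrite iter_translate_meanC//=; apply: translate_mean_dist => //;
  exact: bounded_measurable_iter.
Qed.

Lemma taylor_gauge_ge0 y : 0 <= taylor_gauge y.
Proof. by rewrite /taylor_gauge le_min sqr_ge0 exprn_ge0. Qed.

Lemma taylor_gauge_le y : taylor_gauge y <= y ^+ 2.
Proof. by rewrite /taylor_gauge ge_min lexx. Qed.

Lemma measurable_taylor_gauge : measurable_fun setT (@taylor_gauge R).
Proof.
apply: measurable_minr; first exact: exprn_measurable.
by apply: measurable_funX; exact: normr_measurable.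
Qed.

Lemma integrable_taylor_gauge nu : nu.-integrable setT (EFin \o (fun y : R => y ^+ 2)) ->
  nu.-integrable setT (EFin \o (@taylor_gauge R)).
Proof.
move=> i2; apply: (integrable_le i2) => [|y]; first exact: measurable_taylor_gauge.
by rewrite ger0_norm ?taylor_gauge_ge0// taylor_gauge_le.
Qed.

(** The first order term integrates to zero and the second depends on [nu] only through its
    variance, so both disappear from the difference of two centred laws of equal variance. *)
Lemma translate_mean_taylor nu g (a b : R -> R) (C w : R) : 0 <= C ->
  bounded_measurable g ->
  (forall x y, `|g (x + y) - g x - a x * y - b x * y ^+ 2 / 2| <= C * taylor_gauge y) ->
  nu.-integrable setT (EFin \o (fun y : R => y ^+ 2)) ->
  \int[nu]_y y = 0 -> \int[nu]_y y ^+ 2 = w ->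
  forall x, `|translate_mean nu g x - g x - b x * w / 2| <= C * \int[nu]_y taylor_gauge y.
Proof.
move=> C0 bg gT i2 e1 e2 x.
have ione : nu.-integrable setT (EFin \o (fun _ : R => (1 : R))).
  exact: finite_measure_integrable_cst.
have i1 : nu.-integrable setT (EFin \o (fun y : R => y)).
  apply: (integrable_le (integrableD measurableT ione i2)) => // y /=.
  have [y1|y1] := leP `|y| 1; first by rewrite ler_wpDr// sqr_ge0.
  by rewrite -real_normK ?num_real// ler_wpDl// expr2 ler_peMl// ltW.
have ig := integrable_translate nu x bg.
have ic := integrable_scale (g x) ione.
have ia := integrable_scale (a x) i1.
have ib := integrable_scale (b x / 2) i2.
have d1 := integrableB measurableT ig ic.
have d2 := integrableB measurableT d1 ia.
have d3 := integrableB measurableT d2 ib.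
have igau := integrable_taylor_gauge i2.
have -> : translate_mean nu g x - g x - b x * w / 2 =
    \int[nu]_y (g (x + y) - g x * 1 - a x * y - b x / 2 * y ^+ 2).
  rewrite (RintegralB measurableT d2 ib) (RintegralB measurableT d1 ia).
  rewrite (RintegralB measurableT ig ic) !RintegralZl// e1 e2.
  rewrite probability_Rintegral_cst /translate_mean; ring.
apply: (@le_Rintegral_bound _ _ _ nu _ (fun y => C * taylor_gauge y)).
- exact: d3.
- move=> y; apply: le_trans (gT x y).
  by rewrite le_eqVlt; apply/orP; left; apply/eqP; congr `|_|; ring.
- by apply: measurable_funM => //; exact: measurable_taylor_gauge.
- by rewrite (RintegralE (integrable_scale C igau)) RintegralZl.
Qed.

End translate_mean.

(** * The Gaussian convolution semigroup *)

Section normal_semigroup.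
Context {R : realType}.
Local Notation N s := (normal_prob 0 s : probability (measurableTypeR R) R).
Implicit Types (g : R -> R) (s t x y : R).

Lemma translate_mean_normal_convolution s t r g x :
  0 < s -> 0 < t -> 0 < r -> r ^+ 2 = s ^+ 2 + t ^+ 2 -> bounded_measurable g ->
  translate_mean (N s) (translate_mean (N t) g) x = translate_mean (N r) g x.
Proof.
move=> s0 t0 r0 rE bg; have [mg [M gM]] := bg.
have h0 y : 0 <= g y + M.
  by have := gM y; rewrite ler_norml => /andP[]; lra.
apply: (@addIr _ M); apply: EFin_inj.
have m1 : measurable_fun setT (translate_mean (N t) g).
  exact: (measurable_translate_mean (normal_prob 0 t) bg).
have mgx : measurable_fun setT (fun z : R => (g (x + z) + M)%:E).
  by apply/measurable_EFinP; apply: measurable_funD => //; exact: measurable_translate.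
have E1 := translate_meanD_EFin (N s) x m1 (translate_mean_le (N t) mg gM).
have E2 := translate_meanD_EFin (N r) x mg gM.
have E3 := @ge0_integral_normal_convolution _ s t r _ s0 t0 r0 rE mgx (fun z => h0 (x + z)).
apply: (etrans (esym E1)); apply: etrans E2; apply: etrans E3.
apply: eq_integral => z _; apply: (etrans (esym (translate_meanD_EFin (N t) _ mg gM))).
by apply: eq_integral => w _; rewrite addrA.
Qed.

(** Exact stability: with t = sqrt (v / n) the n-step Gaussian operator does not depend on n, so the
    comparison needs no further limit on the Gaussian side. *)
Lemma iter_translate_mean_normal n t g x : 0 < t -> bounded_measurable g ->
  iter n.+1 (translate_mean (N t)) g x = translate_mean (N (t * Num.sqrt n.+1%:R)) g x.
Proof.
move=> t0 bg; elim: n x => [|n IH] x; first by rewrite /= sqrtr1 mulr1.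
have q0 k : 0 < t * Num.sqrt k.+1%:R by rewrite mulr_gt0// sqrtr_gt0 ltr0n.
rewrite iterS.
have -> : iter n.+1 (translate_mean (N t)) g = translate_mean (N (t * Num.sqrt n.+1%:R)) g.
  by apply/funext => y; exact: IH.
apply: translate_mean_normal_convolution => //.
by rewrite !exprMn !sqr_sqrtr// -[in LHS]natr1; ring.
Qed.

(** The cost of smoothing is K times the mean of |z|, and |z| <= s exp |z / s| reduces it to the
    exponential moment. *)
Lemma translate_mean_normal_lipschitz s K f : 0 < s -> bounded_measurable f -> 0 <= K ->
  (forall x y, `|f x - f y| <= K * `|x - y|) ->
  forall x, `|translate_mean (N s) f x - f x| <= K * (s * (2 * expR (1 / 2))).
Proof.
move=> s0 bf K0 fK x; have [mf [M fM]] := bf.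
have sn0 : s != 0 by rewrite gt_eqF.
have ic : (normal_prob 0 s).-integrable setT (EFin \o (fun _ : R => f x)).
  exact: finite_measure_integrable_cst.
have ig := integrable_translate (normal_prob 0 s) x bf.
have -> : translate_mean (N s) f x - f x = \int[normal_prob 0 s]_z (f (x + z) - f x).
  by rewrite (RintegralB measurableT ig ic) (@probability_Rintegral_cst _ _ _ (normal_prob 0 s)).
have mexpn : measurable_fun setT (fun z : R => expR (1 * `|z / s|)).
  apply: measurableT_comp => //; apply: measurable_funM => //.
  by apply: measurableT_comp => //; apply: measurable_funM.
apply: (@le_Rintegral_bound _ _ _ (normal_prob 0 s) _ (fun z : R => (K * s) * expR (1 * `|z / s|))).
- exact: (integrableB measurableT ig ic).
- move=> z; apply: (le_trans (fK _ _)).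
  rewrite (_ : x + z - x = z); last by rewrite addrC addKr.
  rewrite -mulrA ler_wpM2l// mul1r.
  have -> : `|z| = s * `|z / s|.
    by rewrite normrM normfV (gtr0_norm s0) mulrCA divff// mulr1.
  by rewrite ler_wpM2l ?(ltW s0)// norm_le_expR.
- by apply: measurable_funM.
- under eq_integral do rewrite EFinM.
  have Ks : 0 <= K * s by rewrite mulr_ge0// ltW.
  rewrite ge0_integralZl//; last by apply/measurable_EFinP.
  rewrite (mulrA K) [leRHS]EFinM; apply: lee_wpmul2l; first by rewrite lee_fin.
  by have := normal_exp_norm_le s0 (ler01); rewrite expr1n.
Qed.

Lemma normal_taylor_gauge_le s : 0 < s ->
  \int[normal_prob 0 s]_y taylor_gauge y <= s ^+ 3 * (12 * expR (1 / 2)).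
Proof.
move=> s0; apply: le_trans (ler_norm _) _.
apply: (@le_Rintegral_bound _ _ _ (normal_prob 0 s) _ (fun z : R => `|z| ^+ 3)).
- apply: (@integrable_taylor_gauge _ (normal_prob 0 s)); exact: integrable_normal_sqr_id.
- by move=> y; rewrite ger0_norm ?taylor_gauge_ge0// /taylor_gauge ge_min lexx orbT.
- by apply: measurable_funX; exact: normr_measurable.
- exact: normal_abs_cube_le.
Qed.

End normal_semigroup.

(** * Convergence of iterated convolution operators *)

Section clt_core.
Context {R : realType}.
Local Notation prob := (probability (measurableTypeR R) R).

Lemma lipschitz_measurable (K : R) (f : R -> R) :
  (forall x y, `|f x - f y| <= K * `|x - y|) -> continuous f.
Proof.
move=> fK x; apply/cvgrPdist_le => /= e e0; near=> y.
apply: (le_trans (fK _ _)).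
have K1 : 0 < `|K| + 1 by rewrite ltr_wpDl.
apply: (@le_trans _ _ ((`|K| + 1) * `|x - y|)).
  by rewrite ler_wpM2r//; apply: (le_trans (ler_norm _)); rewrite lerDl.
rewrite mulrC -ler_pdivlMr//; near: y; apply: cvgr_dist_le => //.
by rewrite divr_gt0.
Unshelve. all: by end_near. Qed.

(** The limit enters as a functional [L] that the n-step operator of [N n] realises exactly; the
    Gaussian limit and the degenerate one of variance zero are thus both instances. *)
Lemma iter_translate_mean_cvg (A N : nat -> prob) (v : R) (L : (R -> R) -> R) :
  (forall n, (0 < n)%N -> [/\ (A n).-integrable setT (EFin \o (fun y : R => y ^+ 2)),
     \int[A n]_y y = 0 & \int[A n]_y y ^+ 2 = v / n%:R]) ->
  (forall n, (0 < n)%N -> [/\ (N n).-integrable setT (EFin \o (fun y : R => y ^+ 2)),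
     \int[N n]_y y = 0 & \int[N n]_y y ^+ 2 = v / n%:R]) ->
  (n%:R * \int[A n]_y taylor_gauge y @[n --> \oo] --> (0 : R)) ->
  (n%:R * \int[N n]_y taylor_gauge y @[n --> \oo] --> (0 : R)) ->
  (forall n g, (0 < n)%N -> bounded_measurable g ->
     iter n (translate_mean (N n)) g 0 = L g) ->
  forall (f : R -> R) (K M : R), (forall x y, `|f x - f y| <= K * `|x - y|) ->
    (forall x, `|f x| <= M) ->
  iter n (translate_mean (A n)) f 0 @[n --> \oo] --> L f.
Proof.
move=> HA HN gA gN HL f K M fK fM.
have mf : measurable_fun setT f.
  by apply: continuous_measurable_fun; exact: lipschitz_measurable fK.
have bf : bounded_measurable f by split => //; exists M.
have K0 : 0 <= K by have := le_trans (normr_ge0 _) (fK 1 0); rewrite subr0 normr1 mulr1.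
apply/cvgrPdist_le => /= e e0.
pose c : R := 2 * expR (1 / 2).
have c0 : 0 < c by rewrite mulr_gt0// expR_gt0.
(* The smoothing scale depends on [e] and [K] only and is fixed before [n], because the Taylor
   constant [C] depends on it. The [+ 1] covers K = 0. *)
pose s := e / 3 / ((K + 1) * c).
have s0 : 0 < s by rewrite !divr_gt0// mulr_gt0// ltr_wpDl.
have sK : K * (s * c) <= e / 3.
  have -> : K * (s * c) = e / 3 * (K / (K + 1)).
    by rewrite /s; field; rewrite !gt_eqF// ltr_wpDl.
  rewrite ler_piMr//; first by rewrite divr_ge0// ltW.
  by rewrite ler_pdivrMr ?ltr_wpDl// mul1r lerDl.
pose h := translate_mean (normal_prob 0 s) f.
have bh : bounded_measurable h.
  exact: (bounded_measurable_translate_mean (normal_prob 0 s)).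
have hf x : `|h x - f x| <= e / 3.
  exact: le_trans (translate_mean_normal_lipschitz s0 bf K0 fK x) sK.
have [a [b [C [C0 hT]]]] := normal_smooth_taylor s0 mf fM.
have gsum : C * (n%:R * \int[A n]_y taylor_gauge y + n%:R * \int[N n]_y taylor_gauge y)
   @[n --> \oo] --> (0 : R).
  have cC : (fun _ : nat => C) @ \oo --> C by exact: cvg_cst.
  by have := cvgM cC (cvgD gA gN); rewrite addr0 mulr0; exact.
near=> n.
have n0 : (0 < n)%N by near: n; exact: nbhs_infty_gt.
have [iA A1 A2] := HA _ n0; have [iN N1 N2] := HN _ n0.
have D1 := translate_mean_taylor C0 bh hT iA A1 A2.
have D2 := translate_mean_taylor C0 bh hT iN N1 N2.
have D x : `|translate_mean (A n) h x - translate_mean (N n) h x| <=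
   C * (\int[A n]_y taylor_gauge y + \int[N n]_y taylor_gauge y).
  rewrite (_ : _ - _ = (translate_mean (A n) h x - h x - b x * (v / n%:R) / 2) -
    (translate_mean (N n) h x - h x - b x * (v / n%:R) / 2)); last by ring.
  by rewrite (le_trans (ler_normB _ _))// mulrDr lerD.
have T1 := @iter_translate_mean_compare _ (A n) (N n) h _ n bh D 0.
have T2 := @iter_translate_mean_dist _ (A n) h f _ n bh bf hf 0.
have T3 := @iter_translate_mean_dist _ (N n) h f _ n bh bf hf 0.
rewrite !HL// in T1 T3.
have T4 : C * (n%:R * \int[A n]_y taylor_gauge y + n%:R * \int[N n]_y taylor_gauge y) <= e / 3.
  apply: le_trans (ler_norm _) _; rewrite -normrN -sub0r.
  by near: n; move/cvgrPdist_le : gsum; apply; rewrite divr_gt0.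
(* Three thirds of [e]: smoothing under [A n], Trotter comparison for the smoothed function [h],
   smoothing under the limit. *)
rewrite (_ : L f - _ = (iter n (translate_mean (A n)) h 0 - iter n (translate_mean (A n)) f 0)
  - (iter n (translate_mean (A n)) h 0 - L h) - (L h - L f)); last by ring.
apply: (le_trans (ler_normB _ _)).
apply: (@le_trans _ _ (e / 3 + e / 3 + e / 3)); last by lra.
apply: lerD => //; apply: (le_trans (ler_normB _ _)); apply: lerD => //.
apply: (le_trans T1); apply: le_trans T4.
by rewrite mulrCA mulrDr.
Unshelve. all: by end_near. Qed.

End clt_core.

(** * Laws of rescaled variables *)

Definition mfun_of d d' (T : measurableType d) (T' : measurableType d') (f : T -> T')
    (mf : measurable_fun setT f) : {mfun T >-> T'} :=
  HB.pack_for {mfun T >-> T'} f (isMeasurableFun.Build d d' T T' f mf).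

Section law.
Context d (T : measurableType d) (R : realType) (P : probability T R).

Definition law (Y : T -> R) (mY : measurable_fun setT Y) :
  probability (measurableTypeR R) R := distribution P (@mfun_of _ _ T (measurableTypeR R) Y mY).

Variables (Y : T -> R) (mY : measurable_fun setT Y).

Lemma integrable_law (h : R -> R) : measurable_fun setT h ->
  P.-integrable setT (EFin \o (h \o Y)) -> (law mY).-integrable setT (EFin \o h).
Proof.
move=> mh ih; apply: (@integrable_pushforward _ _ T (measurableTypeR R) R Y mY P setT (EFin \o h)) => //.
exact/measurable_EFinP.
Qed.

Lemma Rintegral_law (h : R -> R) : measurable_fun setT h ->
  P.-integrable setT (EFin \o (h \o Y)) -> \int[law mY]_y h y = \int[P]_x h (Y x).
Proof.
move=> mh ih; congr fine.
rewrite (@integral_distribution _ _ T (measurableTypeR R) R P (@mfun_of _ _ T (measurableTypeR R) Y mY) (EFin \o h))//.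
exact/measurable_EFinP.
Qed.

End law.

Section normalized_law.
Context d (T : measurableType d) (R : realType) (P : probability T R).
Variables (Y : T -> R) (mY : measurable_fun setT Y) (v : R).
Hypotheses (iY2 : P.-integrable setT (EFin \o (fun x => Y x ^+ 2)))
  (EY : \int[P]_x Y x = 0) (EY2 : \int[P]_x Y x ^+ 2 = v).

Lemma measurable_normalized n : measurable_fun setT (fun x => Y x / Num.sqrt n%:R).
Proof. exact: measurable_funM. Qed.

Definition normalized_law n := law P (measurable_normalized n).

Let iY : P.-integrable setT (EFin \o Y).
Proof.
have ione : P.-integrable setT (EFin \o (fun _ : T => (1 : R))).
  exact: finite_measure_integrable_cst.
apply: (integrable_le (integrableD measurableT ione iY2)) => // y /=.
have [y1|y1] := leP `|Y y| 1; first by rewrite ler_wpDr// sqr_ge0.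
by rewrite -real_normK ?num_real// ler_wpDl// expr2 ler_peMl// ltW.
Qed.

Let iYn n : P.-integrable setT (EFin \o (fun x => Y x / Num.sqrt n%:R)).
Proof.
have := integrable_scale (Num.sqrt n%:R)^-1 iY.
by congr (_.-integrable _ (EFin \o _)); apply/funext => x; rewrite mulrC.
Qed.

Let sqE n x : (0 < n)%N -> (Y x / Num.sqrt n%:R) ^+ 2 = n%:R^-1 * Y x ^+ 2 :> R.
Proof. by move=> n0; rewrite exprMn exprVn sqr_sqrtr// mulrC. Qed.

Let iYn2 n : (0 < n)%N -> P.-integrable setT (EFin \o (fun x => (Y x / Num.sqrt n%:R) ^+ 2)).
Proof.
move=> n0; have := integrable_scale n%:R^-1 iY2.
by congr (_.-integrable _ (EFin \o _)); apply/funext => x; rewrite sqE.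
Qed.

Lemma normalized_law_moments n : (0 < n)%N ->
  [/\ (normalized_law n).-integrable setT (EFin \o (fun y : R => y ^+ 2)),
     \int[normalized_law n]_y y = 0 & \int[normalized_law n]_y y ^+ 2 = v / n%:R].
Proof.
move=> n0; split.
- by apply: integrable_law; [exact: exprn_measurable|exact: iYn2].
- rewrite /normalized_law (Rintegral_law (h := id) (measurable_normalized n) (@measurable_id _ _ _) (iYn n)) /=.
  by under eq_Rintegral do rewrite mulrC; rewrite RintegralZl// EY mulr0.
- rewrite /normalized_law (Rintegral_law (measurable_normalized n) (@exprn_measurable R setT 2) (iYn2 n0)).
  by under eq_Rintegral do rewrite sqE//; rewrite RintegralZl// EY2 mulrC.
Qed.

(** The Lindeberg condition by dominated convergence: n times the gauge of Y / sqrt n is at most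
    Y^2, by the quadratic branch, and at most |Y|^3 / sqrt n pointwise, by the cubic one. *)
Lemma normalized_law_gauge_cvg :
  n%:R * \int[normalized_law n]_y taylor_gauge y @[n --> \oo] --> (0 : R).
Proof.
pose F n x : R := n%:R * taylor_gauge (Y x / Num.sqrt n%:R).
have mF n : measurable_fun setT (F n).
  apply: measurable_funM => //; apply: measurableT_comp; first exact: measurable_taylor_gauge.
  exact: measurable_normalized.
have F_ge0 n x : 0 <= F n x by rewrite mulr_ge0// taylor_gauge_ge0.
have F_le n x : F n x <= Y x ^+ 2.
  case: n => [|n]; first by rewrite /F mul0r sqr_ge0.
  rewrite /F; apply: (le_trans (ler_wpM2l (ler0n R n.+1) (taylor_gauge_le _))).
  by rewrite sqE// mulrA mulfV ?mul1r// pnatr_eq0.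
have iF n : P.-integrable setT (EFin \o F n).
  by apply: (integrable_le iY2) => // x; rewrite ger0_norm.
have FE n : (0 < n)%N -> n%:R * \int[normalized_law n]_y taylor_gauge y = \int[P]_x F n x.
  move=> n0; rewrite Rintegral_law; last 2 first.
  - exact: measurable_taylor_gauge.
  - apply: (integrable_le (iYn2 n0)) => [|x].
      apply: measurableT_comp; first exact: measurable_taylor_gauge.
      exact: measurable_normalized.
    by rewrite /= ger0_norm ?taylor_gauge_ge0// taylor_gauge_le.
  rewrite RintegralZl//.
  apply: (integrable_le (iYn2 n0)) => [|x].
    apply: measurableT_comp; first exact: measurable_taylor_gauge.
    exact: measurable_normalized.
  by rewrite /= ger0_norm ?taylor_gauge_ge0// taylor_gauge_le.
have Fcvg x : F n x @[n --> \oo] --> (0 : R).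
  apply/cvgrPdist_le => /= e e0; near=> n.
  have n0 : (0 < n)%N by near: n; exact: nbhs_infty_gt.
  have sn0 : 0 < Num.sqrt n%:R :> R by rewrite sqrtr_gt0 ltr0n.
  rewrite sub0r normrN ger0_norm//.
  apply: (@le_trans _ _ (n%:R * `|Y x / Num.sqrt n%:R| ^+ 3)).
    by rewrite ler_wpM2l// /taylor_gauge ge_min lexx orbT.
  have -> : n%:R * `|Y x / Num.sqrt n%:R| ^+ 3 = `|Y x| ^+ 3 / Num.sqrt n%:R.
    rewrite normrM normfV (gtr0_norm sn0) -{1}(@sqr_sqrtr _ n%:R)//.
    by field; rewrite gt_eqF.
  rewrite ler_pdivrMr// mulrC -ler_pdivrMr//.
  rewrite -(@ler_pXn2r _ 2)// ?nnegrE ?divr_ge0 ?(ltW e0) ?exprn_ge0// sqr_sqrtr//.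
  by near: n; exact: nbhs_infty_ger.
pose G x : R := Y x ^+ 2.
have Fe x : setT x -> (EFin \o F n) x @[n --> \oo] --> (cst 0%E : T -> \bar R) x.
  by move=> _; apply/cvg_EFin; [exact: nearW|exact: Fcvg].
have dom n x : setT x -> (`|(EFin \o F n) x| <= (EFin \o G) x)%E.
  by move=> _ /=; rewrite lee_fin ger0_norm.
have mEF n : measurable_fun setT (EFin \o F n) by exact/measurable_EFinP.
have fG x : setT x -> (EFin \o G) x \is a fin_num by [].
have := dominated_cvg measurableT mEF Fe fG iY2 dom.
rewrite integral0 => /fine_cvg h.
rewrite -(cvg_shiftS _) /=; have := h; rewrite -(cvg_shiftS _) /=.
by under eq_fun do rewrite -/(Rintegral P setT (F _)) -FE//.
Unshelve. all: by end_near. Qed.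

End normalized_law.

Definition normal0_mean {R : realType} (v : R) (f : R -> R) : R :=
  if v == 0 then f 0 else \int[normal_prob 0 (Num.sqrt v)]_y f y.

Lemma normal0_integralE {R : realType} (v M : R) (f : R -> R) : measurable_fun setT f ->
  (forall x, `|f x| <= M) -> normal0_integral v f = (normal0_mean v f)%:E.
Proof.
move=> mf fM; rewrite /normal0_integral /normal0_mean; case: ifPn => // v0.
exact: RintegralE (@bounded_integrable _ _ _ (normal_prob 0 (Num.sqrt v)) _ _ mf fM).
Qed.

Section clt.
Context d (T : measurableType d) (R : realType) (P : probability T R).
Variables (Y : T -> R) (mY : measurable_fun setT Y) (v : R).
Hypotheses (iY2 : P.-integrable setT (EFin \o (fun x => Y x ^+ 2)))
  (EY : \int[P]_x Y x = 0) (EY2 : \int[P]_x Y x ^+ 2 = v).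

Lemma normalized_law_iter_cvg (f : R -> R) (K M : R) :
  (forall x y, `|f x - f y| <= K * `|x - y|) -> (forall x, `|f x| <= M) ->
  iter n (translate_mean (normalized_law P mY n)) f 0 @[n --> \oo] --> normal0_mean v f.
Proof.
move=> fK fM.
have v0 : 0 <= v by rewrite -EY2; apply: Rintegral_ge0 => x _; exact: sqr_ge0.
have HA n : (0 < n)%N -> _ := @normalized_law_moments _ _ _ P Y mY v iY2 EY EY2 n.
have gA := normalized_law_gauge_cvg mY iY2.
have mc : measurable_fun [set: T] (cst 0 : T -> R) by exact: measurable_cst.
have i0 (h : R -> R) : P.-integrable setT (EFin \o (h \o (cst 0 : T -> R))).
  have : P.-integrable setT (EFin \o cst (h 0)) by exact: finite_measure_integrable_cst.
  by [].
rewrite /normal0_mean; case: eqVneq => [v00|vn0].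
  (* Variance zero: the comparison law is the point mass at 0, realised as the law of a constant,
     and its operator is the identity. *)
  apply: (@iter_translate_mean_cvg _ _ (fun _ => law P mc) v (fun f => f 0) HA) fK fM => //.
  - move=> n n0; split.
    + by apply: integrable_law; [exact: exprn_measurable|exact: i0].
    + rewrite (Rintegral_law (h := id) mc (@measurable_id _ _ _) (i0 id)) /=.
      by rewrite probability_Rintegral_cst.
    + rewrite (Rintegral_law mc (@exprn_measurable R setT 2) (i0 _)) /=.
      by rewrite probability_Rintegral_cst v00 mul0r expr0n.
  - rewrite (Rintegral_law mc (@measurable_taylor_gauge R) (i0 _)) /=.
    rewrite probability_Rintegral_cst (_ : taylor_gauge 0 = 0).
      by under eq_fun do rewrite mulr0; exact: cvg_cst.
    by rewrite /taylor_gauge normr0 !expr0n minxx.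
  - move=> n g _ bg.
    have tmE h : bounded_measurable h -> translate_mean (law P mc) h = h.
      move=> [mh _]; apply/funext => x; rewrite /translate_mean.
      rewrite (Rintegral_law mc (measurable_translate x mh) (i0 _)) /=.
      by rewrite probability_Rintegral_cst addr0.
    by elim: n => //= n IH; rewrite tmE//; exact: bounded_measurable_iter.
have vp : 0 < v by rewrite lt_neqAle eq_sym vn0.
(* One Gaussian step carries the variance v / n; its gauge is of order n^(-3/2), so n steps
   contribute o(1). *)
pose s n : R := Num.sqrt (v / n%:R).
have sp n : (0 < n)%N -> 0 < s n by move=> n0; rewrite sqrtr_gt0 divr_gt0// ltr0n.
have -> : \int[normal_prob 0 (Num.sqrt v)]_y f y =
    translate_mean (normal_prob 0 (Num.sqrt v) : probability (measurableTypeR R) R) f 0.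
  by apply: eq_Rintegral => y _; rewrite add0r.
apply: (@iter_translate_mean_cvg _ _ (fun n => normal_prob 0 (s n) : probability (measurableTypeR R) R) v
  (fun f => translate_mean (normal_prob 0 (Num.sqrt v) : probability (measurableTypeR R) R) f 0) HA) fK fM => //.
- move=> n n0; split.
  + exact: integrable_normal_sqr_id (sp _ n0).
  + exact: normal_mean0 (sp _ n0).
  + by rewrite (normal_second_moment (sp _ n0)) sqr_sqrtr// divr_ge0.
- pose c : R := 12 * expR (1 / 2).
  have c0 : 0 < c by rewrite mulr_gt0// expR_gt0.
  apply/cvgrPdist_le => /= e e0; near=> n.
  have n0 : (0 < n)%N by near: n; exact: nbhs_infty_gt.
  have nr0 : 0 < n%:R :> R by rewrite ltr0n.
  have G0 : 0 <= \int[normal_prob 0 (s n)]_y taylor_gauge y.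
    by apply: Rintegral_ge0 => y _; exact: taylor_gauge_ge0.
  rewrite sub0r normrN ger0_norm ?mulr_ge0//.
  apply: (le_trans (ler_wpM2l (ltW nr0) (normal_taylor_gauge_le (sp _ n0)))).
  rewrite -/c exprSr sqr_sqrtr; last by rewrite divr_ge0// ltW.
  have -> : n%:R * (v / n%:R * s n * c) = v * c * s n by field; rewrite gt_eqF.
  rewrite mulrC -ler_pdivlMr ?mulr_gt0//.
  have ec0 : 0 <= e / (v * c) by rewrite divr_ge0 ?mulr_ge0 ?(ltW e0) ?(ltW c0).
  rewrite -(@ler_pXn2r _ 2)// ?nnegrE ?sqrtr_ge0// sqr_sqrtr; last by rewrite divr_ge0// ltW.
  have ec1 : 0 < (e / (v * c)) ^+ 2 by rewrite exprn_gt0// divr_gt0// mulr_gt0.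
  rewrite ler_pdivrMr// mulrC -ler_pdivrMr//.
  by near: n; exact: nbhs_infty_ger.
- move=> [//|n] g _ bg; apply: (etrans (iter_translate_mean_normal n 0 (sp n.+1 isT) bg)).
  have -> : s n.+1 * Num.sqrt n.+1%:R = Num.sqrt v.
    by rewrite /s -sqrtrM ?divr_ge0// divfK// pnatr_eq0.
  by [].
Unshelve. all: by end_near. Qed.

End clt.

(** * Independence *)

Section independent_systems.
Context d (T : measurableType d) (R : realType) (P : probability T R).
Local Open Scope ereal_scope.

Definition indep_systems (G1 G2 : set (set T)) :=
  forall A B, G1 A -> G2 B -> P (A `&` B) = P A * P B.

(** For fixed [B] both sides are finite measures in [A], equal on a pi-system that contains the
    whole space; uniqueness of measures extends the equality. *)
Lemma indep_systems_sigmal (G1 G2 : set (set T)) : G1 `<=` measurable ->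
  G2 `<=` measurable -> setI_closed G1 -> G1 setT ->
  indep_systems G1 G2 -> indep_systems <<s G1 >> G2.
Proof.
move=> mG1 mG2 IG1 TG1 ind A B sA GB.
have mB : measurable B by exact: mG2.
have PB : P B = (fine (P B))%:E by rewrite fineK// fin_num_measure.
have PB0 : (0 <= fine (P B))%R by rewrite fine_ge0.
pose m1 := mrestr P mB; pose m2 := mscale (NngNum PB0) P.
have -> : P (A `&` B) = m1 A by [].
have -> : P A * P B = m2 A by rewrite /m2 /mscale/= muleC -PB.
apply: (@g_sigma_algebra_measure_unique _ R T G1 mG1 (fun=> setT)) sA => //.
- by rewrite -subTset => x _; exists 0%N.
- move=> C GC; apply: (etrans (ind _ _ GC GB)); rewrite muleC {1}PB.
  by [].
- move=> _; apply: (@le_lt_trans _ _ 1); last exact: ltry.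
  by apply: probability_le1; exact: measurableI.
Qed.

Lemma indep_systemsC (G1 G2 : set (set T)) : indep_systems G1 G2 -> indep_systems G2 G1.
Proof. by move=> ind A B GA GB; rewrite setIC [RHS]muleC; exact: ind. Qed.

Lemma indep_systems_sigma (G1 G2 : set (set T)) : G1 `<=` measurable ->
  G2 `<=` measurable -> setI_closed G1 -> setI_closed G2 -> G1 setT -> G2 setT ->
  indep_systems G1 G2 -> indep_systems <<s G1 >> <<s G2 >>.
Proof.
move=> mG1 mG2 IG1 IG2 TG1 TG2 ind.
have sG1 : <<s G1 >> `<=` measurable by exact: smallest_sub (@sigma_algebra_measurable _ T) mG1.
apply: indep_systemsC; apply: indep_systems_sigmal => //.
by apply: indep_systemsC; exact: indep_systems_sigmal.
Qed.

Lemma measurable_id_sigma (G : set (set T)) : G `<=` measurable ->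
  measurable_fun setT (id : T -> g_sigma_algebraType G).
Proof.
move=> mG _ A sA; rewrite setTI preimage_id.
exact: (smallest_sub (@sigma_algebra_measurable _ T) mG).
Qed.

(** Independence says that the diagonal x -> (x, x), into the product of [T] with two different
    sigma-algebras, has a product law. Decoupling is thus a matter of sample points: one carries the
    noise, the other the design and the signal, and the latter can be frozen. *)
Lemma indep_integral (G1 G2 : set (set T)) : G1 `<=` measurable ->
  G2 `<=` measurable -> setI_closed G1 -> setI_closed G2 -> G1 setT -> G2 setT ->
  indep_systems G1 G2 ->
  forall F : g_sigma_algebraType G1 * g_sigma_algebraType G2 -> \bar R,
  measurable_fun setT F -> (forall z, 0 <= F z) ->
  \int[P]_x F (x, x) = \int[P]_y \int[P]_x F (x, y).
Proof.
move=> mG1 mG2 IG1 IG2 TG1 TG2 ind F mF F0.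
have sind := indep_systems_sigma mG1 mG2 IG1 IG2 TG1 TG2 ind.
have mid1 := measurable_id_sigma mG1; have mid2 := measurable_id_sigma mG2.
pose P1 := distribution P (mfun_of mid1).
pose P2 := distribution P (mfun_of mid2).
have mdiag : measurable_fun setT (fun x : T => (x, x) : g_sigma_algebraType G1 * g_sigma_algebraType G2).
  by apply: (@measurable_fun_pair _ _ _ T (g_sigma_algebraType G1) (g_sigma_algebraType G2) id id).
pose D := distribution P (mfun_of mdiag).
have DE A B : measurable A -> measurable B -> D (A `*` B) = P1 A * P2 B.
  move=> mA mB; rewrite /D /P1 /P2 /distribution /pushforward /=.
  by rewrite -sind//.
have prodE := product_measure_unique DE.
transitivity (\int[D]_z F z).
  by rewrite ge0_integral_distribution.
transitivity (\int[P1 \x P2]_z F z).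
  apply: eq_measure_integral => A mA _.
  by first [exact: prodE | exact: (esym (prodE _ mA))].
rewrite fubini_tonelli2//.
have mG := @measurable_fun_fubini_tonelli_G _ _ _ _ R P1 F mF F0.
have G0 y : 0 <= fubini_G P1 F y by apply: integral_ge0 => x _.
apply: (etrans (@ge0_integral_distribution _ _ _ _ _ P (mfun_of mid2) _ mG G0)).
apply: eq_integral => y _ /=.
have mFy := @measurable_fun_pair1 _ _ _ (g_sigma_algebraType G1) (g_sigma_algebraType G2) _ F y mF.
exact: (@ge0_integral_distribution _ _ _ _ _ P (mfun_of mid1) _ mFy (fun x => F0 (x, y))).
Qed.

End independent_systems.

Section cylinders.
Context d (T : measurableType d) (R : realType) (P : probability T R).
Variables (I : finType) (X : I -> T -> R).
Hypothesis mX : forall i, measurable_fun setT (X i).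

Definition cylinders (J : {set I}) : set (set T) :=
  [set A | exists B : I -> set R, (forall i, measurable (B i)) /\
     A = \bigcap_(i in [set` J]) (X i @^-1` B i)].

Lemma cylinders_setI J : setI_closed (cylinders J).
Proof.
move=> _ _ [B1 [mB1 ->]] [B2 [mB2 ->]]; exists (fun i => B1 i `&` B2 i); split.
  by move=> i; exact: measurableI.
apply/seteqP; split => x /=.
  by move=> [h1 h2] i iJ; split; [exact: h1|exact: h2].
by move=> h; split => i iJ; have [] := h i iJ.
Qed.

Lemma cylinders_setT J : cylinders J setT.
Proof. by exists (fun _ => setT); split => //; apply/seteqP; split => x. Qed.

Lemma cylinders_measurable J : cylinders J `<=` measurable.
Proof.
move=> _ [B [mB ->]]; apply: fin_bigcap_measurable; first exact: finite_finset.
by move=> i _; rewrite -[X in measurable X]setTI; exact: mX.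
Qed.

Lemma measurable_cylinders (J : {set I}) (i : I) : i \in J ->
  measurable_fun setT (X i : g_sigma_algebraType (cylinders J) -> R).
Proof.
move=> iJ _ A mA; rewrite setTI; apply: sub_sigma_algebra.
exists (fun j => if j == i then A else setT); split.
  by move=> j; case: ifP.
apply/seteqP; split => x /=.
  by move=> XA j _; case: ifP => // /eqP ->.
by move=> /(_ i iJ); rewrite /= eqxx.
Qed.

Lemma indep_cylinders (J1 J2 : {set I}) : mutually_indep P X -> (forall i, i \in J1 -> i \notin J2) ->
  indep_systems P (cylinders J1) (cylinders J2).
Proof.
move=> ind dJ _ _ [B1 [mB1 ->]] [B2 [mB2 ->]].
rewrite ind// ind//.
pose B i := if i \in J1 then B1 i else B2 i.
have mB i : measurable (B i) by rewrite /B; case: ifP.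
have J2B i : i \in J2 -> B i = B2 i.
  by move=> iJ2; rewrite /B; case: ifPn => // /dJ; rewrite iJ2.
have -> : \bigcap_(i in [set` J1]) X i @^-1` B1 i `&` \bigcap_(i in [set` J2]) X i @^-1` B2 i =
    \bigcap_(i in [set` J1 :|: J2]) X i @^-1` B i.
  apply/seteqP; split => x /=.
    move=> [h1 h2] i; rewrite /= inE => /orP[iJ|iJ].
      by rewrite /B iJ; exact: h1.
    by rewrite J2B//; exact: h2.
  move=> h; split => i iJ.
    by have := h i; rewrite /= inE iJ /B iJ => /(_ isT).
  by have := h i; rewrite /= inE iJ orbT J2B// => /(_ isT).
rewrite ind// (eq_bigl (fun i => (i \in J1) || (i \in J2))); last by move=> i; rewrite inE.
rewrite bigU; last first.
  by rewrite fintype.disjoint_subset; apply/fintype.subsetP => i; rewrite inE; exact: dJ.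
congr (_ * _)%E; apply: eq_bigr => i iJ; first by rewrite /B iJ.
by rewrite J2B.
Qed.

End cylinders.

(** * Expectations of products of independent variables *)

Section indep_product.
Context d (T : measurableType d) (R : realType) (P : probability T R).
Variables (G1 G2 : set (set T)).
Hypotheses (mG1 : G1 `<=` measurable) (mG2 : G2 `<=` measurable)
  (IG1 : setI_closed G1) (IG2 : setI_closed G2) (TG1 : G1 setT) (TG2 : G2 setT)
  (ind : indep_systems P G1 G2).

Lemma ge0_indep_expectationM (f : g_sigma_algebraType G1 -> R) (g : g_sigma_algebraType G2 -> R) :
  measurable_fun setT f -> measurable_fun setT g ->
  (forall x, 0 <= f x) -> (forall x, 0 <= g x) ->
  (\int[P]_x (f x * g x)%:E = \int[P]_x (f x)%:E * \int[P]_x (g x)%:E)%E.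
Proof.
move=> mf mg f0 g0.
have mfT : measurable_fun setT (f : T -> R).
  exact: (measurableT_comp mf (measurable_id_sigma mG1)).
have mgT : measurable_fun setT (g : T -> R).
  exact: (measurableT_comp mg (measurable_id_sigma mG2)).
have := @indep_integral _ _ _ P G1 G2 mG1 mG2 IG1 IG2 TG1 TG2 ind (fun z => (f z.1 * g z.2)%:E).
move=> /= ->.
- under eq_integral => y _.
    under eq_integral do rewrite EFinM.
    rewrite ge0_integralZr; [|exact: measurableT|exact/measurable_EFinP|
      by move=> x _; rewrite lee_fin|by rewrite lee_fin].
    over.
  rewrite ge0_integralZl; [by []|exact: measurableT|exact/measurable_EFinP|
    by move=> x _; rewrite lee_fin|].
  by apply: integral_ge0 => x _; rewrite lee_fin.
- apply/measurable_EFinP; apply: measurable_funM.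
    by apply: measurableT_comp => //; exact: measurable_fst.
  by apply: measurableT_comp => //; exact: measurable_snd.
- by move=> z; rewrite lee_fin mulr_ge0.
Qed.

Lemma ge0_indep_RintegralM (f : g_sigma_algebraType G1 -> R) (g : g_sigma_algebraType G2 -> R) :
  measurable_fun setT f -> measurable_fun setT g ->
  (forall x, 0 <= f x) -> (forall x, 0 <= g x) ->
  P.-integrable setT (EFin \o (f : T -> R)) -> P.-integrable setT (EFin \o (g : T -> R)) ->
  P.-integrable setT (EFin \o (fun x : T => f x * g x)) /\
  \int[P]_x (f x * g x) = \int[P]_x f x * \int[P]_x g x.
Proof.
move=> mf mg f0 g0 fi gi; have E := ge0_indep_expectationM mf mg f0 g0.
have mfT : measurable_fun setT (f : T -> R).
  exact: (measurableT_comp mf (measurable_id_sigma mG1)).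
have mgT : measurable_fun setT (g : T -> R).
  exact: (measurableT_comp mg (measurable_id_sigma mG2)).
have fgE : (\int[P]_x (f x * g x)%:E = (\int[P]_x f x * \int[P]_x g x)%:E)%E.
  by rewrite E (RintegralE fi) (RintegralE gi).
split; last by rewrite /Rintegral fgE.
apply: ge0_integrable; first exact: measurable_funM.
  by move=> x; rewrite mulr_ge0.
by rewrite fgE ltry.
Qed.

(** Each factor is a difference of non-negative integrable ones, f = (f + |f|) - |f|; the four
    products are recombined. *)
Lemma indep_RintegralM (f : g_sigma_algebraType G1 -> R) (g : g_sigma_algebraType G2 -> R) :
  measurable_fun setT f -> measurable_fun setT g ->
  P.-integrable setT (EFin \o (f : T -> R)) -> P.-integrable setT (EFin \o (g : T -> R)) ->
  P.-integrable setT (EFin \o (fun x : T => f x * g x)) /\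
  \int[P]_x (f x * g x) = \int[P]_x f x * \int[P]_x g x.
Proof.
move=> mf mg fi gi.
pose f1 x := f x + `|f x|; pose f2 x := `|f x|.
pose g1 x := g x + `|g x|; pose g2 x := `|g x|.
have mf2 : measurable_fun setT f2 by exact: measurableT_comp.
have mg2 : measurable_fun setT g2 by exact: measurableT_comp.
have mf1 : measurable_fun setT f1 by exact: measurable_funD.
have mg1 : measurable_fun setT g1 by exact: measurable_funD.
have pos (r : R) : 0 <= r + `|r| by have := ler_norm (- r); rewrite normrN; lra.
have if2 : P.-integrable setT (EFin \o (f2 : T -> R)) by exact: integrable_norm.
have ig2 : P.-integrable setT (EFin \o (g2 : T -> R)) by exact: integrable_norm.
have if1 : P.-integrable setT (EFin \o (f1 : T -> R)) by exact: (integrableD measurableT fi if2).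
have ig1 : P.-integrable setT (EFin \o (g1 : T -> R)) by exact: (integrableD measurableT gi ig2).
have Ef1 : \int[P]_x f1 x = \int[P]_x f x + \int[P]_x f2 x by exact: RintegralD.
have Eg1 : \int[P]_x g1 x = \int[P]_x g x + \int[P]_x g2 x by exact: RintegralD.
have [i11 E11] := ge0_indep_RintegralM mf1 mg1 (fun x => pos _) (fun x => pos _) if1 ig1.
have [i12 E12] := ge0_indep_RintegralM mf1 mg2 (fun x => pos _) (fun x => normr_ge0 _) if1 ig2.
have [i21 E21] := ge0_indep_RintegralM mf2 mg1 (fun x => normr_ge0 _) (fun x => pos _) if2 ig1.
have [i22 E22] := ge0_indep_RintegralM mf2 mg2 (fun x => normr_ge0 _) (fun x => normr_ge0 _) if2 ig2.
have fgE : (fun x : T => f x * g x) = (fun x : T => f1 x * g1 x - f1 x * g2 x - (f2 x * g1 x - f2 x * g2 x)).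
  by apply/funext => x; rewrite /f1 /f2 /g1 /g2; ring.
have j1 := integrableB measurableT i11 i12.
have j2 := integrableB measurableT i21 i22.
split; first by rewrite fgE; exact: (integrableB measurableT j1 j2).
have -> : \int[P]_x (f x * g x) =
    \int[P]_x (f1 x * g1 x - f1 x * g2 x - (f2 x * g1 x - f2 x * g2 x)) by rewrite -fgE.
rewrite (RintegralB measurableT j1 j2) (RintegralB measurableT i11 i12) (RintegralB measurableT i21 i22).
by rewrite E11 E12 E21 E22 Ef1 Eg1; ring.
Qed.

End indep_product.

(** * Gram-Schmidt and projections *)

Section dot.
Context {R : realType} {n : nat}.
Implicit Types (u v w x y z q : 'cV[R]_n) (qs zs : seq 'cV[R]_n).

Definition dot u v : R := \sum_(i < n) u i 0 * v i 0.

Lemma dotC u v : dot u v = dot v u.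
Proof. by apply: eq_bigr => i _; rewrite mulrC. Qed.

Lemma dotDl u v w : dot (u + v) w = dot u w + dot v w.
Proof. by rewrite /dot -big_split; apply: eq_bigr => i _; rewrite mxE mulrDl. Qed.

Lemma dotZl a u v : dot (a *: u) v = a * dot u v.
Proof. by rewrite /dot mulr_sumr; apply: eq_bigr => i _; rewrite mxE mulrA. Qed.

Lemma dotDr u v w : dot u (v + w) = dot u v + dot u w.
Proof. by rewrite dotC dotDl dotC (dotC w). Qed.

Lemma dotZr a u v : dot u (a *: v) = a * dot u v.
Proof. by rewrite dotC dotZl dotC. Qed.

Lemma dotNr u v : dot u (- v) = - dot u v.
Proof. by rewrite -scaleN1r dotZr mulN1r. Qed.

Lemma dotBr u v w : dot u (v - w) = dot u v - dot u w.
Proof. by rewrite dotDr dotNr. Qed.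

Lemma dotBl u v w : dot (u - v) w = dot u w - dot v w.
Proof. by rewrite dotC dotBr dotC (dotC v). Qed.

Lemma dot0r u : dot u 0 = 0.
Proof. by rewrite -(subrr 0) dotBr subrr. Qed.

Lemma dot0l u : dot 0 u = 0.
Proof. by rewrite dotC dot0r. Qed.

Lemma dot_sumr (I : Type) (r : seq I) (Q : pred I) (f : I -> 'cV[R]_n) u :
  dot u (\sum_(i <- r | Q i) f i) = \sum_(i <- r | Q i) dot u (f i).
Proof. by apply: (big_morph (dot u)) => [v w|]; rewrite ?dotDr ?dot0r. Qed.

Lemma dot_suml (I : Type) (r : seq I) (Q : pred I) (f : I -> 'cV[R]_n) u :
  dot (\sum_(i <- r | Q i) f i) u = \sum_(i <- r | Q i) dot (f i) u.
Proof. by rewrite dotC dot_sumr; apply: eq_bigr => i _; rewrite dotC. Qed.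

Lemma sqnE u : sqn u = dot u u.
Proof. by apply: eq_bigr => i _; rewrite expr2. Qed.

Lemma sqn_ge0 u : 0 <= sqn u.
Proof. by apply: sumr_ge0 => i _; exact: sqr_ge0. Qed.

Lemma sqn_eq0 u : sqn u = 0 -> u = 0.
Proof.
move=> /eqP; rewrite psumr_eq0; last by move=> i _; exact: sqr_ge0.
move=> /allP h; apply/matrixP => i j; rewrite ord1 mxE.
by have := h i (mem_index_enum i); rewrite sqrf_eq0 => /eqP.
Qed.

Lemma sqnD u v : sqn (u + v) = sqn u + 2 * dot u v + sqn v.
Proof. by rewrite !sqnE !(dotDl, dotDr) (dotC v u); ring. Qed.

Lemma sqnB u v : sqn (u - v) = sqn u - 2 * dot u v + sqn v.
Proof. by rewrite !sqnE !(dotBl, dotBr) (dotC v u); ring. Qed.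

Lemma sqnZ a u : sqn (a *: u) = a ^+ 2 * sqn u.
Proof. by rewrite !sqnE dotZl dotZr mulrA expr2. Qed.

(** Since the inverse of 0 is 0, the zero vector is normalized to itself. Dependent columns then
    give zero vectors in the system instead of an exceptional case, which is why [orthosys] allows
    squared norms 0 and 1. *)
Definition normalize w : 'cV[R]_n := (Num.sqrt (sqn w))^-1 *: w.

Lemma sqn_normalize w : sqn (normalize w) = 0 \/ sqn (normalize w) = 1.
Proof.
rewrite /normalize sqnZ exprVn sqr_sqrtr ?sqn_ge0//.
have [->|w0] := eqVneq (sqn w) 0; first by left; rewrite mulr0.
by right; rewrite mulVf.
Qed.

Lemma scale_normalize w : Num.sqrt (sqn w) *: normalize w = w.
Proof.
rewrite /normalize scalerA; have [w0|w0] := eqVneq (sqn w) 0.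
  by rewrite (sqn_eq0 w0) scaler0.
rewrite divff ?scale1r// gt_eqF// sqrtr_gt0 lt_neqAle eq_sym w0; exact: sqn_ge0.
Qed.

Definition prj qs y : 'cV[R]_n := \sum_(q <- qs) dot q y *: q.

(** The head is orthogonalized against the system of the tail, so prepending a vector leaves that
    system intact; this is what makes [mu :: cols Z m] an extension of the system of Z_m by one
    vector. *)
Fixpoint gram_schmidt zs : seq 'cV[R]_n :=
  if zs is z :: zs' then
    let qs := gram_schmidt zs' in normalize (z - prj qs z) :: qs
  else [::].

Fixpoint orthosys qs : Prop :=
  if qs is q :: qs' then
    [/\ forall q', q' \in qs' -> dot q q' = 0, sqn q = 0 \/ sqn q = 1 & orthosys qs']
  else True.

Lemma prj_cons q qs y : prj (q :: qs) y = dot q y *: q + prj qs y.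
Proof. by rewrite /prj big_cons. Qed.

Lemma dot_prj qs x y : dot (prj qs x) y = \sum_(q <- qs) dot q x * dot q y.
Proof. by rewrite dot_suml; apply: eq_bigr => q _; rewrite dotZl. Qed.

Lemma prjD qs x y : prj qs (x + y) = prj qs x + prj qs y.
Proof. by rewrite /prj -big_split; apply: eq_bigr => q _; rewrite dotDr scalerDl. Qed.

Lemma dot_prj_orthogonal qs q y : (forall q', q' \in qs -> dot q q' = 0) ->
  dot q (prj qs y) = 0.
Proof.
move=> h; rewrite dotC dot_prj big_seq big1// => q' q'qs.
by rewrite (dotC q' q) h// mulr0.
Qed.

Lemma orthosys_perp qs q y : orthosys qs -> q \in qs -> dot q (y - prj qs y) = 0.
Proof.
elim: qs => [//|q0 qs IH] /= [oq nq0 oqs].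
rewrite inE prj_cons => /orP[/eqP ->|qqs].
  rewrite dotBr dotDr dotZr dot_prj_orthogonal// addr0 -sqnE.
  case: nq0 => [h|->]; last by rewrite mulr1 subrr.
  by rewrite (sqn_eq0 h) dot0l mul0r subrr.
rewrite opprD addrA addrAC dotBr dotZr (dotC q q0) (oq q qqs) mulr0 subr0.
exact: IH.
Qed.

Lemma prj_perp qs x y : orthosys qs -> dot (prj qs x) (y - prj qs y) = 0.
Proof.
move=> oqs; rewrite dot_prj big_seq big1// => q qqs.
by rewrite (orthosys_perp y oqs qqs) mulr0.
Qed.

Lemma sqn_prj qs y : orthosys qs -> sqn (prj qs y) = \sum_(q <- qs) dot q y ^+ 2.
Proof.
move=> oqs; have := prj_perp y y oqs; rewrite dotBr -sqnE => /eqP.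
rewrite subr_eq0 => /eqP <-; rewrite dot_prj.
by apply: eq_bigr => q _; rewrite expr2.
Qed.

Lemma orthosys_gram_schmidt zs : orthosys (gram_schmidt zs).
Proof.
elim: zs => //= z zs IH; split => //; last exact: sqn_normalize.
by move=> q qqs; rewrite dotZl dotC (orthosys_perp _ IH qqs) mulr0.
Qed.

(** For the head z0 = prj z0 + w, the component along the new vector restores w, including the case
    w = 0; later vectors are orthogonal to the new one. *)
Lemma prj_gram_schmidt_id zs z : z \in zs -> prj (gram_schmidt zs) z = z.
Proof.
elim: zs => [//|z0 zs IH] /=; rewrite inE prj_cons.
set qs := gram_schmidt zs; set w := z0 - prj qs z0.
have oqs : orthosys qs by exact: orthosys_gram_schmidt.
have qo q' : q' \in qs -> dot (normalize w) q' = 0.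
  by move=> q'qs; rewrite dotZl dotC (orthosys_perp _ oqs q'qs) mulr0.
move=> /orP[/eqP ->|zzs]; last first.
  by rewrite -{1}(IH zzs) dot_prj_orthogonal// scale0r add0r IH.
have -> : dot (normalize w) z0 = Num.sqrt (sqn w) * sqn (normalize w).
  rewrite -{1}(subrK (prj qs z0) z0) -/w dotDr dot_prj_orthogonal// addr0.
  by rewrite -{2}(scale_normalize w) dotZr -sqnE.
have -> : (Num.sqrt (sqn w) * sqn (normalize w)) *: normalize w = w.
  case: (sqn_normalize w) => h; rewrite h; last by rewrite mulr1 scale_normalize.
  by rewrite mulr0 scale0r -{1}(scale_normalize w) (sqn_eq0 h) scaler0.
by rewrite /w subrK.
Qed.

Lemma gram_schmidt_closed (S : 'cV[R]_n -> Prop) zs :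
  S 0 -> (forall u v, S u -> S v -> S (u + v)) -> (forall a u, S u -> S (a *: u)) ->
  (forall z, z \in zs -> S z) -> forall y, S (prj (gram_schmidt zs) y).
Proof.
move=> S0 SD SZ Szs.
have Sprj qs y : (forall q, q \in qs -> S q) -> S (prj qs y).
  move=> Sqs; rewrite /prj big_seq; apply: (big_ind S) => //.
  by move=> q qqs; apply: SZ; exact: Sqs.
move=> y; apply: (Sprj); elim: zs Szs => //= z zs IH Szs q.
have Sgs : forall q, q \in gram_schmidt zs -> S q.
  by apply: IH => z' z'zs; apply: Szs; rewrite inE z'zs orbT.
rewrite inE => /orP[/eqP ->|]; last exact: Sgs.
apply: (SZ); apply: (SD); first by apply: Szs; rewrite inE eqxx.
by rewrite -scaleN1r; apply: SZ; exact: Sprj.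
Qed.

Lemma size_gram_schmidt zs : size (gram_schmidt zs) = size zs.
Proof. by elim: zs => //= z zs ->. Qed.

End dot.

Section proj_cols.
Context {R : realType} {n p : nat}.
Implicit Types (Z : 'M[R]_(n, p)) (m : {set 'I_p}) (y v : 'cV[R]_n).

Definition cols Z m : seq 'cV[R]_n := [seq col j Z | j <- enum m].

Definition in_span Z m v := exists c : 'cV[R]_p,
  (forall j, j \notin m -> c j 0 = 0) /\ v = Z *m c.

Lemma dot_mulmx_tr (u v : 'cV[R]_n) : u^T *m v = (dot u v)%:M.
Proof.
apply/matrixP => i j; rewrite !ord1 !mxE eqxx mulr1n.
by apply: eq_bigr => k _; rewrite mxE.
Qed.

Lemma dot_in_span Z m v w : in_span Z m v ->
  (forall j, j \in m -> dot (col j Z) w = 0) -> dot v w = 0.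
Proof.
move=> [c [c0 ->]] h.
have -> : Z *m c = \sum_j c j 0 *: col j Z.
  apply/matrixP => i k; rewrite ord1 mxE summxE.
  by apply: eq_bigr => j _; rewrite !mxE mulrC.
rewrite dot_suml big1// => j _; rewrite dotZl.
by have [jm|jm] := boolP (j \in m); [rewrite h// mulr0|rewrite c0// mul0r].
Qed.

Lemma in_spanB Z m v w : in_span Z m v -> in_span Z m w -> in_span Z m (v - w).
Proof.
move=> [c [c0 ->]] [e [e0 ->]]; exists (c - e); split; last by rewrite mulmxBr.
by move=> j jm; rewrite !mxE c0// e0// subr0.
Qed.

Lemma in_spanS Z m m' v : (forall j, j \in m -> j \in m') -> in_span Z m v -> in_span Z m' v.
Proof.
move=> mm' [c [c0 ->]]; exists c; split => // j jm'; apply: c0.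
by apply/negP => /mm'; apply/negP.
Qed.

Lemma prj_in_span Z m y : in_span Z m (prj (gram_schmidt (cols Z m)) y).
Proof.
apply: (@gram_schmidt_closed _ _ (in_span Z m)).
- by exists 0; split=> [j _|]; rewrite ?mxE// mulmx0.
- move=> u w [c [c0 ->]] [e [e0 ->]]; exists (c + e); split; last by rewrite mulmxDr.
  by move=> j jm; rewrite !mxE c0// e0// addr0.
- move=> a u [c [c0 ->]]; exists (a *: c); split; last by rewrite -scalemxAr.
  by move=> j jm; rewrite !mxE c0// mulr0.
- move=> z /mapP[j]; rewrite mem_enum => jm ->.
  exists (delta_mx j 0); split; last by rewrite -colE.
  move=> k km; rewrite mxE eqxx andbT; case: eqP => // kj.
  by rewrite kj jm in km.
Qed.

Lemma prj_cols_perp Z m y j : j \in m ->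
  dot (col j Z) (y - prj (gram_schmidt (cols Z m)) y) = 0.
Proof.
move=> jm; have jc : col j Z \in cols Z m by apply/mapP; exists j => //; rewrite mem_enum.
rewrite -(prj_gram_schmidt_id jc) prj_perp//; exact: orthosys_gram_schmidt.
Qed.

(** Gram-Schmidt gives existence; uniqueness holds because the difference of two candidates lies in
    the span and is orthogonal to it. The explicit formula gives measurability and the expression of
    |P_m eps|^2 as a sum of squares. *)
Lemma proj_colsE Z m y : proj_cols Z m y = prj (gram_schmidt (cols Z m)) y.
Proof.
set A := [set v : 'cV[R]_n | (exists c : 'cV[R]_p, (forall j, j \notin m -> c j 0 = 0) /\ v = Z *m c) /\
    (forall j, j \in m -> (col j Z)^T *m (y - v) = 0)].
have Aprj : A (prj (gram_schmidt (cols Z m)) y).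
  split; first exact: prj_in_span.
  by move=> j jm; rewrite dot_mulmx_tr prj_cols_perp// raddf0.
have : A (proj_cols Z m y) by apply: (@xgetPex _ 0 A); exists (prj (gram_schmidt (cols Z m)) y).
move: Aprj; set v1 := prj _ _; set v2 := proj_cols _ _ _.
move=> [s1 h1] [s2 h2].
have d0 (v : 'cV[R]_n) j : (col j Z)^T *m (y - v) = 0 -> dot (col j Z) (y - v) = 0.
  by rewrite dot_mulmx_tr => /matrixP /(_ 0 0); rewrite !mxE eqxx mulr1n.
apply/eqP; rewrite -subr_eq0; apply/eqP/sqn_eq0; rewrite sqnE.
apply: (dot_in_span (in_spanB s2 s1)) => j jm.
have -> : v2 - v1 = (y - v1) - (y - v2) by rewrite opprB [RHS]addrC addrA subrK.
rewrite dotBr (d0 _ _ (h1 j jm)) (d0 _ _ (h2 j jm)). by rewrite subrr.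
Qed.

Lemma sqn_projperp_le Z m m' y : (forall j, j \in m -> j \in m') ->
  sqn (projperp_cols Z m' y) <= sqn (projperp_cols Z m y).
Proof.
move=> mm'; rewrite /projperp_cols !proj_colsE.
set v := prj (gram_schmidt (cols Z m)) y; set v' := prj (gram_schmidt (cols Z m')) y.
have -> : y - v = (y - v') + (v' - v) by rewrite addrA subrK.
rewrite [leRHS]sqnD dotC (dot_in_span (m := m') (Z := Z)).
- by rewrite mulr0 addr0 lerDl sqn_ge0.
- apply: in_spanB; first exact: prj_in_span.
  by apply: in_spanS mm' _; exact: prj_in_span.
- by move=> j jm; exact: prj_cols_perp.
Qed.

End proj_cols.

(** * Gibbs averaging over models *)

(* Gibbs variational principle; ln #|Q| is the maximal entropy. *)
Lemma gibbs_mean_le {R : realType} (I : finType) (Q : pred I) (E : I -> R) (alpha : R) (i0 : I) :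
  0 < alpha -> Q i0 ->
  \sum_(i | Q i) expR (- E i / alpha) / (\sum_(j | Q j) expR (- E j / alpha)) * E i <= E i0 + alpha * ln #|Q|%:R.
Proof.
move=> a0 Qi0; set D := \sum_(j | Q j) expR (- E j / alpha); pose w i := expR (- E i / alpha) / D.
have D0 : 0 < D.
  rewrite /D (bigD1 i0)//= ltr_wpDr ?expR_gt0//.
  by apply: sumr_ge0 => i _; exact: expR_ge0.
have w0 i : 0 < w i by rewrite divr_gt0// expR_gt0.
have w1 : \sum_(i | Q i) w i = 1 by rewrite -mulr_suml divff// gt_eqF.
have N0 : 0 < #|Q|%:R :> R by rewrite ltr0n; apply/card_gt0P; exists i0.
have EE i : E i = alpha * (- ln (w i) - ln D).
  rewrite /w lnM ?posrE ?expR_gt0 ?invr_gt0// expRK lnV ?posrE//.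
  by field; rewrite gt_eqF.
(* The inequality ln x <= x - 1 at x = 1 / (#|Q| w i); the linear terms cancel in the sum, as the
   weights add up to one. *)
have ent i : w i * (- ln (w i)) <= #|Q|%:R^-1 - w i + w i * ln #|Q|%:R.
  have x0 : 0 < (#|Q|%:R * w i)^-1 by rewrite invr_gt0 (mulr_gt0 N0 (w0 i)).
  have := @le_ln1Dx _ ((#|Q|%:R * w i)^-1 - 1).
  have lnx : ln (#|Q|%:R * w i)^-1 = - (ln #|Q|%:R + ln (w i)).
    by rewrite lnV ?posrE ?(mulr_gt0 N0 (w0 i))// lnM// posrE.
  rewrite (addrC 1) subrK lnx.
  have x1 : -1 < (#|Q|%:R * w i)^-1 - 1 by rewrite ltrBrDr addNr.
  move=> /(_ x1) h; have := ler_wpM2l (ltW (w0 i)) h.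
  have -> : w i * ((#|Q|%:R * w i)^-1 - 1) = #|Q|%:R^-1 - w i.
    by field; rewrite !gt_eqF.
  lra.
have entS : \sum_(i | Q i) w i * (- ln (w i)) <= ln #|Q|%:R.
  apply: (le_trans (ler_sum _ (fun i _ => ent i))).
  rewrite big_split/= sumrB w1 -mulr_suml w1 mul1r sumr_const.
  by rewrite -[X in X - 1](mulr_natr (#|Q|%:R^-1)) mulVf ?gt_eqF// subrr add0r.
have -> : \sum_(i | Q i) expR (- E i / alpha) / D * E i =
    alpha * (\sum_(i | Q i) w i * (- ln (w i)) - ln D).
  rewrite -[ln D]mul1r -w1 mulr_suml -sumrB mulr_sumr; apply: eq_bigr => i _.
  by rewrite -/(w i) EE; ring.
have lD : - E i0 / alpha <= ln D.
  rewrite -[leLHS]expRK ler_ln ?posrE ?expR_gt0// /D (bigD1 i0)//= lerDl.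
  by apply: sumr_ge0 => i _; exact: expR_ge0.
have : E i0 / alpha * alpha = E i0 by rewrite divfK// gt_eqF.
rewrite mulNr in lD => Ea.
have h : \sum_(i | Q i) w i * - ln (w i) - ln D <= ln #|Q|%:R + E i0 / alpha by lra.
apply: (le_trans (ler_wpM2l (ltW a0) h)); rewrite mulrDr (mulrC alpha (_ / _)) Ea addrC.
exact: lexx.
Qed.

Lemma exists_superset (T : finType) (S : {set T}) (u : nat) :
  (#|S| <= u <= #|T|)%N -> exists m : {set T}, #|m| = u /\ forall j, j \in S -> j \in m.
Proof.
move=> /andP[Su uT]; pose s := enum S ++ take (u - #|S|) (enum (~: S)).
have us : uniq s.
  rewrite cat_uniq enum_uniq take_uniq ?enum_uniq// andbT.
  by apply/hasPn => x /mem_take; rewrite !mem_enum inE.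
exists [set x in s]; split; last by move=> j jS; rewrite inE mem_cat mem_enum jS.
rewrite cardsE (card_uniqP us) size_cat -cardE size_take -cardE.
case: ltnP => h; first by rewrite subnKC.
apply/eqP; rewrite eqn_leq cardsC uT andbT.
by rewrite -(cardsC S) -(subnKC Su) leq_add2l.
Qed.

Lemma bin_le_exp p u : ('C(p, u) <= p ^ u)%N.
Proof.
apply: (@leq_trans (p ^_ u)).
  by rewrite -bin_ffact leq_pmulr// fact_gt0.
elim: u => [|u IH]; first by rewrite ffactn0.
by rewrite ffactnSr expnSr leq_mul// leq_subr.
Qed.

(** Bias-variance decomposition. At the Gibbs mean it shows V >= 0; at [a = mu] it bounds V by the
    mean squared distance to mu. *)
Lemma dot_sqn_mean {R : realType} (I : finType) (Q : pred I) (w : I -> R) n (x : I -> 'cV[R]_n)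
    (a : 'cV[R]_n) : \sum_(i | Q i) w i = 1 ->
  \sum_(i | Q i) w i * sqn (x i - a) =
    (\sum_(i | Q i) w i * sqn (x i) - sqn (\sum_(i | Q i) w i *: x i))
    + sqn (\sum_(i | Q i) w i *: x i - a).
Proof.
move=> w1; set xb := \sum_(i | Q i) w i *: x i.
have -> : \sum_(i | Q i) w i * sqn (x i - a) =
    \sum_(i | Q i) w i * sqn (x i) - 2 * dot xb a + sqn a.
  have aE : sqn a = \sum_(i | Q i) w i * sqn a by rewrite -mulr_suml w1 mul1r.
  rewrite /xb dot_suml mulr_sumr -sumrB [in RHS]aE -big_split/=.
  by apply: eq_bigr => i _; rewrite sqnB dotZl; ring.
by rewrite sqnB; ring.
Qed.

(** * Pathwise bounds on the estimators *)

Section deterministic.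
Context {R : realType} {n p : nat}.
Variables (Z : 'M[R]_(n, p)) (mu eps : 'cV[R]_n) (alpha b : R) (u : nat) (S : {set 'I_p}).
Hypotheses (alpha0 : 0 < alpha) (Su : (#|S| <= u)%N) (up : (u <= p)%N).
Hypothesis muS : sqn (projperp_cols Z S mu) <= b.
Hypothesis noise : forall m : {set 'I_p}, #|m| = u ->
  \sum_(q <- gram_schmidt (mu :: cols Z m)) dot q eps ^+ 2 <= b.

Implicit Types m : {set 'I_p}.

Let y := mu + eps.
Let L : R := u%:R * ln p%:R.
Let A2 m := sqn (projperp_cols Z m mu).
Let B m := sqn (proj_cols Z m eps).
(** Subtracting |eps|^2 shifts all residuals equally, so the Gibbs weights do not change, and
    removes the part of order n. *)
Let r m := sqn (projperp_cols Z m y) - sqn eps.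
Let w m := wgt alpha u Z y m.
Let target := sqn mu + 2 * dot mu eps.

Let b0 : 0 <= b. Proof. exact: le_trans (sqn_ge0 _) muS. Qed.

Let rE m : r m = A2 m + 2 * dot (projperp_cols Z m mu) eps - B m.
Proof.
rewrite /r /A2 /B /y /projperp_cols !proj_colsE prjD.
set qs := gram_schmidt _; have oqs : orthosys qs by exact: orthosys_gram_schmidt.
have -> : mu + eps - (prj qs mu + prj qs eps) = (mu - prj qs mu) + (eps - prj qs eps).
  by rewrite opprD addrACA.
rewrite sqnD (sqnB eps) dotBr.
have -> : dot (mu - prj qs mu) (prj qs eps) = 0 by rewrite dotC prj_perp.
have -> : dot eps (prj qs eps) = sqn (prj qs eps).
  by rewrite dotC sqnE; apply/eqP; rewrite -subr_eq0 -dotBr prj_perp.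
ring.
Qed.

(** The head of the Gram-Schmidt system of [mu :: cols Z m] is the normalized P_m^perp mu, and the
    tail spans the columns of Z_m: the cross term and |P_m eps|^2 share one energy. *)
Let noiseE m : \sum_(q <- gram_schmidt (mu :: cols Z m)) dot q eps ^+ 2 =
  dot (normalize (projperp_cols Z m mu)) eps ^+ 2 + B m.
Proof.
rewrite /= big_cons /B /projperp_cols !proj_colsE sqn_prj//.
exact: orthosys_gram_schmidt.
Qed.

Let B_le m : #|m| = u -> B m <= b.
Proof.
by move=> /noise; rewrite noiseE; apply: le_trans; rewrite lerDr sqr_ge0.
Qed.

(** The factorization through the normalized vector avoids dividing by |P_m^perp mu|, which may
    vanish. *)
Let cross m : #|m| = u -> exists2 c, dot (projperp_cols Z m mu) eps = Num.sqrt (A2 m) * c & c ^+ 2 <= b.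
Proof.
move=> um; exists (dot (normalize (projperp_cols Z m mu)) eps).
  by rewrite -dotZl scale_normalize.
by have := noise um; rewrite noiseE; apply: le_trans; rewrite lerDl sqn_ge0.
Qed.

(** With s^2 = A2 m, from 2 s c >= - s^2 / 2 - 2 c^2: half of the bias pays for the cross term,
    leaving 2 b for c^2 and b for B m. The surviving half is what later bounds the mean bias. *)
Let r_ge m : #|m| = u -> A2 m / 2 - 3 * b <= r m.
Proof.
move=> um; rewrite rE; have [c -> cb] := cross um; have Bb := B_le um.
have sA : Num.sqrt (A2 m) ^+ 2 = A2 m by rewrite sqr_sqrtr// sqn_ge0.
have := sqr_ge0 (Num.sqrt (A2 m) + 2 * c).
rewrite sqrrD exprMn sA; move: (Num.sqrt (A2 m)) => s; lra.
Qed.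

Let r_le m : #|m| = u -> A2 m <= b -> r m <= 3 * b.
Proof.
move=> um Ab; rewrite rE; have [c -> cb] := cross um.
have B0 : 0 <= B m by exact: sqn_ge0.
have sA : Num.sqrt (A2 m) ^+ 2 = A2 m by rewrite sqr_sqrtr// sqn_ge0.
have := sqr_ge0 (Num.sqrt (A2 m) - c).
rewrite sqrrB sA; move: (Num.sqrt (A2 m)) => s; lra.
Qed.

Let m0_ex : exists m : {set 'I_p}, #|m| = u /\ A2 m <= b.
Proof.
have [|m [um Sm]] := @exists_superset 'I_p S u; first by rewrite Su card_ord.
by exists m; split => //; apply: le_trans muS; exact: sqn_projperp_le.
Qed.

Let w_ge0 m : 0 <= w m.
Proof.
rewrite /w /wgt divr_ge0 ?expR_ge0// sumr_ge0// => k _; exact: expR_ge0.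
Qed.

Let w_sum : \sum_(m : {set 'I_p} | #|m| == u) w m = 1.
Proof.
have [m0 [um0 _]] := m0_ex.
rewrite -mulr_suml divff// gt_eqF// (bigD1 m0) ?um0//= ltr_wpDr ?expR_gt0//.
by apply: sumr_ge0 => k _; exact: expR_ge0.
Qed.

Let card_le : ln #|[pred m : {set 'I_p} | #|m| == u]|%:R <= L :> R.
Proof.
have -> : #|[pred m : {set 'I_p} | #|m| == u]| = 'C(p, u).
  by rewrite -[p in RHS]card_ord -card_draws cardsE; apply: eq_card => m; rewrite !inE.
have C0 : (0 < 'C(p, u))%N by rewrite bin_gt0.
(* If [p = 0] then [u = 0]: there is a single model, and both sides vanish. *)
have [p0|p0] := posnP p.
  move: up; rewrite /L p0 leqn0 => /eqP ->; rewrite bin0 mul0r ln1; exact: lexx.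
rewrite /L mulr_natl -lnXn ?ltr0n// ler_ln ?posrE ?exprn_gt0 ?ltr0n//.
by rewrite -natrX ler_nat bin_le_exp.
Qed.

Let W := \sum_(m : {set 'I_p} | #|m| == u) w m * r m.

Let wmean_r f c : (forall m : {set 'I_p}, #|m| = u -> f m <= c) ->
  \sum_(m : {set 'I_p} | #|m| == u) w m * f m <= c.
Proof.
move=> fc; rewrite -[c]mul1r -w_sum mulr_suml; apply: ler_sum => m /eqP um.
by rewrite ler_wpM2l//; exact: fc.
Qed.

Let W_le : W <= 3 * b + alpha * L.
Proof.
have [m0 [um0 Am0]] := m0_ex.
have := @gibbs_mean_le R _ [pred m : {set 'I_p} | #|m| == u]
  (fun m => sqn (projperp_cols Z m y)) alpha m0 alpha0.
rewrite /= um0 eqxx => /(_ isT) h.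
have -> : W = \sum_(m : {set 'I_p} | #|m| == u) w m * sqn (projperp_cols Z m y) - sqn eps.
  rewrite -[sqn eps]mul1r -w_sum mulr_suml -sumrB; apply: eq_bigr => m _.
  by rewrite mulrBr.
have := r_le um0 Am0; rewrite /r => h1.
have := ler_wpM2l (ltW alpha0) card_le => h2.
have := le_trans h _; rewrite /w /wgt => {}h.
apply: (@le_trans _ _ (sqn (projperp_cols Z m0 y) +
         alpha * ln #|[pred m : {set 'I_p} | #|m| == u]|%:R - sqn eps)).
  by rewrite lerD2r; apply: h.
lra.
Qed.

Let W_ge : - (3 * b) <= W.
Proof.
rewrite lerNl -[leLHS]mulN1r mulr_sumr.
under eq_bigr do rewrite mulrCA.
apply: wmean_r => m um; have := r_ge um; have : 0 <= A2 m by exact: sqn_ge0.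
lra.
Qed.

(** A model of large bias has a large residual by [r_ge], so a small Gibbs mean of the residuals
    forces a small mean bias: 6 b + 2 W with W at most 3 b + alpha L. *)
Let A_mean : \sum_(m : {set 'I_p} | #|m| == u) w m * A2 m <= 12 * b + 2 * (alpha * L).
Proof.
have : \sum_(m : {set 'I_p} | #|m| == u) w m * (A2 m - 2 * r m) <= 6 * b.
  by apply: wmean_r => m um; have := r_ge um; lra.
under eq_bigr do rewrite mulrBr mulrCA.
rewrite sumrB -mulr_sumr -/W; have := W_le; lra.
Qed.

Let sqn_proj m : sqn (proj_cols Z m y) = sqn y - sqn (projperp_cols Z m y).
Proof.
rewrite /projperp_cols !proj_colsE; set qs := gram_schmidt _.
have oqs : orthosys qs by exact: orthosys_gram_schmidt.
rewrite sqnB; have -> : dot y (prj qs y) = sqn (prj qs y); last by ring.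
by rewrite dotC sqnE; apply/eqP; rewrite -subr_eq0 -dotBr prj_perp.
Qed.

Let II := \sum_(m : {set 'I_p} | #|m| == u) w m * sqn (proj_cols Z m y).

Let II_E : II = target - W.
Proof.
rewrite /II /W /target.
under eq_bigr do rewrite sqn_proj.
have -> : \sum_(m : {set 'I_p} | #|m| == u) w m * (sqn y - sqn (projperp_cols Z m y)) =
   \sum_(m : {set 'I_p} | #|m| == u) (w m * (sqn y - sqn eps) - w m * r m).
  by apply: eq_bigr => m _; rewrite /r; ring.
by rewrite sumrB -mulr_suml w_sum /y sqnD; ring.
Qed.

Let V := II - sqn (muhat alpha u Z y).

Let V_ge0 : 0 <= V.
Proof.
have := dot_sqn_mean (fun m => proj_cols Z m y) (muhat alpha u Z y) w_sum.
rewrite /= -/II -/(muhat alpha u Z y) subrr [X in _ + X](_ : _ = 0); last first.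
  by rewrite /sqn big1// => i _; rewrite mxE expr0n.
rewrite addr0 -/V => <-; apply: sumr_ge0 => m _; rewrite mulr_ge0// sqn_ge0//.
Qed.

(** P_m y - mu = P_m eps - P_m^perp mu is an orthogonal decomposition, so its mean squared norm is
    the mean of A2 + B: 12 b + 2 alpha L for the bias, b for the noise. *)
Let V_le : V <= 13 * b + 2 * (alpha * L).
Proof.
have := dot_sqn_mean (fun m => proj_cols Z m y) mu w_sum.
rewrite /= -/II -/(muhat alpha u Z y) -/V => h.
have : V <= \sum_(m : {set 'I_p} | #|m| == u) w m * sqn (proj_cols Z m y - mu).
  by rewrite h lerDl sqn_ge0.
have -> : \sum_(m : {set 'I_p} | #|m| == u) w m * sqn (proj_cols Z m y - mu) =
    \sum_(m : {set 'I_p} | #|m| == u) (w m * A2 m + w m * B m).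
  apply: eq_bigr => m _; rewrite -mulrDr /A2 /B /y /projperp_cols !proj_colsE prjD.
  set qs := gram_schmidt _; have oqs : orthosys qs by exact: orthosys_gram_schmidt.
  have -> : prj qs mu + prj qs eps - mu = prj qs eps - (mu - prj qs mu).
    by rewrite opprB addrA (addrC (prj qs mu)).
  by rewrite sqnB prj_perp//; congr (_ * _); ring.
rewrite big_split/= => hV.
have := A_mean; have := @wmean_r B b B_le; lra.
Qed.

Let L_ge0 : 0 <= alpha * L.
Proof.
apply: mulr_ge0; first exact: ltW.
rewrite /L mulr_ge0//; have [->|p0] := posnP p; first by rewrite ln0.
by rewrite ln_ge0// ler1n.
Qed.

(** Up to the factor 1/n the estimators are II - V, II and II + V with II = target - W; the third
    uses <y, P_m y> = |P_m y|^2. The bounds on W and V add up: 16 = 3 + 13 and 3 = 1 + 2. *)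
Lemma estimators_deterministic :
  [/\ `|sig2_I alpha u Z y - target / n%:R| <= (16 * b + 3 * (alpha * L)) / n%:R,
      `|sig2_II alpha u Z y - target / n%:R| <= (16 * b + 3 * (alpha * L)) / n%:R &
      `|sig2_III alpha u Z y - target / n%:R| <= (16 * b + 3 * (alpha * L)) / n%:R].
Proof.
have key x : `|x - target| <= 16 * b + 3 * (alpha * L) ->
   `|x / n%:R - target / n%:R| <= (16 * b + 3 * (alpha * L)) / n%:R.
  by move=> h; rewrite -mulrBl normrM normfV (ger0_norm (ler0n R n)) ler_wpM2r// invr_ge0.
have := W_le; have := W_ge; have := V_le; have := V_ge0; have := II_E; have := L_ge0;
  move: b0 => ? ? ? ? ? ? ?.
have IE : sqn (muhat alpha u Z y) = II - V by rewrite /V; ring.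
split; apply: key.
- by rewrite IE ler_norml; apply/andP; split; lra.
- by rewrite -/II ler_norml; apply/andP; split; lra.
- have -> : sqn y - sqn (y - muhat alpha u Z y) = II + V.
    rewrite sqnB IE.
    have -> : dot y (muhat alpha u Z y) = II; last by ring.
    rewrite /muhat dot_sumr; apply: eq_bigr => m _; rewrite dotZr proj_colsE; congr (_ * _).
    set qs := gram_schmidt _; have oqs : orthosys qs by exact: orthosys_gram_schmidt.
    by rewrite dotC sqnE; apply/eqP; rewrite -subr_eq0 -dotBr prj_perp.
  by rewrite ler_norml; apply/andP; split; lra.
Qed.

End deterministic.

(** * Measurability of the estimators *)

Lemma measurable_ext d d' (T : measurableType d) (T' : measurableType d') (g f : T -> T') :
  g =1 f -> measurable_fun setT g -> measurable_fun setT f.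
Proof. by move=> /funext ->. Qed.

Lemma measurable_bigsum d (T : measurableType d) (R : realType) (I : Type) (s : seq I)
    (Q : pred I) (f : I -> T -> R) : (forall i, Q i -> measurable_fun setT (f i)) ->
  measurable_fun setT (fun x => \sum_(i <- s | Q i) f i x).
Proof.
move=> mf; elim: s => [|i s IH].
  by apply: measurable_ext (@measurable_cst _ _ T _ setT (0 : R)) => x; rewrite big_nil.
case: (boolP (Q i)) => Qi; last first.
  by apply: measurable_ext IH => x; rewrite big_cons (negbTE Qi).
by apply: measurable_ext (measurable_funD (mf i Qi) IH) => x; rewrite big_cons Qi.
Qed.

(** Inversion is discontinuous at 0, but on non-negative reals, 0 included, it is the power of
    exponent -1, which is measurable. *)
Lemma measurable_inv_ge0 d (T : measurableType d) (R : realType) (f : T -> R) :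
  measurable_fun setT f -> (forall x, 0 <= f x) ->
  measurable_fun setT (fun x => (f x)^-1).
Proof.
move=> mf f0; have -> : (fun x => (f x)^-1) = (@powR R ^~ (-1)) \o f.
  by apply/funext => x /=; rewrite powR_inv1.
by apply: measurableT_comp => //; exact: measurable_powR.
Qed.

Section measurable_vectors.
Context d (T : measurableType d) (R : realType) (n : nat).
Implicit Types (v w : T -> 'cV[R]_n) (s : T -> seq 'cV[R]_n).

Definition mvec v := forall i, measurable_fun setT (fun x => v x i 0).

(** A random list of fixed length with measurable entries. Its induction principle follows the
    recursion of Gram-Schmidt, so no sigma-algebra on lists has to be introduced. *)
Inductive mseq : (T -> seq 'cV[R]_n) -> Prop :=
| mseq_nil : mseq (fun _ => [::])
| mseq_cons v s : mvec v -> mseq s -> mseq (fun x => v x :: s x).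

Lemma mvecD v w : mvec v -> mvec w -> mvec (fun x => v x + w x).
Proof.
by move=> mv mw i; apply: measurable_ext (measurable_funD (mv i) (mw i)) => x; rewrite mxE.
Qed.

Lemma mvecZ (a : T -> R) v : measurable_fun setT a -> mvec v -> mvec (fun x => a x *: v x).
Proof.
by move=> ma mv i; apply: measurable_ext (measurable_funM ma (mv i)) => x; rewrite mxE.
Qed.

Lemma mvecB v w : mvec v -> mvec w -> mvec (fun x => v x - w x).
Proof.
by move=> mv mw i; apply: measurable_ext (measurable_funB (mv i) (mw i)) => x; rewrite !mxE.
Qed.

Lemma mvec_ext v w : v =1 w -> mvec v -> mvec w.
Proof. by move=> /funext ->. Qed.

Lemma mvec0 : mvec (fun _ => 0).
Proof. by move=> i; apply: measurable_ext (@measurable_cst _ _ T _ setT (0 : R)) => x; rewrite mxE. Qed.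

Lemma mvec_sum (I : Type) (r : seq I) (Q : pred I) (f : I -> T -> 'cV[R]_n) :
  (forall i, Q i -> mvec (f i)) -> mvec (fun x => \sum_(i <- r | Q i) f i x).
Proof.
move=> mf; elim: r => [|i r IH].
  by apply: mvec_ext mvec0 => x; rewrite big_nil.
case: (boolP (Q i)) => Qi; last first.
  by apply: mvec_ext IH => x; rewrite big_cons (negbTE Qi).
by apply: mvec_ext (mvecD (mf i Qi) IH) => x; rewrite big_cons Qi.
Qed.

Lemma measurable_dot v w : mvec v -> mvec w -> measurable_fun setT (fun x => dot (v x) (w x)).
Proof. by move=> mv mw; apply: measurable_bigsum => i _; exact: measurable_funM. Qed.

Lemma measurable_sqn v : mvec v -> measurable_fun setT (fun x => sqn (v x)).
Proof. by move=> mv; apply: measurable_ext (measurable_dot mv mv) => x; rewrite sqnE. Qed.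

Lemma mvec_normalize v : mvec v -> mvec (fun x => normalize (v x)).
Proof.
move=> mv; apply: mvecZ => //; apply: measurable_inv_ge0 => [|x]; last exact: sqrtr_ge0.
apply: (measurableT_comp (f := @Num.sqrt R)); last exact: measurable_sqn.
by apply: continuous_measurable_fun; exact: sqrt_continuous.
Qed.

Lemma mvec_prj s v : mseq s -> mvec v -> mvec (fun x => prj (s x) (v x)).
Proof.
move=> ms mv; elim: ms => [|w {}s mw _ IH].
  by apply: mvec_ext mvec0 => x; rewrite /prj big_nil.
have mh := mvecZ (measurable_dot mw mv) mw.
by apply: mvec_ext (mvecD mh IH) => x; rewrite prj_cons.
Qed.

Lemma mseq_gram_schmidt s : mseq s -> mseq (fun x => gram_schmidt (s x)).
Proof.
elim=> [|v {}s mv ms IH]; first exact: mseq_nil.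
apply: mseq_cons => //; apply: mvec_normalize; apply: mvecB => //.
exact: mvec_prj.
Qed.

Lemma measurable_mseq_energy s v : mseq s -> mvec v ->
  measurable_fun setT (fun x => \sum_(q <- s x) dot q (v x) ^+ 2).
Proof.
move=> ms mv; elim: ms => [|w {}s mw _ IH].
  by apply: measurable_ext (@measurable_cst _ _ T _ setT (0 : R)) => x; rewrite big_nil.
have mh := measurable_funX 2 (measurable_dot mw mv).
by apply: measurable_ext (measurable_funD mh IH) => x; rewrite big_cons.
Qed.

End measurable_vectors.

Section measurable_estimators.
Context d (T : measurableType d) (R : realType) (n p : nat).
Variables (Z : T -> 'M[R]_(n, p)) (y : T -> 'cV[R]_n) (alpha : R) (u : nat).
Hypotheses (mZ : forall i j, measurable_fun setT (fun x => Z x i j)) (my : mvec y).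

Lemma mseq_cols (m : {set 'I_p}) : mseq (fun x => cols (Z x) m).
Proof.
rewrite /cols; elim: (enum m) => [|j s IH] /=; first exact: mseq_nil.
apply: (mseq_cons (v := fun x => col j (Z x))) => // i.
by apply: measurable_ext (mZ i j) => x; rewrite mxE.
Qed.

Lemma mvec_proj_cols (m : {set 'I_p}) : mvec (fun x => proj_cols (Z x) m (y x)).
Proof.
have ms := mseq_gram_schmidt (mseq_cols m).
by apply: mvec_ext (mvec_prj ms my) => x; rewrite proj_colsE.
Qed.

Lemma mvec_projperp_cols (m : {set 'I_p}) : mvec (fun x => projperp_cols (Z x) m (y x)).
Proof. by apply: mvecB => //; exact: mvec_proj_cols. Qed.

Let mexp (m : {set 'I_p}) :
  measurable_fun setT (fun x => expR (- sqn (projperp_cols (Z x) m (y x)) / alpha)).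
Proof.
apply: measurableT_comp => //; apply: measurable_funM => //.
by apply: measurable_funN; apply: measurable_sqn; exact: mvec_projperp_cols.
Qed.

Lemma measurable_wgt (m : {set 'I_p}) : measurable_fun setT (fun x => wgt alpha u (Z x) (y x) m).
Proof.
apply: measurable_funM => //; apply: measurable_inv_ge0.
  by apply: measurable_bigsum => k _; exact: mexp.
by move=> x; apply: sumr_ge0 => k _; exact: expR_ge0.
Qed.

Lemma mvec_muhat : mvec (fun x => muhat alpha u (Z x) (y x)).
Proof.
apply: mvec_sum => m _; apply: mvecZ; first exact: measurable_wgt.
exact: mvec_proj_cols.
Qed.

Lemma measurable_sig2_I : measurable_fun setT (fun x => sig2_I alpha u (Z x) (y x)).
Proof. by apply: measurable_funM => //; apply: measurable_sqn; exact: mvec_muhat. Qed.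

Lemma measurable_sig2_II : measurable_fun setT (fun x => sig2_II alpha u (Z x) (y x)).
Proof.
apply: measurable_funM => //; apply: measurable_bigsum => m _.
apply: measurable_funM; first exact: measurable_wgt.
by apply: measurable_sqn; exact: mvec_proj_cols.
Qed.

Lemma measurable_sig2_III : measurable_fun setT (fun x => sig2_III alpha u (Z x) (y x)).
Proof.
apply: measurable_funM => //; apply: measurable_funB; first exact: measurable_sqn.
by apply: measurable_sqn; apply: mvecB => //; exact: mvec_muhat.
Qed.

End measurable_estimators.

(** * Sub-Gaussian quadratic forms *)

Lemma integral_probability_cst d (T : measurableType d) (R : realType) (P : probability T R)
    (r : R) : (\int[P]_x r%:E = r%:E)%E.
Proof.
transitivity (r%:E * P setT)%E; first exact: (integral_cst P measurableT r%:E).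
by rewrite (@probability_setT _ _ _ P) mule1.
Qed.

Section gaussian_square.
Context {R : realType}.

(** Multiplying the standard density by exp (t^2 / 4) gives a multiple of the density of variance 2,
    hence [s = sqrt 2]. The bound is put as exp c with c >= 0 because one such factor is paid per
    vector of the system. *)
Lemma normal_exp_sqr_finite : exists2 c : R, 0 <= c &
  (\int[normal_prob 0 1]_t (expR (t ^+ 2 / 4))%:E <= (expR c)%:E)%E.
Proof.
pose s : R := Num.sqrt 2.
have s0 : 0 < s by rewrite sqrtr_gt0.
have sn0 : s != 0 by rewrite gt_eqF.
have mexp : measurable_fun setT (fun t : R => (expR (t ^+ 2 / 4))%:E).
  apply/measurable_EFinP; apply: measurableT_comp => //.
  by apply: measurable_funM => //; exact: exprn_measurable.
have c0 : 0 < normal_peak 1 / normal_peak s :> R by rewrite divr_gt0 ?normal_peak_gt0 ?oner_neq0.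
have E : (\int[normal_prob 0 1]_t (expR (t ^+ 2 / 4))%:E = (normal_peak 1 / normal_peak s)%:E)%E.
  rewrite (ge0_integral_normal 0 1 mexp); last by move=> t; rewrite lee_fin expR_ge0.
  transitivity (\int[@lebesgue_measure R]_t ((normal_peak 1 / normal_peak s)%:E * (normal_pdf 0 s t)%:E))%E.
    apply: eq_integral => t _; rewrite -!EFinM; congr (_%:E).
    rewrite !normal_pdfE ?oner_neq0//= [RHS]mulrA divfK; last by rewrite gt_eqF// normal_peak_gt0.
    rewrite mulrCA; congr (_ * _); rewrite /normal_fun -expRD; congr expR.
    by rewrite /s sqr_sqrtr// expr1n; field.
  rewrite ge0_integralZl.
  - by rewrite integral_normal_pdf mule1.
  - exact: measurableT.
  - by apply/measurable_EFinP; exact: measurable_normal_pdf.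
  - by move=> t _; rewrite lee_fin normal_pdf_ge0.
  - by rewrite lee_fin ltW.
exists `|ln (normal_peak 1 / normal_peak s : R)| => //.
rewrite E lee_fin -{1}(lnK (x := normal_peak 1 / normal_peak s)) ?posrE//.
by rewrite ler_expR ler_norm.
Qed.

End gaussian_square.

Section subgaussian.
Context d (T : measurableType d) (R : realType) (P : probability T R).
Variables (n : nat) (eps : 'I_n -> T -> R) (K : R).
Hypotheses (meps : forall i, measurable_fun setT (eps i)) (ind : mutually_indep P eps).
Hypothesis subG : forall i l,
  (\int[P]_x (expR (l * eps i x))%:E <= (expR (K ^+ 2 * l ^+ 2 / 2))%:E)%E.

(** Independence splits off one coordinate at a time; restricting the sum by [i < k] keeps every
    index in the same 'I_n, so one family of cylinders serves all steps. *)
Lemma subgaussian_partial_sum (a : 'I_n -> R) k :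
  (\int[P]_x (expR (\sum_(i < n | (i < k)%N) a i * eps i x))%:E <=
   (expR (K ^+ 2 * (\sum_(i < n | (i < k)%N) a i ^+ 2) / 2))%:E)%E.
Proof.
elim: k => [|k IH].
  under eq_integral do rewrite big_pred0 ?expR0//.
  by rewrite integral_probability_cst big_pred0// mulr0 mul0r expR0.
have [kn|nk] := ltnP k n; last first.
  have E (f : 'I_n -> R) : \sum_(i < n | (i < k.+1)%N) f i = \sum_(i < n | (i < k)%N) f i.
    apply: eq_bigl => i; rewrite !(leq_trans (ltn_ord i))//; exact: leqW.
  by rewrite E; under eq_integral do rewrite E.
pose i0 := Ordinal kn.
have E (f : 'I_n -> R) : \sum_(i < n | (i < k.+1)%N) f i = \sum_(i < n | (i < k)%N) f i + f i0.
  rewrite (bigD1 i0)//= addrC; congr (_ + _); apply: eq_bigl => i.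
  by rewrite ltnS ltn_neqAle andbC.
rewrite E; under eq_integral do rewrite E expRD.
pose J1 : {set 'I_n} := [set i : 'I_n | (i < k)%N]%SET.
pose J2 : {set 'I_n} := [set i0]%SET.
have dJ i : i \in J1 -> i \notin J2.
  by rewrite !inE => ik; apply/eqP => ii; move: ik; rewrite ii ltnn.
have mf : measurable_fun setT (fun x : g_sigma_algebraType (cylinders eps J1) =>
    expR (\sum_(i < n | (i < k)%N) a i * eps i x)).
  apply: measurableT_comp => //; apply: measurable_bigsum => i ik.
  by apply: measurable_funM => //; apply: measurable_cylinders; rewrite inE.
have mg : measurable_fun setT (fun x : g_sigma_algebraType (cylinders eps J2) =>
    expR (a i0 * eps i0 x)).
  apply: measurableT_comp => //; apply: measurable_funM => //.
  by apply: measurable_cylinders; rewrite inE.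
rewrite (ge0_indep_expectationM (cylinders_measurable meps (J := J1)) (cylinders_measurable meps (J := J2))
  (@cylinders_setI _ T R _ eps J1) (@cylinders_setI _ T R _ eps J2)
  (@cylinders_setT _ T R _ eps J1) (@cylinders_setT _ T R _ eps J2)
  (indep_cylinders ind dJ) mf mg (fun x => expR_ge0 _) (fun x => expR_ge0 _)).
rewrite mulrDr mulrDl expRD EFinM; apply: lee_pmul => //.
- by apply: integral_ge0 => x _; rewrite lee_fin expR_ge0.
- by apply: integral_ge0 => x _; rewrite lee_fin expR_ge0.
Qed.

Definition evec (x : T) : 'cV[R]_n := \col_i eps i x.

Lemma mvec_evec : mvec evec.
Proof. by move=> i; apply: measurable_ext (meps i) => x; rewrite mxE. Qed.

Lemma subgaussian_dot (b : 'cV[R]_n) :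
  (\int[P]_x (expR (dot b (evec x)))%:E <= (expR (K ^+ 2 * sqn b / 2))%:E)%E.
Proof.
have := subgaussian_partial_sum (fun i => b i 0) n.
have E (f : 'I_n -> R) : \sum_(i < n | (i < n)%N) f i = \sum_(i < n) f i.
  by apply: eq_bigl => i; rewrite ltn_ord.
rewrite E; under eq_integral do rewrite E; move=> h; apply: le_trans h.
rewrite le_eqVlt; apply/orP; left; apply/eqP; apply: eq_integral => x _.
by congr ((expR _)%:E); apply: eq_bigr => i _; rewrite mxE.
Qed.

(* exp (a^2 / 2) is the mean of exp (a t) over a standard normal t: with a = s <q, eps>, the
   square is traded for a linear form, and Fubini reduces to the next vector. *)
Lemma subgaussian_quadratic (s c : R) (qs : seq 'cV[R]_n) (b : 'cV[R]_n) :
  K ^+ 2 * s ^+ 2 <= 1 / 2 -> 0 <= c ->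
  (\int[normal_prob 0 1]_t (expR (t ^+ 2 / 4))%:E <= (expR c)%:E)%E ->
  orthosys qs -> (forall q, q \in qs -> dot b q = 0) ->
  (\int[P]_x (expR (s ^+ 2 / 2 * (\sum_(q <- qs) dot q (evec x) ^+ 2) + dot b (evec x)))%:E <=
   (expR ((size qs)%:R * c + K ^+ 2 * sqn b / 2))%:E)%E.
Proof.
move=> Ks c0 Cc; elim: qs b => [|q qs IH] b.
  move=> _ _; under eq_integral do rewrite big_nil mulr0 add0r.
  by rewrite mul0r add0r; exact: subgaussian_dot.
move=> /= [oq nq oqs] bq.
have mev := mvec_evec.
have mdot (w : 'cV[R]_n) : measurable_fun setT (fun x => dot w (evec x)).
  by apply: measurable_dot => // i; exact: measurable_cst.
pose G (x : T) := s ^+ 2 / 2 * (\sum_(q <- qs) dot q (evec x) ^+ 2) + dot b (evec x).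
have mG : measurable_fun setT G.
  apply: measurable_funD => //; apply: measurable_funM => //.
  apply: measurable_bigsum => q' _; exact: measurable_funX.
pose F (xt : T * R) : \bar R := (expR (G xt.1 + xt.2 * (s * dot q (evec xt.1))))%:E.
have mF : measurable_fun setT F.
  apply/measurable_EFinP; apply: measurableT_comp => //; apply: measurable_funD.
    by apply: (measurableT_comp mG); exact: measurable_fst.
  apply: measurable_funM; first exact: measurable_snd.
  by apply: measurable_funM => //; apply: (measurableT_comp (mdot q)); exact: measurable_fst.
have F0 xt : (0 <= F xt)%E by rewrite lee_fin expR_ge0.
have one0 : (1 : R) != 0 by exact: oner_neq0.
have mexpT' (f : R -> R) : measurable_fun setT f -> measurable_fun setT (fun x => (expR (f x))%:E).
  by move=> mf; apply/measurable_EFinP; exact: measurableT_comp.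
have inner x : (\int[normal_prob 0 1]_t F (x, t) =
   (expR (s ^+ 2 / 2 * (\sum_(q <- q :: qs) dot q (evec x) ^+ 2) + dot b (evec x)))%:E)%E.
  rewrite /F /=; under eq_integral do rewrite expRD EFinM (mulrC _ (s * _)).
  rewrite ge0_integralZl.
  - rewrite normal_mgf// -EFinM -expRD; congr ((expR _)%:E).
    by rewrite /G big_cons expr1n; field.
  - exact: measurableT.
  - by apply: mexpT'; apply: measurable_funM.
  - by move=> t _; rewrite lee_fin expR_ge0.
  - by rewrite lee_fin expR_ge0.
have -> : (\int[P]_x (expR (s ^+ 2 / 2 * (\sum_(q <- q :: qs) dot q (evec x) ^+ 2) + dot b (evec x)))%:E =
    \int[P]_x \int[normal_prob 0 1]_t F (x, t))%E.
  by apply: eq_integral => x _; rewrite inner.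
rewrite (@fubini_tonelli _ _ T (measurableTypeR R) R P (normal_prob 0 1 : probability (measurableTypeR R) R) F mF F0).
have step t : (\int[P]_x F (x, t) <=
   (expR ((size qs)%:R * c + K ^+ 2 * sqn b / 2))%:E * (expR (t ^+ 2 / 4))%:E)%E.
  (* The vector [q], orthogonal to [b] and to the remaining ones, moves into the linear form:
     orthogonality persists and squared norms add. *)
  have bq' q' : q' \in qs -> dot (b + (t * s) *: q) q' = 0.
    by move=> q'qs; rewrite dotDl dotZl oq// bq ?inE ?q'qs ?orbT// mulr0 addr0.
  have -> : (\int[P]_x F (x, t) = \int[P]_x (expR (s ^+ 2 / 2 * (\sum_(q <- qs) dot q (evec x) ^+ 2)
      + dot (b + (t * s) *: q) (evec x)))%:E)%E.
    apply: eq_integral => x _; rewrite /F /G /=; congr ((expR _)%:E).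
    by rewrite dotDl dotZl; ring.
  apply: (le_trans (IH _ oqs bq')); rewrite -EFinM -expRD lee_fin ler_expR.
  have -> : sqn (b + (t * s) *: q) = sqn b + (t * s) ^+ 2 * sqn q.
    by rewrite sqnD dotZr bq ?inE ?eqxx// sqnZ; ring.
  have q1 : sqn q <= 1 by case: nq => ->.
  have q0 := sqn_ge0 q.
  (* The new squared norm contributes K^2 t^2 s^2 |q|^2 / 2, so this bound yields the exponent t^2 /
     4, still integrable against the standard Gaussian. *)
  have h1 : K ^+ 2 * s ^+ 2 * sqn q <= 1 / 2.
    by apply: le_trans Ks; rewrite ler_piMr// mulr_ge0// sqr_ge0.
  have := ler_wpM2r (sqr_ge0 t) h1.
  by rewrite exprMn; lra.
have c1 : (0 <= (expR ((size qs)%:R * c + K ^+ 2 * sqn b / 2))%:E)%E by rewrite lee_fin expR_ge0.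
have mt : measurable_fun setT (fun t : R => (expR (t ^+ 2 / 4))%:E).
  by apply: mexpT'; apply: measurable_funM => //; exact: exprn_measurable.
apply: (@le_trans _ _ (\int[normal_prob 0 1]_t
   ((expR ((size qs)%:R * c + K ^+ 2 * sqn b / 2))%:E * (expR (t ^+ 2 / 4))%:E))%E).
  apply: ge0_le_integral.
  - exact: measurableT.
  - by move=> t _; apply: integral_ge0 => x _.
  - exact: (@measurable_fun_fubini_tonelli_G _ _ T (measurableTypeR R) R P F mF F0).
  - by apply: emeasurable_funM.
  - by move=> t _; exact: step.
rewrite ge0_integralZl.
- apply: (le_trans (lee_wpmul2l c1 Cc)); rewrite -EFinM -expRD lee_fin ler_expR -natr1.
  by rewrite le_eqVlt; apply/orP; left; apply/eqP; ring.
- exact: measurableT.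
- exact: mt.
- by move=> t _; rewrite lee_fin expR_ge0.
- exact: c1.
Qed.

End subgaussian.

(** * Convergence in distribution *)

Lemma bounded_convergence d (T : measurableType d) (R : realType) (P : probability T R)
    (F : nat -> T -> R) (f : T -> R) (M : R) :
  (forall n, measurable_fun setT (F n)) -> (forall n x, `|F n x| <= M) ->
  (forall x, F n x @[n --> \oo] --> f x) ->
  \int[P]_x F n x @[n --> \oo] --> \int[P]_x f x.
Proof.
move=> mF FM Ff.
have mf : measurable_fun setT f by apply: (measurable_fun_cvg mF) => x _; exact: Ff.
have fM x : `|f x| <= M.
  have h : `|F n x| @[n --> \oo] --> `|f x| by apply: cvg_norm; exact: Ff.
  have cM : (fun _ : nat => M) @ \oo --> M by exact: cvg_cst.
  by apply: (ler_cvg_to h cM); apply: nearW => n; exact: FM.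
have mEF n : measurable_fun setT (EFin \o F n) by exact/measurable_EFinP.
have EFf x : setT x -> (EFin \o F n) x @[n --> \oo] --> (EFin \o f) x.
  by move=> _; apply/cvg_EFin; [exact: nearW|exact: Ff].
have fin x : setT x -> (EFin \o (cst M : T -> R)) x \is a fin_num by [].
have iM : P.-integrable setT (EFin \o (cst M : T -> R)) by exact: finite_measure_integrable_cst.
have dom n x : setT x -> (`|(EFin \o F n) x| <= (EFin \o (cst M : T -> R)) x)%E.
  by move=> _ /=; rewrite lee_fin.
have := dominated_cvg measurableT mEF EFf fin iM dom.
by rewrite (RintegralE (bounded_integrable P mf fM)) => /fine_cvg.
Qed.

(** * Lipschitz minorants of a bounded continuous function *)

Section inf_convolution.
Context {R : realType}.
Variables (f : R -> R) (M : R).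
Hypotheses (cf : continuous f) (fM : forall x, `|f x| <= M).

(** The Pasch-Hausdorff envelope: for k >= 0 and bounded [f], the largest k-Lipschitz function below
    [f]. *)
Definition inf_convolution (k x : R) : R := inf [set f y + k * `|x - y| | y in setT].

Let f_le x : f x <= M. Proof. exact: le_trans (ler_norm _) (fM x). Qed.
Let f_ge x : - M <= f x. Proof. by have := fM x; rewrite ler_norml => /andP[]. Qed.

Let lbnd k x : 0 <= k -> lbound [set f y + k * `|x - y| | y in setT] (- M).
Proof. by move=> k0 _ [y _ <-]; rewrite -[leLHS]addr0 lerD// mulr_ge0. Qed.

Lemma inf_convolution_le k x y : 0 <= k -> inf_convolution k x <= f y + k * `|x - y|.
Proof. by move=> k0; apply: ge_inf; [exists (- M); exact: lbnd|exists y]. Qed.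

Lemma inf_convolution_ge k x c : (forall y, c <= f y + k * `|x - y|) -> c <= inf_convolution k x.
Proof.
move=> h; apply: lb_le_inf; first by exists (f x + k * `|x - x|), x.
by move=> _ [y _ <-]; exact: h.
Qed.

Lemma inf_convolution_le_fun k x : 0 <= k -> inf_convolution k x <= f x.
Proof.
by move=> k0; have := inf_convolution_le x x k0; rewrite subrr normr0 mulr0 addr0.
Qed.

Lemma inf_convolution_bounded k x : 0 <= k -> `|inf_convolution k x| <= M.
Proof.
move=> k0; rewrite ler_norml (le_trans (inf_convolution_le_fun x k0) (f_le x)) andbT.
by apply: inf_convolution_ge => y; rewrite -[leLHS]addr0 lerD// mulr_ge0.
Qed.

Lemma inf_convolution_lipschitz k : 0 <= k ->
  forall x y, `|inf_convolution k x - inf_convolution k y| <= k * `|x - y|.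
Proof.
move=> k0.
suff H x y : inf_convolution k x - inf_convolution k y <= k * `|x - y|.
  by move=> x y; rewrite ler_norml H andbT lerNl opprB (distrC x y) H.
rewrite lerBlDr -lerBlDl; apply: inf_convolution_ge => z.
rewrite lerBlDl; apply: (le_trans (inf_convolution_le x z k0)).
rewrite addrCA lerD2l -mulrDr ler_wpM2l//.
by rewrite (le_trans _ (ler_normD _ _))// addrA subrK.
Qed.

(** Near [x] continuity keeps f y above f x - e; at distance at least r the penalty n r eventually
    exceeds 2 M, the largest possible gain. *)
Lemma inf_convolution_cvg x : inf_convolution n%:R x @[n --> \oo] --> f x.
Proof.
apply/cvgrPdist_le => /= e e0.
have fx : f y @[y --> x] --> f x by exact: cf.
move/cvgrPdist_le : fx => /(_ e e0) /nbhs_ballP[r /= r0 fr].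
near=> n.
have n0 : 0 <= n%:R :> R by [].
rewrite ger0_norm ?subr_ge0 ?inf_convolution_le_fun// lerBlDr -lerBlDl.
apply: inf_convolution_ge => y.
have [yr|yr] := ltP `|x - y| r.
  have := fr y yr; rewrite ler_norml => /andP[_ h].
  by apply: (@le_trans _ _ (f y)); [lra|rewrite lerDl mulr_ge0].
have h1 : 2 * M <= n%:R * r.
  by rewrite -ler_pdivrMr//; near: n; exact: nbhs_infty_ger.
have h2 : n%:R * r <= n%:R * `|x - y| by rewrite ler_wpM2l.
have := f_le x; have := f_ge y; lra.
Unshelve. all: by end_near. Qed.

End inf_convolution.

(** Presents the limit functional as integration against a probability, degenerate case included, so
    that bounded convergence applies to it. *)
Lemma normal0_mean_law d (T : measurableType d) (R : realType) (P : probability T R) (v : R) :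
  exists nu : probability (measurableTypeR R) R, forall (f : R -> R) (M : R),
    measurable_fun setT f -> (forall x, `|f x| <= M) -> normal0_mean v f = \int[nu]_x f x.
Proof.
case: (eqVneq v 0) => [v0|v0]; last first.
  by exists (normal_prob 0 (Num.sqrt v)) => f M _ _; rewrite /normal0_mean (negbTE v0).
have mc : measurable_fun [set: T] (cst 0 : T -> R) by exact: measurable_cst.
exists (law P mc) => f M mf fM.
have i0 : P.-integrable setT (EFin \o (f \o (cst 0 : T -> R))).
  have : P.-integrable setT (EFin \o cst (f 0)) by exact: finite_measure_integrable_cst.
  by [].
by rewrite (Rintegral_law mc mf i0) /normal0_mean v0 eqxx /= probability_Rintegral_cst.
Qed.

Section convergence_in_distribution.
Context d (T : measurableType d) (R : realType) (P : probability T R).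

(* Inf-convolutions are Lipschitz minorants increasing to f, so that no tightness is needed. *)
Lemma cvg_lipschitz_continuous (X : nat -> T -> R) (v : R) :
  (forall n, measurable_fun setT (X n)) ->
  (forall (f : R -> R) (K M : R), (forall x y, `|f x - f y| <= K * `|x - y|) ->
     (forall x, `|f x| <= M) -> \int[P]_x f (X n x) @[n --> \oo] --> normal0_mean v f) ->
  cvg_dist_normal0 P X v.
Proof.
move=> mX H f cf [M fM].
have [nu nuE] := normal0_mean_law P v.
have mcont (g : R -> R) : continuous g -> measurable_fun setT g by exact: continuous_measurable_fun.
have igX (g : R -> R) N n : measurable_fun setT g -> (forall x, `|g x| <= N) ->
    P.-integrable setT (EFin \o (fun x => g (X n x))).
  by move=> mg gN; apply: (@bounded_integrable _ _ _ P _ N) => //; exact: measurableT_comp.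
have lower (g : R -> R) : continuous g -> (forall x, `|g x| <= M) ->
    forall e : R, 0 < e -> \forall n \near \oo, normal0_mean v g - e <= \int[P]_x g (X n x).
  move=> cg gM e e0; pose gk (k : nat) := inf_convolution g k%:R.
  have gkL k x y : `|gk k x - gk k y| <= k%:R * `|x - y| by exact: (inf_convolution_lipschitz gM).
  have gkM k x : `|gk k x| <= M by exact: (inf_convolution_bounded gM).
  have mgk k : measurable_fun setT (gk k).
    by apply: mcont; exact: lipschitz_measurable (gkL k).
  have gk_cvg : \int[nu]_x gk k x @[k --> \oo] --> \int[nu]_x g x.
    exact: (@bounded_convergence _ (measurableTypeR R) R nu gk g M mgk gkM (fun x => inf_convolution_cvg cg gM (x := x))).
  have e20 : 0 < e / 2 by rewrite divr_gt0.
  have [k _ hk] : \forall k \near \oo, `|\int[nu]_x g x - \int[nu]_x gk k x| <= e / 2.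
    by move/cvgrPdist_le : gk_cvg; exact.
  have {}hk := hk k (leqnn k).
  have := H (gk k) _ M (gkL k) (gkM k).
  rewrite (nuE _ _ (mgk k) (gkM k)) (nuE _ _ (mcont _ cg) gM) => /cvgrPdist_le /(_ _ e20).
  apply: filterS => n hn.
  have : \int[P]_x gk k (X n x) <= \int[P]_x g (X n x).
    apply: le_Rintegral => //; first exact: (igX _ M _ (mgk k)).
      exact: (igX _ M _ (mcont _ cg)).
    by move=> x _; exact: (inf_convolution_le_fun gM).
  by move: hk hn; rewrite !ler_norml => /andP[? ?] /andP[? ?] ?; lra.
rewrite (normal0_integralE v (mcont _ cf) fM).
have -> : (fun n => (\int[P]_x (f (X n x))%:E)%E) = EFin \o (fun n => \int[P]_x f (X n x)).
  by apply/funext => n /=; rewrite (RintegralE (igX _ M n (mcont _ cf) fM)).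
apply/cvg_EFin; first exact: nearW.
apply/cvgrPdist_le => /= e e0.
(* The minorants give only the lower bound; the upper one is the lower bound for - f. *)
have cNf : continuous (fun x => - f x) by move=> x; apply: cvgN; exact: cf.
have Nf x : `|- f x| <= M by rewrite normrN.
have h1 := lower f cf fM e e0; have h2 := lower (fun x => - f x) cNf Nf e e0.
near=> n.
have k1 : normal0_mean v f - e <= \int[P]_x f (X n x) by near: n.
have : normal0_mean v (fun x => - f x) - e <= \int[P]_x - f (X n x) by near: n.
have RN (h : R -> R) d' (T' : measurableType d') (Q : probability T' R) (Y : T' -> R) :
    Q.-integrable setT (EFin \o (fun x => h (Y x))) -> \int[Q]_x - h (Y x) = - \int[Q]_x h (Y x).
  move=> i; have := RintegralZl (-1) measurableT i; rewrite mulN1r => <-.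
  by apply: eq_Rintegral => x _; rewrite mulN1r.
rewrite (nuE _ _ (mcont _ cNf) Nf) (RN f _ _ nu id); last first.
  exact: (bounded_integrable nu (mcont _ cf) fM).
rewrite (RN f _ _ P (X n)); last exact: (igX _ M n (mcont _ cf) fM).
move: k1; rewrite (nuE _ _ (mcont _ cf) fM) => k1 k2.
by rewrite ler_norml; apply/andP; split; lra.
Unshelve. all: by end_near. Qed.

(** Convergence in probability enters through exceptional sets rather than through |X - W| > e,
    because closeness is proved pointwise off an explicit event. *)
Lemma cvg_slutsky_lipschitz (X W : nat -> T -> R) (bad : R -> nat -> set T) (f : R -> R) (K M l : R) :
  (forall n, measurable_fun setT (X n)) -> (forall n, measurable_fun setT (W n)) ->
  (forall e n, 0 < e -> measurable (bad e n)) ->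
  (forall e, 0 < e -> P (bad e n) @[n --> \oo] --> 0%E) ->
  (forall e, 0 < e -> \forall n \near \oo, forall x, ~ bad e n x -> `|X n x - W n x| <= e) ->
  (forall x y, `|f x - f y| <= K * `|x - y|) -> (forall x, `|f x| <= M) ->
  \int[P]_x f (W n x) @[n --> \oo] --> l -> \int[P]_x f (X n x) @[n --> \oo] --> l.
Proof.
move=> mX mW mbad Pbad Hbad fK fM Wl.
have mf : measurable_fun setT f by apply: continuous_measurable_fun; exact: lipschitz_measurable fK.
have K0 : 0 <= K by have := le_trans (normr_ge0 _) (fK 1 0); rewrite subr0 normr1 mulr1.
have M0 : 0 <= M by exact: le_trans (normr_ge0 _) (fM 0).
have ifX (Y : nat -> T -> R) n : (forall n, measurable_fun setT (Y n)) ->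
    P.-integrable setT (EFin \o (fun x => f (Y n x))).
  by move=> mY; apply: (@bounded_integrable _ _ _ P _ M) => //; exact: measurableT_comp.
apply/cvgrPdist_le => /= e e0.
(* Off the bad set the error is at most K e1, on it at most 2 M times its probability; the [+ 1]
   covers K = 0 and M = 0. *)
pose e1 := e / 3 / (K + 1); pose e2 := e / 3 / (2 * M + 1).
have e10 : 0 < e1 by rewrite !divr_gt0// ltr_wpDl.
have e20 : 0 < e2 by rewrite !divr_gt0// ltr_wpDl// mulr_ge0.
have Ke1 : K * e1 <= e / 3.
  have -> : K * e1 = e / 3 * (K / (K + 1)) by rewrite /e1; field; rewrite gt_eqF// ltr_wpDl.
  rewrite ler_piMr//; first by rewrite divr_ge0// ltW.
  by rewrite ler_pdivrMr ?ltr_wpDl// mul1r lerDl.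
have Me2 : 2 * M * e2 <= e / 3.
  have M1 : 0 < 2 * M + 1 by rewrite ltr_wpDl// mulr_ge0.
  have -> : 2 * M * e2 = e / 3 * (2 * M / (2 * M + 1)) by rewrite /e2; field; rewrite gt_eqF.
  rewrite ler_piMr//; first by rewrite divr_ge0// ltW.
  by rewrite ler_pdivrMr// mul1r lerDl.
have PB : \forall n \near \oo, fine (P (bad e1 n)) <= e2.
  have /fine_cvg /cvgrPdist_le /(_ _ e20) := Pbad _ e10.
  by apply: filterS => n /=; rewrite sub0r normrN; apply: le_trans; exact: ler_norm.
have HB := Hbad _ e10.
have e30 : 0 < e / 3 by rewrite divr_gt0.
move/cvgrPdist_le : Wl => /(_ _ e30) Wl.
near=> n.
have w : `|l - \int[P]_x f (W n x)| <= e / 3 by near: n.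
have pb : fine (P (bad e1 n)) <= e2 by near: n.
have hb x : ~ bad e1 n x -> `|X n x - W n x| <= e1 by move: x; near: n.
have mb := mbad e1 n e10.
have h : `|\int[P]_x (f (W n x) - f (X n x))| <= K * e1 + 2 * M * fine (P (bad e1 n)).
  apply: (@le_Rintegral_bound _ _ _ P _ (fun x => K * e1 + 2 * M * \1_(bad e1 n) x)).
  - exact: (integrableB measurableT (ifX W n mW) (ifX X n mX)).
  - move=> x; rewrite indicE; have [xb|xb] := boolP (x \in bad e1 n).
      rewrite mulr1; apply: (le_trans (ler_normB _ _)).
      have := fM (W n x); have := fM (X n x); have := mulr_ge0 K0 (ltW e10); lra.
    rewrite mulr0 addr0; apply: (le_trans (fK _ _)); rewrite distrC ler_wpM2l//.
    by apply: hb => bx; move/negP : xb; apply; rewrite inE.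
  - by apply: measurable_funD => //; apply: measurable_funM => //; exact: measurable_indic.
  - have KM : 0 <= K * e1 by rewrite mulr_ge0// ltW.
    have mi : measurable_fun setT (fun x : T => (\1_(bad e1 n) x)%:E : \bar R).
      by apply/measurable_EFinP; exact: measurable_indic.
    have -> : (\int[P]_x (K * e1 + 2 * M * \1_(bad e1 n) x)%:E =
        \int[P]_x ((K * e1)%:E + (2 * M)%:E * (\1_(bad e1 n) x)%:E))%E.
      by apply: eq_integral => x _; rewrite EFinD EFinM.
    have M2 : 0 <= 2 * M by rewrite mulr_ge0.
    rewrite ge0_integralD.
    + rewrite (ge0_integralZl P measurableT mi); last by rewrite lee_fin.
        rewrite integral_indic// setIT integral_probability_cst.
        by rewrite EFinD (EFinM (2 * M)) fineK// fin_num_measure.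
      by move=> x _; rewrite lee_fin.
    + exact: measurableT.
    + by move=> x _; rewrite lee_fin.
    + exact: measurable_cst.
    + by move=> x _; rewrite mule_ge0// lee_fin.
    + by apply: emeasurable_funM.
have E : \int[P]_x (f (W n x) - f (X n x)) = \int[P]_x f (W n x) - \int[P]_x f (X n x).
  exact: (RintegralB measurableT (ifX W n mW) (ifX X n mX)).
rewrite E in h.
have pb2 : 2 * M * fine (P (bad e1 n)) <= 2 * M * e2 by rewrite ler_wpM2l// mulr_ge0.
rewrite -(subrK (\int[P]_x f (W n x)) l) -addrA.
apply: (le_trans (ler_normD _ _)).
lra.
Unshelve. all: by end_near. Qed.

End convergence_in_distribution.

(** * Sums of i.i.d. pairs *)

Lemma mutually_indep_sum d (T : measurableType d) (R : realType) (P : probability T R)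
    (I J : finType) (X : I -> T -> R) (Y : J -> T -> R) :
  mutually_indep P X -> mutually_indep P Y -> indep_families P X Y ->
  mutually_indep P (fun k => match k with inl i => X i | inr j => Y j end).
Proof.
move=> iX iY iXY A B mB.
pose A1 : {set I} := [set i | inl i \in A]%SET; pose A2 : {set J} := [set j | inr j \in A]%SET.
have -> : \bigcap_(k in [set` A]) (match k with inl i => X i | inr j => Y j end @^-1` B k) =
    \bigcap_(i in [set` A1]) (X i @^-1` B (inl i)) `&` \bigcap_(j in [set` A2]) (Y j @^-1` B (inr j)).
  apply/seteqP; split => x /=.
    move=> h; split => i /=; rewrite inE => iA; first exact: (h (inl i)).
    exact: (h (inr i)).
  by move=> [h1 h2] [i|j] /= iA; [apply: h1|apply: h2]; rewrite /= inE.
rewrite iXY// iX// iY// big_sumType /=.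
by congr (_ * _)%E; apply: eq_bigl => i; rewrite inE.
Qed.

Lemma indep_families_inr d (T : measurableType d) (R : realType) (P : probability T R)
    (I J K : finType) (X : I -> T -> R) (Y : J + K -> T -> R) :
  indep_families P X Y -> indep_families P X (fun k => Y (inr k)).
Proof.
move=> iXY A B F G mF mG.
pose G' (k : J + K) := match k with inl _ => setT | inr j => G j end.
have mG' k : measurable (G' k) by case: k => /=.
have E : \bigcap_(k in [set` [set inr j | j in B]%SET]) (Y k @^-1` G' k) =
    \bigcap_(j in [set` B]) (Y (inr j) @^-1` G j).
  apply/seteqP; split => x h.
    by move=> j jB; apply: (h (inr j)); apply/imsetP; exists j.
  by move=> k /imsetP[j jB ->]; exact: h.
by have := iXY A [set inr j | j in B]%SET F G' mF mG'; rewrite E.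
Qed.

Section equality_in_law.
Context d (T : measurableType d) (R : realType) (P : probability T R).
Variables (X Y X' Y' : T -> R).
Hypotheses (mX : measurable_fun setT X) (mY : measurable_fun setT Y)
  (mX' : measurable_fun setT X') (mY' : measurable_fun setT Y').
Hypothesis XX' : forall A, measurable A -> P (X @^-1` A) = P (X' @^-1` A).
Hypothesis YY' : forall A, measurable A -> P (Y @^-1` A) = P (Y' @^-1` A).
Hypothesis iXY : forall A B, measurable A -> measurable B ->
  P (X @^-1` A `&` Y @^-1` B) = (P (X @^-1` A) * P (Y @^-1` B))%E.
Hypothesis iXY' : forall A B, measurable A -> measurable B ->
  P (X' @^-1` A `&` Y' @^-1` B) = (P (X' @^-1` A) * P (Y' @^-1` B))%E.

(** Both joint laws are product measures with the same factors. This lets a pair (eps_i, mu_i) at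
    sample size n be exchanged for a fixed reference pair. *)
Lemma ge0_integral_eq_law2 (g : R * R -> \bar R) : measurable_fun setT g ->
  (forall z, 0 <= g z)%E -> (\int[P]_x g (X x, Y x) = \int[P]_x g (X' x, Y' x))%E.
Proof.
move=> mg g0.
have mXY := measurable_fun_pair mX mY; have mXY' := measurable_fun_pair mX' mY'.
transitivity (\int[distribution P (mfun_of mXY)]_z g z)%E.
  by rewrite ge0_integral_distribution.
transitivity (\int[distribution P (mfun_of mXY')]_z g z)%E; last first.
  by rewrite ge0_integral_distribution.
pose P1 := distribution P (mfun_of mX); pose P2 := distribution P (mfun_of mY).
have E1 A B : measurable A -> measurable B ->
   distribution P (mfun_of mXY) (A `*` B) = (P1 A * P2 B)%E.
  by move=> mA mB; exact: iXY.
have E2 A B : measurable A -> measurable B ->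
   distribution P (mfun_of mXY') (A `*` B) = (P1 A * P2 B)%E.
  by move=> mA mB; apply: (etrans (iXY' mA mB)); rewrite -XX'// -YY'.
have F1 := product_measure_unique E1; have F2 := product_measure_unique E2.
apply: eq_measure_integral => A mA _.
by rewrite -[LHS]F1// -[RHS]F2.
Qed.

Lemma Rintegral_eq_law2 (h : R -> R -> R) (f : R -> R) :
  measurable_fun setT (fun z : R * R => h z.1 z.2) -> bounded_measurable f ->
  \int[P]_x f (h (X x) (Y x)) = \int[P]_x f (h (X' x) (Y' x)).
Proof.
move=> mh [mf [M fM]].
have mfh : measurable_fun setT (fun z : R * R => f (h z.1 z.2)) by exact: measurableT_comp.
have E : (\int[P]_x (f (h (X x) (Y x)) + M)%:E = \int[P]_x (f (h (X' x) (Y' x)) + M)%:E)%E.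
  apply: (@ge0_integral_eq_law2 (fun z => (f (h z.1 z.2) + M)%:E)).
    by apply/measurable_EFinP; exact: measurable_funD.
  by move=> z; rewrite lee_fin; have := fM (h z.1 z.2); rewrite ler_norml; lra.
have iF (U V : T -> R) : measurable_fun setT U -> measurable_fun setT V ->
    P.-integrable setT (EFin \o (fun x => f (h (U x) (V x)))).
  move=> mU mV; apply: (@bounded_integrable _ _ _ P _ M) => //.
  exact: (measurableT_comp mfh (measurable_fun_pair mU mV)).
have iM : P.-integrable setT (EFin \o (fun _ : T => M)) by exact: finite_measure_integrable_cst.
have := congr1 fine E; rewrite -/(Rintegral _ _ _) -/(Rintegral _ _ _).
rewrite (RintegralD measurableT (iF _ _ mX mY) iM) (RintegralD measurableT (iF _ _ mX' mY') iM).
exact: addIr.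
Qed.

End equality_in_law.

Section independent_increments.
Context d (T : measurableType d) (R : realType) (P : probability T R).

(** The inner integral is the convolution of [f] with the law of [U], evaluated at the outer
    variable: one step of the iterated operator. *)
Lemma indep_Rintegral_add (G1 G2 : set (set T)) (U V : T -> R) (f : R -> R) :
  G1 `<=` measurable -> G2 `<=` measurable -> setI_closed G1 -> setI_closed G2 -> G1 setT -> G2 setT ->
  indep_systems P G1 G2 ->
  measurable_fun setT (U : g_sigma_algebraType G1 -> R) ->
  measurable_fun setT (V : g_sigma_algebraType G2 -> R) ->
  bounded_measurable f -> \int[P]_x f (U x + V x) = \int[P]_y \int[P]_x f (V y + U x).
Proof.
move=> mG1 mG2 IG1 IG2 TG1 TG2 ind mU mV [mf [M fM]].
have mU' : measurable_fun [set: T] (U : T -> R) by exact: (measurableT_comp mU (measurable_id_sigma mG1)).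
have mV' : measurable_fun [set: T] (V : T -> R) by exact: (measurableT_comp mV (measurable_id_sigma mG2)).
pose F z : \bar R := (f (U z.1 + V z.2) + M)%:E.
have mF : measurable_fun setT (F : g_sigma_algebraType G1 * g_sigma_algebraType G2 -> \bar R).
  apply/measurable_EFinP; apply: measurable_funD => //; apply: (measurableT_comp mf).
  apply: measurable_funD; first by apply: (measurableT_comp mU); exact: measurable_fst.
  by apply: (measurableT_comp mV); exact: measurable_snd.
have F0 z : (0 <= F z)%E by rewrite lee_fin; have := fM (U z.1 + V z.2); rewrite ler_norml; lra.
have E := indep_integral mG1 mG2 IG1 IG2 TG1 TG2 ind mF F0.
have iM : P.-integrable setT (EFin \o (fun _ : T => M)) by exact: finite_measure_integrable_cst.
have iW (W : T -> R) : measurable_fun setT W -> P.-integrable setT (EFin \o (fun x => f (W x))).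
  by move=> mW; apply: (@bounded_integrable _ _ _ P _ M) => //; exact: measurableT_comp.
have W1 (W : T -> R) : measurable_fun setT W -> (\int[P]_x (f (W x) + M)%:E = (\int[P]_x f (W x) + M)%:E)%E.
  move=> mW; rewrite (RintegralE (integrableD measurableT (iW W mW) iM)).
  by rewrite (RintegralD measurableT (iW W mW) iM) probability_Rintegral_cst.
have mUV : measurable_fun setT (fun x : T => U x + V x) by exact: measurable_funD.
have mUy y : measurable_fun setT (fun x : T => U x + V y) by exact: measurable_funD.
have in1 y : (\int[P]_x F (x, y) = (\int[P]_x f (U x + V y) + M)%:E)%E by exact: (W1 _ (mUy y)).
have L : (\int[P]_x F (x, x) = (\int[P]_x f (U x + V x) + M)%:E)%E by exact: (W1 _ mUV).
move: E; rewrite L; under eq_integral do rewrite in1.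
have mI : measurable_fun setT (fun y : T => \int[P]_x f (U x + V y)).
  pose nu := law P mU'.
  have E y : translate_mean nu f (V y) = \int[P]_x f (U x + V y).
    rewrite /translate_mean (Rintegral_law mU' (measurable_translate (V y) mf)); last first.
      have := iW _ (mUy y); congr (_.-integrable _ (EFin \o _)).
      by apply/funext => x /=; rewrite addrC.
    by apply: eq_Rintegral => x _; rewrite addrC.
  rewrite -(funext E); apply: measurableT_comp mV'.
  by have [] := @bounded_measurable_translate_mean _ nu f (conj mf (ex_intro _ M fM)).
have IM y : `|\int[P]_x f (U x + V y)| <= M.
  exact: (probability_Rintegral_le P (measurableT_comp mf (mUy y)) (fun x => fM _)).
have iI := bounded_integrable P mI IM.
rewrite (RintegralE (integrableD measurableT iI iM)) (RintegralD measurableT iI iM) probability_Rintegral_cst.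
move=> [/addIr ->].
by apply: eq_Rintegral => y _; apply: eq_Rintegral => x _; rewrite addrC.
Qed.

End independent_increments.

Section iid_pairs.
Context d (T : measurableType d) (R : realType) (P : probability T R).
Variables (n : nat) (e m : 'I_n -> T -> R) (h : R -> R -> R) (nu : probability (measurableTypeR R) R).
Let X (k : 'I_n + 'I_n) : T -> R := match k with inl i => e i | inr i => m i end.
Hypotheses (me : forall i, measurable_fun setT (e i)) (mm : forall i, measurable_fun setT (m i)).
Hypothesis ind : mutually_indep P X.
Hypothesis mh : measurable_fun setT (fun z : R * R => h z.1 z.2).
Hypothesis lawU : forall i f, bounded_measurable f ->
  \int[P]_x f (h (e i x) (m i x)) = \int[nu]_y f y.

(** Splitting off the last summand replaces [f] by its convolution with [nu], so the induction
    quantifies over [f]. *)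
Lemma expectation_iid_sum k (f : R -> R) : (k <= n)%N -> bounded_measurable f ->
  \int[P]_x f (\sum_(i < n | (i < k)%N) h (e i x) (m i x)) = iter k (translate_mean nu) f 0.
Proof.
elim: k f => [|k IH] f kn bf.
  under eq_Rintegral do rewrite big_pred0//.
  by rewrite probability_Rintegral_cst.
have mX k' : measurable_fun setT (X k') by case: k'.
pose i0 := Ordinal kn.
have E (F : 'I_n -> R) : \sum_(i < n | (i < k.+1)%N) F i = F i0 + \sum_(i < n | (i < k)%N) F i.
  rewrite (bigD1 i0)//=; congr (_ + _); apply: eq_bigl => i.
  by rewrite ltnS ltn_neqAle andbC.
under eq_Rintegral do rewrite E.
pose idx (k' : 'I_n + 'I_n) : 'I_n := match k' with inl i => i | inr i => i end.
pose J1 : {set 'I_n + 'I_n} := [set k' | idx k' == i0]%SET.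
pose J2 : {set 'I_n + 'I_n} := [set k' | (idx k' < k)%N]%SET.
have dJ k' : k' \in J1 -> k' \notin J2.
  by rewrite !inE => /eqP ->; rewrite ltnn.
have mpair (J : {set 'I_n + 'I_n}) i : inl i \in J -> inr i \in J ->
    measurable_fun setT (fun x : g_sigma_algebraType (cylinders X J) => h (e i x) (m i x)).
  move=> iJ1 iJ2.
  exact: (measurableT_comp mh (measurable_fun_pair
    (measurable_cylinders (X := X) iJ1) (measurable_cylinders (X := X) iJ2))).
have mU : measurable_fun setT (fun x : g_sigma_algebraType (cylinders X J1) => h (e i0 x) (m i0 x)).
  by apply: mpair; rewrite inE.
have mV : measurable_fun setT (fun x : g_sigma_algebraType (cylinders X J2) =>
    \sum_(i < n | (i < k)%N) h (e i x) (m i x)).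
  by apply: measurable_bigsum => i ik; apply: mpair; rewrite inE.
rewrite (indep_Rintegral_add (cylinders_measurable mX (J := J1)) (cylinders_measurable mX (J := J2))
  (@cylinders_setI _ T R _ X J1) (@cylinders_setI _ T R _ X J2)
  (@cylinders_setT _ T R _ X J1) (@cylinders_setT _ T R _ X J2) (indep_cylinders ind dJ) mU mV bf).
rewrite iterSr -(IH _ (ltnW kn)); last exact: bounded_measurable_translate_mean.
apply: eq_Rintegral => y _; rewrite /translate_mean.
apply: (lawU i0 (f := fun w => f (_ + w))); case: bf => mf [M fM]; split; last by exists M.
exact: measurable_translate.
Qed.

End iid_pairs.

Section noise_moments.
Context d (T : measurableType d) (R : realType) (P : probability T R).
Variables (I : finType) (X : I -> T -> R) (a b : I).
Hypotheses (mX : forall i, measurable_fun setT (X i)) (ind : mutually_indep P X) (ab : a != b).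
Local Notation e := (X a).
Local Notation m := (X b).
Variables (s2 se k : R).
Hypotheses (ie2 : P.-integrable setT (EFin \o (fun x => e x ^+ 2)))
  (im2 : P.-integrable setT (EFin \o (fun x => m x ^+ 2)))
  (im4 : P.-integrable setT (EFin \o (fun x => (m x ^+ 2 - s2) ^+ 2))).
Hypotheses (Ee : \int[P]_x e x = 0) (Ee2 : \int[P]_x e x ^+ 2 = se)
  (Em2 : \int[P]_x m x ^+ 2 = s2) (Ek : \int[P]_x (m x ^+ 2 - s2) ^+ 2 = k).

Let integrable_sq (f : T -> R) : measurable_fun setT f ->
  P.-integrable setT (EFin \o (fun x => f x ^+ 2)) -> P.-integrable setT (EFin \o f).
Proof.
move=> mf if2.
have ione : P.-integrable setT (EFin \o (fun _ : T => (1 : R))).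
  exact: finite_measure_integrable_cst.
apply: (integrable_le (integrableD measurableT ione if2)) => // y /=.
by rewrite ler_norml; apply/andP; split; nra.
Qed.

Let indM (f g : R -> R) : measurable_fun setT f -> measurable_fun setT g ->
  P.-integrable setT (EFin \o (fun x => f (e x))) -> P.-integrable setT (EFin \o (fun x => g (m x))) ->
  P.-integrable setT (EFin \o (fun x => f (e x) * g (m x))) /\
  \int[P]_x (f (e x) * g (m x)) = \int[P]_x f (e x) * \int[P]_x g (m x).
Proof.
move=> mf mg ife igm.
have dJ i : i \in [set a]%SET -> i \notin [set b]%SET by rewrite !inE => /eqP ->.
have aJ : a \in [set a]%SET by rewrite inE.
have bJ : b \in [set b]%SET by rewrite inE.
exact: (indep_RintegralM (cylinders_measurable mX (J := [set a]%SET)) (cylinders_measurable mX (J := [set b]%SET))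
  (@cylinders_setI _ T R _ X _) (@cylinders_setI _ T R _ X _)
  (@cylinders_setT _ T R _ X _) (@cylinders_setT _ T R _ X _) (indep_cylinders ind dJ)
  (measurableT_comp mf (measurable_cylinders (X := X) aJ))
  (measurableT_comp mg (measurable_cylinders (X := X) bJ)) ife igm).
Qed.

(** With A = m^2 - s2 the variable is A + 2 e m. In its square the mixed term 4 e m A has mean zero,
    as e is centred and independent of m, whatever the third moment of m; A^2 gives k and 4 e^2 m^2
    gives 4 se s2. *)
Lemma linearized_square_moments : let Y x := m x ^+ 2 + 2 * m x * e x - s2 in
  [/\ P.-integrable setT (EFin \o (fun x => Y x ^+ 2)), \int[P]_x Y x = 0 &
   \int[P]_x Y x ^+ 2 = k + 4 * se * s2].
Proof.
move=> Y; have m2 : measurable_fun setT (fun x : R => x ^+ 2) by exact: exprn_measurable.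
have mid : measurable_fun setT (fun x : R => x) by exact: measurable_id.
have ie := integrable_sq (mX a) ie2; have im := integrable_sq (mX b) im2.
pose A x := m x ^+ 2 - s2.
have mA : measurable_fun setT A.
  by apply: measurable_funB => //; exact: measurable_funX.
have iA : P.-integrable setT (EFin \o A) by exact: integrable_sq.
(* The factor m A of the mixed term is integrable, being dominated by m^2 + A^2. *)
pose g (y : R) := y * (y ^+ 2 - s2).
have mg : measurable_fun setT g by apply: measurable_funM => //; apply: measurable_funB.
have igm : P.-integrable setT (EFin \o (fun x => g (m x))).
  apply: (integrable_le (integrableD measurableT im2 im4)) => [|x]; first exact: measurableT_comp.
  rewrite /= -/(A x) ler_norml /g -/(A x).
  by apply/andP; split; have := sqr_ge0 (m x + A x); have := sqr_ge0 (m x - A x);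
    have := sqr_ge0 (m x); have := sqr_ge0 (A x); nra.
have [i1 E1] := indM mid mid ie im.
have [i2 E2] := indM mid mg ie igm.
have [i3 E3] := indM m2 m2 ie2 im2.
have is2 : P.-integrable setT (EFin \o (fun _ : T => s2)) by exact: finite_measure_integrable_cst.
have EA : \int[P]_x A x = 0.
  by rewrite (RintegralB measurableT im2 is2) probability_Rintegral_cst Em2 subrr.
have i1' := integrable_scale 2 i1.
have i2' := integrable_scale 4 i2.
have i3' := integrable_scale 4 i3.
have YE : Y = fun x => A x + 2 * (e x * m x) by apply/funext => x; rewrite /Y /A; ring.
have Y2E : (fun x => Y x ^+ 2) =
    (fun x => A x ^+ 2 + 4 * (e x * g (m x)) + 4 * (e x ^+ 2 * m x ^+ 2)).
  by apply/funext => x; rewrite /Y /A /g; ring.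
have i12 := integrableD measurableT im4 i2'.
split.
- by rewrite Y2E; exact: (integrableD measurableT i12 i3').
- by rewrite YE (RintegralD measurableT iA i1') EA RintegralZl// E1 Ee mul0r mulr0 addr0.
- have -> : \int[P]_x Y x ^+ 2 = \int[P]_x (A x ^+ 2 + 4 * (e x * g (m x)) + 4 * (e x ^+ 2 * m x ^+ 2)).
    by rewrite -Y2E.
  rewrite (RintegralD measurableT i12 i3') (RintegralD measurableT im4 i2') !RintegralZl//.
  by rewrite E2 E3 Ee Ee2 Em2 Ek; ring.
Qed.

End noise_moments.

(** * Noise energy of all models *)

Lemma markov_lt d (T : measurableType d) (R : realType) (P : probability T R) (G : T -> R) (a : R) :
  measurable_fun setT G -> (forall x, 0 <= G x) -> 0 < a ->
  (a%:E * P [set x | (a < G x)%R] <= \int[P]_x (G x)%:E)%E.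
Proof.
move=> mG G0 a0.
have mA : measurable [set x | (a < G x)%R].
  have -> : [set x | (a < G x)%R] = setT `&` G @^-1` [set` `]a, +oo[].
    by apply/seteqP; split => x /=; rewrite in_itv /= andbT => // -[].
  exact: mG.
have mi : measurable_fun setT (fun x : T => (\1_[set x | (a < G x)%R] x)%:E : \bar R).
  by apply/measurable_EFinP; exact: measurable_indic.
have -> : (a%:E * P [set x | (a < G x)%R] = \int[P]_x (a%:E * (\1_[set x | (a < G x)%R] x)%:E))%E.
  rewrite (ge0_integralZl P measurableT mi).
  - by rewrite integral_indic// setIT.
  - by move=> x _; rewrite lee_fin.
  - by rewrite lee_fin ltW.
apply: ge0_le_integral => //.
- by move=> x _; rewrite mule_ge0// lee_fin ltW.
- by apply: emeasurable_funM.
- exact/measurable_EFinP.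
- move=> x _; rewrite lee_fin indicE; have [|_] := boolP (x \in _); rewrite ?mulr0//.
  by rewrite inE /= mulr1 => /ltW.
Qed.

Lemma measurable_section_integral d (T : measurableType d) (R : realType) (P : probability T R)
    (G1 G2 : set (set T)) (F : g_sigma_algebraType G1 * g_sigma_algebraType G2 -> \bar R) :
  G1 `<=` measurable -> G2 `<=` measurable -> measurable_fun setT F -> (forall z, 0 <= F z)%E ->
  measurable_fun [set: T] (fun y : T => \int[P]_x F (x, y))%E.
Proof.
move=> mG1 mG2 mF F0; have mid1 := measurable_id_sigma mG1.
pose P1 := distribution P (mfun_of mid1).
have mG := @measurable_fun_fubini_tonelli_G _ _ _ _ R P1 F mF F0.
apply: measurable_ext (measurableT_comp mG (measurable_id_sigma mG2)) => y /=.
have mFy := @measurable_fun_pair1 _ _ _ (g_sigma_algebraType G1) (g_sigma_algebraType G2) _ F y mF.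
exact: (@ge0_integral_distribution _ _ _ _ _ P (mfun_of mid1) _ mFy (fun x => F0 (x, y))).
Qed.

Section noise_energy.
Context d (T : measurableType d) (R : realType) (P : probability T R).
Variables (n p : nat) (Z : 'I_n -> 'I_p -> T -> R) (mu eps : 'I_n -> T -> R) (K : R).
Hypotheses (mZ : forall i j, measurable_fun setT (Z i j))
  (mmu : forall i, measurable_fun setT (mu i)) (meps : forall i, measurable_fun setT (eps i)).
Let X (k : ('I_n * 'I_p) + 'I_n) : T -> R :=
  match k with inl ij => Z ij.1 ij.2 | inr i => mu i end.
Hypotheses (indX : indep_families P eps X) (ind : mutually_indep P eps).
Hypothesis subG : forall i l,
  (\int[P]_x (expR (l * eps i x))%:E <= (expR (K ^+ 2 * l ^+ 2 / 2))%:E)%E.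

(* mu is adjoined to the columns so that the cross term <P_m^perp mu, eps> is controlled together
   with P_m eps. *)
Definition noise_energy (m : {set 'I_p}) (x y : T) : R :=
  \sum_(q <- gram_schmidt (evec mu y :: cols (\matrix_(i, j) Z i j y) m)) dot q (evec eps x) ^+ 2.

Let mX k : measurable_fun setT (X k). Proof. by case: k => [[]|]. Qed.

Lemma measurable_noise_energy m : measurable_fun setT (fun x => noise_energy m x x).
Proof.
apply: measurable_mseq_energy; last exact: mvec_evec.
apply: mseq_gram_schmidt; apply: (mseq_cons (v := fun x => evec mu x)); first exact: mvec_evec.
by apply: mseq_cols => i j; apply: measurable_ext (mZ i j) => x; rewrite mxE.
Qed.

(** By independence the two sample points of [noise_energy] may be drawn separately. With the second
    one frozen, the orthogonal system is deterministic and has #|m| + 1 vectors, zero ones counted,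
    so the bound on quadratic forms applies. *)
Lemma noise_energy_mgf (s c : R) (m : {set 'I_p}) :
  K ^+ 2 * s ^+ 2 <= 1 / 2 -> 0 <= c ->
  (\int[normal_prob 0 1]_t (expR (t ^+ 2 / 4))%:E <= (expR c)%:E)%E ->
  (\int[P]_x (expR (s ^+ 2 / 2 * noise_energy m x x))%:E <= (expR ((#|m|.+1)%:R * c))%:E)%E.
Proof.
move=> Ks c0 Cc.
pose G1 := cylinders eps [set: 'I_n]%SET.
pose G2 := cylinders X [set: ('I_n * 'I_p) + 'I_n]%SET.
have iG : indep_systems P G1 G2.
  by move=> _ _ [B1 [mB1 ->]] [B2 [mB2 ->]]; exact: indX.
pose F (z : g_sigma_algebraType G1 * g_sigma_algebraType G2) : \bar R :=
  (expR (s ^+ 2 / 2 * noise_energy m z.1 z.2))%:E.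
have m1 i : measurable_fun setT (eps i : g_sigma_algebraType G1 -> R).
  by apply: measurable_cylinders; rewrite inE.
have m2 k : measurable_fun setT (X k : g_sigma_algebraType G2 -> R).
  by apply: measurable_cylinders; rewrite inE.
have mv : mvec (fun z : g_sigma_algebraType G1 * g_sigma_algebraType G2 => evec eps z.1).
  move=> i; apply: measurable_ext (measurableT_comp (m1 i) (@measurable_fst _ _ _ _)) => z.
  by rewrite mxE.
have mv2 : mvec (fun z : g_sigma_algebraType G1 * g_sigma_algebraType G2 => evec mu z.2).
  move=> i; apply: measurable_ext (measurableT_comp (m2 (inr i)) (@measurable_snd _ _ _ _)) => z.
  by rewrite mxE.
have mc : mseq (fun z : g_sigma_algebraType G1 * g_sigma_algebraType G2 =>
    cols (\matrix_(i, j) Z i j z.2) m).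
  apply: mseq_cols => i j.
  apply: measurable_ext (measurableT_comp (m2 (inl (i, j))) (@measurable_snd _ _ _ _)) => z.
  by rewrite mxE.
have ms : mseq (fun z : g_sigma_algebraType G1 * g_sigma_algebraType G2 =>
    gram_schmidt (evec mu z.2 :: cols (\matrix_(i, j) Z i j z.2) m)).
  exact: mseq_gram_schmidt (mseq_cons mv2 mc).
have mF : measurable_fun setT F.
  apply/measurable_EFinP; apply: measurableT_comp => //; apply: measurable_funM => //.
  exact: (measurable_mseq_energy ms mv).
have F0 z : (0 <= F z)%E by rewrite lee_fin expR_ge0.
rewrite (indep_integral (cylinders_measurable meps (J := _)) (cylinders_measurable mX (J := _))
  (@cylinders_setI _ T R _ eps _) (@cylinders_setI _ T R _ X _)
  (@cylinders_setT _ T R _ eps _) (@cylinders_setT _ T R _ X _) iG mF F0).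
rewrite -(integral_probability_cst P).
apply: ge0_le_integral => //.
- by move=> y _; apply: integral_ge0.
- exact: measurable_section_integral (cylinders_measurable meps (J := _)) (cylinders_measurable mX (J := _)) mF F0.
move=> y _; rewrite /F /=.
have oq := orthosys_gram_schmidt (evec mu y :: cols (\matrix_(i, j) Z i j y) m).
have b0 q : q \in gram_schmidt (evec mu y :: cols (\matrix_(i, j) Z i j y) m) -> dot (0 : 'cV[R]_n) q = 0.
  by move=> _; rewrite dot0l.
have := subgaussian_quadratic meps ind subG Ks c0 Cc oq b0.
rewrite size_gram_schmidt /= size_map -cardE sqnE dot0l mulr0 mul0r addr0.
apply: le_trans; rewrite le_eqVlt; apply/orP; left; apply/eqP; apply: eq_integral => x _.
by rewrite dot0l addr0.
Qed.

End noise_energy.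

Section noise_energy_tail.
Context d (T : measurableType d) (R : realType) (P : probability T R).
Variables (n p : nat) (Z : 'I_n -> 'I_p -> T -> R) (mu eps : 'I_n -> T -> R) (K : R).
Hypotheses (mZ : forall i j, measurable_fun setT (Z i j))
  (mmu : forall i, measurable_fun setT (mu i)) (meps : forall i, measurable_fun setT (eps i)).
Hypotheses (indX : indep_families P eps (fun k : ('I_n * 'I_p) + 'I_n =>
    match k with inl ij => Z ij.1 ij.2 | inr i => mu i end)) (ind : mutually_indep P eps).
Hypothesis subG : forall i l,
  (\int[P]_x (expR (l * eps i x))%:E <= (expR (K ^+ 2 * l ^+ 2 / 2))%:E)%E.
Variables (s c : R) (u : nat).
Hypotheses (s0 : 0 < s) (Ks : K ^+ 2 * s ^+ 2 <= 1 / 2) (c0 : 0 <= c)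
  (Cc : (\int[normal_prob 0 1]_t (expR (t ^+ 2 / 4))%:E <= (expR c)%:E)%E).

Let G x : R := \sum_(m : {set 'I_p} | #|m| == u) expR (s ^+ 2 / 2 * noise_energy Z mu eps m x x).

(** A soft maximum over models: off this event each exponential, being at most the sum [G], is below
    the level. A single Markov inequality for [G] then contains the union bound. *)
Definition noisy (b : R) : set T := [set x | expR (s ^+ 2 / 2 * b) < G x].

Let mterm (m : {set 'I_p}) : measurable_fun setT (fun x => expR (s ^+ 2 / 2 * noise_energy Z mu eps m x x)).
Proof.
by apply: measurableT_comp => //; apply: measurable_funM => //; exact: measurable_noise_energy.
Qed.

Let mG : measurable_fun setT G.
Proof. by apply: measurable_bigsum => m _; exact: mterm. Qed.

Lemma measurable_noisy b : measurable (noisy b).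
Proof.
have -> : noisy b = setT `&` G @^-1` [set` `]expR (s ^+ 2 / 2 * b), +oo[].
  by apply/seteqP; split => x; rewrite /noisy /= in_itv /= andbT => // -[].
exact: mG.
Qed.

Lemma not_noisy_le b x (m : {set 'I_p}) : ~ noisy b x -> #|m| = u -> noise_energy Z mu eps m x x <= b.
Proof.
move=> nb mu'; move/negP : nb; rewrite -leNgt => Gb.
have s2 : 0 < s ^+ 2 / 2 by rewrite divr_gt0// exprn_gt0.
rewrite -(ler_pM2l s2) -ler_expR; apply: le_trans Gb.
rewrite /G (bigD1 m)/=; last by rewrite mu'.
by rewrite lerDl; apply: sumr_ge0 => k _; exact: expR_ge0.
Qed.

Lemma noisy_tail b : (u <= p)%N ->
  (P (noisy b) <= (expR (u%:R * ln p%:R + u.+1%:R * c - s ^+ 2 / 2 * b))%:E)%E.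
Proof.
move=> up; have G0 x : 0 <= G x by apply: sumr_ge0 => k _; exact: expR_ge0.
have := markov_lt P mG G0 (expR_gt0 (s ^+ 2 / 2 * b)).
have -> : (\int[P]_x (G x)%:E = \sum_(m : {set 'I_p} | #|m| == u)
    \int[P]_x (expR (s ^+ 2 / 2 * noise_energy Z mu eps m x x))%:E)%E.
  rewrite -[RHS]big_filter -ge0_integral_sum//.
  - by apply: eq_integral => x _; rewrite big_filter sumEFin.
  - by move=> m; apply/measurable_EFinP; exact: mterm.
have sumle : (\sum_(m : {set 'I_p} | #|m| == u)
    \int[P]_x (expR (s ^+ 2 / 2 * noise_energy Z mu eps m x x))%:E <=
    (expR (u%:R * ln p%:R + u.+1%:R * c))%:E)%E.
  apply: (@le_trans _ _ (\sum_(m : {set 'I_p} | #|m| == u) (expR (u.+1%:R * c))%:E)%E).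
    apply: lee_sum => m /eqP <-.
    exact: (noise_energy_mgf mZ mmu meps indX ind subG m Ks c0 Cc).
  rewrite sumEFin lee_fin sumr_const expRD -[leLHS]mulr_natl ler_wpM2r ?expR_ge0//.
  rewrite -cardsE card_draws card_ord.
  apply: (@le_trans _ _ (p ^ u)%:R); first by rewrite ler_nat bin_le_exp.
  (* For [p = 0] also [u = 0], and both sides are 1. *)
  have [p0|p0] := posnP p.
    have -> : u = 0%N by apply/eqP; rewrite -leqn0 -p0.
    by rewrite expn0 mul0r expR0.
  by rewrite natrX mulrC expRM_natr lnK// posrE ltr0n.
move=> /le_trans /(_ sumle) h.
have {h} : ((expR (s ^+ 2 / 2 * b))%:E * P (noisy b) <=
    (expR (u%:R * ln p%:R + u.+1%:R * c))%:E)%E by exact: h.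
rewrite (expRD _ (- _)) expRN.
have e0 := expR_gt0 (s ^+ 2 / 2 * b).
have -> : P (noisy b) = (fine (P (noisy b)))%:E.
  by rewrite fineK// fin_num_measure//; exact: measurable_noisy.
by rewrite -EFinM !lee_fin ler_pdivlMr// mulrC.
Qed.

End noise_energy_tail.

(** * Rates for the exceptional events *)

Lemma cvg_measure0P d (T : measurableType d) (R : realType) (P : probability T R) (A : nat -> set T) :
  (forall n, measurable (A n)) ->
  (forall e : R, 0 < e -> \forall n \near \oo, (P (A n) <= e%:E)%E) <-> P (A n) @[n --> \oo] --> 0%E.
Proof.
move=> mA; split=> [h|/fine_cvg /cvgrPdist_le h e e0].
  have -> : (fun n => P (A n)) = EFin \o (fun n => fine (P (A n))).
    by apply/funext => n /=; rewrite fineK// fin_num_measure.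
  apply/cvg_EFin; first exact: nearW.
  apply/cvgrPdist_le => /= e /h; apply: filterS => n Pn.
  rewrite sub0r normrN ger0_norm ?fine_ge0//.
  by rewrite -lee_fin fineK// fin_num_measure.
have := h e e0; apply: filterS => n /=.
rewrite sub0r normrN ger0_norm ?fine_ge0//.
by rewrite -lee_fin fineK// fin_num_measure.
Qed.

(** The rate condition controls u ln p, whereas the exponent also contains u. For p >= 2 one has u
    <= u ln p / ln 2; for p <= 1 one has u <= 1, which the additive 2 c absorbs. *)
Lemma sparse_exponent_le (R : realType) (u p : nat) (c : R) : 0 <= c -> (u <= p)%N ->
  u%:R * ln p%:R + u.+1%:R * c <= (1 + c / ln 2) * (u%:R * ln p%:R) + 2 * c.
Proof.
move=> c0 up; have l2 : 0 < ln 2 :> R by rewrite ln_gt0// ltr1n.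
suff : u%:R <= 1 + u%:R * ln p%:R / ln 2 :> R.
  move=> /(ler_wpM2r c0); rewrite -natr1.
  have -> : (1 + c / ln 2) * (u%:R * ln p%:R) = u%:R * ln p%:R + u%:R * ln p%:R / ln 2 * c.
    by field; rewrite gt_eqF.
  lra.
have [p2|p1] := leqP 2 p.
  rewrite ler_wpDl// ler_pdivlMr// ler_wpM2l// ler_ln ?posrE// ?ltr0n ?ler_nat//.
  exact: leq_trans p2.
have L0 : 0 <= u%:R * ln p%:R / ln 2 :> R.
  rewrite divr_ge0 ?(ltW l2)// mulr_ge0//; case: p up p1 => [|p _ _]; first by rewrite ln0.
  by rewrite ln_ge0// ler1n.
by rewrite ler_wpDr// lern1; exact: leq_trans up _.
Qed.

Lemma sparse_tail_cvg0 (R : realType) (u p : nat -> nat) (c k : R) : 0 <= c -> 0 < k ->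
  (\forall n \near \oo, (u n <= p n)%N) ->
  (u n)%:R * ln (p n)%:R / Num.sqrt n%:R @[n --> \oo] --> (0 : R) ->
  forall e : R, 0 < e -> \forall n \near \oo,
    expR ((u n)%:R * ln (p n)%:R + (u n).+1%:R * c - k * Num.sqrt n%:R) <= e.
Proof.
move=> c0 k0 up rate e e0; have l2 : 0 < ln 2 :> R by rewrite ln_gt0// ltr1n.
have C0 : 0 < 1 + c / ln 2 by rewrite ltr_wpDr// divr_ge0// ltW.
(* Half of k sqrt n absorbs the multiple of u ln p; the other half outgrows the constant 2 c - ln
   e. *)
have kC : 0 < k / 2 / (1 + c / ln 2) by rewrite !divr_gt0.
move/cvgrPdist_le : rate => /(_ _ kC) rate.
near=> n.
have n0 : (0 < n)%N by near: n; exact: nbhs_infty_gt.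
have sn0 : 0 < Num.sqrt n%:R :> R by rewrite sqrtr_gt0 ltr0n.
have upn : (u n <= p n)%N by near: n.
have : `|0 - (u n)%:R * ln (p n)%:R / Num.sqrt n%:R| <= k / 2 / (1 + c / ln 2) by near: n.
rewrite sub0r normrN ler_norml => /andP[_]; rewrite ler_pdivrMr// => h.
have {}h : (1 + c / ln 2) * ((u n)%:R * ln (p n)%:R) <= k / 2 * Num.sqrt n%:R.
  rewrite mulrC -ler_pdivlMr//; apply: (le_trans h).
  by rewrite mulrAC.
have h2 := sparse_exponent_le c0 upn.
have big : (2 * c - ln e) / (k / 2) <= Num.sqrt n%:R.
  apply: (le_trans (ler_norm _)).
  rewrite -(@ler_pXn2r _ 2)// ?nnegrE ?sqrtr_ge0// sqr_sqrtr//.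
  by near: n; exact: nbhs_infty_ger.
rewrite -[leRHS](lnK (x := e)) ?posrE// ler_expR.
move: big; rewrite ler_pdivrMr; last by rewrite divr_gt0.
lra.
Unshelve. all: by end_near. Qed.

(** * The linearized statistic *)

Lemma variance_integral d (T : measurableType d) (R : realType) (P : probability T R)
    (X : T -> R) (m v : R) : ('E_P[X] = m%:E)%E -> ('V_P[X] = v%:E)%E ->
  (\int[P]_x ((X x - m) ^+ 2)%:E = v%:E)%E.
Proof.
move=> EX <-; rewrite /variance covariance.unlock EX /= expectation.unlock.
by apply: eq_integral => x _ /=; rewrite expr2.
Qed.

(** A variance that is a real number makes the corresponding square integrable; this is how the
    variances of mu_i, mu_i^2 and eps_i supply the integrability behind the moment computation. *)
Lemma integrable_eq d (T : measurableType d) (R : realType) (P : probability T R) (f : T -> R) (r : R) :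
  measurable_fun setT f -> (forall x, 0 <= f x) -> (\int[P]_x (f x)%:E = r%:E)%E ->
  P.-integrable setT (EFin \o f) /\ \int[P]_x f x = r.
Proof.
move=> mf f0 fr; have i : P.-integrable setT (EFin \o f).
  by apply: ge0_integrable => //; rewrite fr ltry.
by split => //; rewrite /Rintegral fr.
Qed.

Lemma mutually_indep_pair d (T : measurableType d) (R : realType) (P : probability T R)
    (I : finType) (X : I -> T -> R) (a b : I) : mutually_indep P X -> a != b ->
  forall A B, measurable A -> measurable B ->
  P (X a @^-1` A `&` X b @^-1` B) = (P (X a @^-1` A) * P (X b @^-1` B))%E.
Proof.
move=> ind ab A B mA mB.
have E i (C : set R) : X i @^-1` C = \bigcap_(j in [set` [set i]%SET]) (X j @^-1` C).
  apply/seteqP; split => x /=; first by move=> h j; rewrite /= inE => /eqP ->.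
  by apply; rewrite /= inE.
rewrite (E a) (E b); apply: (indep_cylinders (J1 := [set a]%SET) (J2 := [set b]%SET) ind).
- by move=> i; rewrite !inE => /eqP ->.
- by exists (fun _ => A).
- by exists (fun _ => B).
Qed.

Section linearized_clt.
Context d (T : measurableType d) (R : realType) (P : probability T R).
Variables (mu eps : forall n : nat, 'I_n -> {RV P >-> R}) (s2 k se : R).
Hypotheses (Hs2 : forall n (i : 'I_n), ('V_P[mu i] = s2%:E)%E)
  (Hk : forall n (i : 'I_n), ('V_P[fun x => (mu i x ^+ 2)%R] = k%:E)%E)
  (Hse : forall n (i : 'I_n), ('V_P[eps i] = se%:E)%E)
  (mu_id : forall n (i : 'I_n) m (j : 'I_m) (A : set R), measurable A ->
     P (mu i @^-1` A) = P (mu j @^-1` A))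
  (eps_id : forall n (i : 'I_n) m (j : 'I_m) (A : set R), measurable A ->
     P (eps i @^-1` A) = P (eps j @^-1` A))
  (mu_mean : forall n (i : 'I_n), ('E_P[mu i] = 0)%E)
  (eps_mean : forall n (i : 'I_n), ('E_P[eps i] = 0)%E)
  (ind : forall n, mutually_indep P (fun i : 'I_n + 'I_n =>
     match i with inl i => eps i : T -> R | inr i => mu i : T -> R end)).

Definition linearized n x : R :=
  Num.sqrt n%:R * ((sqn (evec (@mu n) x) + 2 * dot (evec (@mu n) x) (evec (@eps n) x)) / n%:R - s2).

(** The laws are common to all n, so the only pair available at sample size 1 serves as reference
    for every summand. *)
Let Y x : R := mu (ord0 : 'I_1) x ^+ 2 + 2 * mu (ord0 : 'I_1) x * eps (ord0 : 'I_1) x - s2.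

Let mY : measurable_fun setT Y.
Proof.
apply: measurable_funB => //; apply: measurable_funD; first exact: measurable_funX.
by apply: measurable_funM => //; apply: measurable_funM.
Qed.

Let Y_moments : [/\ P.-integrable setT (EFin \o (fun x => Y x ^+ 2)), \int[P]_x Y x = 0 &
   \int[P]_x Y x ^+ 2 = k + 4 * se * s2].
Proof.
pose X (i : 'I_1 + 'I_1) : T -> R := match i with inl i => eps i | inr i => mu i end.
have mX i : measurable_fun setT (X i) by case: i => i; exact: measurable_funPT.
have E2 (Z : T -> R) (v : R) : measurable_fun setT Z -> ('E_P[Z] = 0)%E -> ('V_P[Z] = v%:E)%E ->
    (\int[P]_x (Z x ^+ 2)%:E = v%:E)%E.
  by move=> mZ EZ VZ; rewrite -(variance_integral EZ VZ); apply: eq_integral => x _; rewrite subr0.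
have e2 := E2 _ _ (mX (inl ord0)) (eps_mean _) (Hse _).
have m2 := E2 _ _ (mX (inr ord0)) (mu_mean _) (Hs2 _).
have Em2 : ('E_P[fun x => (mu (ord0 : 'I_1) x ^+ 2)%R] = s2%:E)%E by rewrite expectation.unlock.
have m4 := variance_integral Em2 (Hk _).
have mX2 i : measurable_fun setT (fun x => X i x ^+ 2) by exact: measurable_funX.
have mX4 : measurable_fun setT (fun x => (X (inr ord0) x ^+ 2 - s2) ^+ 2).
  by apply: measurable_funX; apply: measurable_funB.
have [ie2 Ee2] := integrable_eq (mX2 (inl ord0)) (fun x => sqr_ge0 _) e2.
have [im2 Em2'] := integrable_eq (mX2 (inr ord0)) (fun x => sqr_ge0 _) m2.
have [im4 Em4] := integrable_eq mX4 (fun x => sqr_ge0 _) m4.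
have Ee : \int[P]_x X (inl ord0) x = 0.
  by have := eps_mean (ord0 : 'I_1); rewrite expectation.unlock /Rintegral /= => ->.
exact: (linearized_square_moments mX (@ind 1) (a := inl ord0) (b := inr ord0) _ ie2 im2 im4 Ee Ee2 Em2' Em4).
Qed.

Lemma linearized_clt (f : R -> R) (K M : R) :
  (forall x y, `|f x - f y| <= K * `|x - y|) -> (forall x, `|f x| <= M) ->
  \int[P]_x f (linearized n x) @[n --> \oo] --> normal0_mean (k + 4 * se * s2) f.
Proof.
move=> fK fM; have [iY2 EY EY2] := Y_moments.
have := normalized_law_iter_cvg mY iY2 EY EY2 fK fM.
have mf : measurable_fun setT f by apply: continuous_measurable_fun; exact: lipschitz_measurable fK.
(* Both sequences are shifted by one so that the sample size is positive and division by sqrt n is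
   legitimate. *)
rewrite -(cvg_shiftS _) /=; move=> h; rewrite -(cvg_shiftS _) /=.
apply: cvg_trans h; apply: near_eq_cvg; apply: nearW => n' /=.
set n := n'.+1.
pose h (e m : R) : R := (m ^+ 2 + 2 * m * e - s2) / Num.sqrt n%:R.
have mh : measurable_fun setT (fun z : R * R => h z.1 z.2).
  have m1 : measurable_fun [set: R * R] (fun z : R * R => z.1) by exact: measurable_fst.
  have m2 : measurable_fun [set: R * R] (fun z : R * R => z.2) by exact: measurable_snd.
  apply: measurable_funM => //; apply: measurable_funB => //; apply: measurable_funD.
    exact: measurable_funX.
  by apply: measurable_funM => //; apply: measurable_funM.
have me i : measurable_fun setT (@eps n i : T -> R) by exact: measurable_funPT.
have mm i : measurable_fun setT (@mu n i : T -> R) by exact: measurable_funPT.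
have lawU i g : bounded_measurable g ->
    \int[P]_x g (h (@eps n i x) (@mu n i x)) = \int[normalized_law P mY n]_y g y.
  move=> bg; have [mg [N gN]] := bg.
  rewrite (Rintegral_law (measurable_normalized mY n) mg); last first.
    apply: (@bounded_integrable _ _ _ P _ N); last by move=> x; exact: gN.
    exact: (measurableT_comp mg (measurable_normalized mY n)).
  have i0 := @mutually_indep_pair _ _ _ P _ _ (inl ord0) (inr ord0) (@ind 1) isT.
  have i1 := @mutually_indep_pair _ _ _ P _ _ (inl i) (inr i) (@ind n) isT.
  have E := Rintegral_eq_law2 (me i) (mm i) (measurable_funPT (eps ord0)) (measurable_funPT (mu ord0))
    (eps_id i ord0) (mu_id i ord0) i1 i0 mh bg.
  exact: E.
have bf : bounded_measurable f by split => //; exists M.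
have := expectation_iid_sum me mm (@ind n) mh lawU (leqnn n) bf.
rewrite /= => <-; apply: eq_Rintegral => x _; congr f.
have n0 : (n%:R : R) != 0 by rewrite pnatr_eq0.
have sn0 : (Num.sqrt n%:R : R) != 0 by rewrite gt_eqF// sqrtr_gt0 ltr0n.
rewrite (eq_bigl xpredT) => [|i]; last by rewrite ltn_ord.
rewrite /h -mulr_suml sumrB big_split /= sumr_const card_ord /linearized.
have -> : \sum_(i < n) 2 * @mu n i x * @eps n i x = 2 * dot (evec (@mu n) x) (evec (@eps n) x).
  by rewrite /dot mulr_sumr; apply: eq_bigr => i _; rewrite !mxE mulrA.
have -> : \sum_(i < n) @mu n i x ^+ 2 = sqn (evec (@mu n) x).
  by apply: eq_bigr => i _; rewrite mxE.
have E : Num.sqrt n%:R ^+ 2 = n%:R :> R by rewrite sqr_sqrtr.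
rewrite -[s2 *+ n]mulr_natr; move: sn0 E; move: (Num.sqrt n%:R) => r r0 <-.
by field.
Qed.

End linearized_clt.

(** * Transfer of the limit to the estimators *)

Section estimators_clt.
Context d (T : measurableType d) (R : realType) (P : probability T R).
Variables (p u : nat -> nat) (Z : forall n : nat, 'I_n -> 'I_(p n) -> {RV P >-> R})
  (mu eps : forall n : nat, 'I_n -> {RV P >-> R}) (s2 v K alpha : R) (S : forall n, {set 'I_(p n)}).
Hypotheses (alpha0 : 0 < alpha)
  (indX : forall n, indep_families P (@eps n)
     (fun k : ('I_n * 'I_(p n)) + 'I_n =>
        match k with inl ij => Z ij.1 ij.2 : T -> R | inr i => mu i : T -> R end))
  (ind : forall n, mutually_indep P (@eps n))
  (subG : forall n (i : 'I_n) (l : R),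
     (\int[P]_x (expR (l * eps i x))%:E <= (expR (K ^+ 2 * l ^+ 2 / 2))%:E)%E)
  (clt : forall (f : R -> R) (L M : R), (forall x y, `|f x - f y| <= L * `|x - y|) ->
     (forall x, `|f x| <= M) ->
     \int[P]_x f (linearized mu eps s2 n x) @[n --> \oo] --> normal0_mean v f)
  (Su : \forall n \near \oo, (#|S n| <= u n)%N)
  (up : \forall n \near \oo, (u n <= p n)%N)
  (sparse : forall e : R, 0 < e ->
     P [set x | e * Num.sqrt n%:R <
        sqn (projperp_cols (\matrix_(i < n, j < p n) Z i j x) (S n) (\col_i @mu n i x))] @[n --> \oo] --> 0%E)
  (rate : (u n)%:R * ln (p n)%:R / Num.sqrt n%:R @[n --> \oo] --> (0 : R)).

Let Zmat n x : 'M[R]_(n, p n) := \matrix_(i < n, j < p n) Z i j x.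

Let sparse_defect n x : R := sqn (projperp_cols (Zmat n x) (S n) (\col_i @mu n i x)).

Let mmu n (i : 'I_n) : measurable_fun setT (mu i). Proof. exact: measurable_funPT. Qed.
Let meps n (i : 'I_n) : measurable_fun setT (eps i). Proof. exact: measurable_funPT. Qed.
Let mZ n (i : 'I_n) (j : 'I_(p n)) : measurable_fun setT (Z i j). Proof. exact: measurable_funPT. Qed.

Let mdefect n : measurable_fun setT (sparse_defect n).
Proof.
apply: measurable_sqn; apply: mvec_projperp_cols; last exact: (mvec_evec (@mmu n)).
by move=> i j; apply: measurable_ext (mZ i j) => x; rewrite mxE.
Qed.

Let mlinearized n : measurable_fun setT (linearized mu eps s2 n).
Proof.
have m1 := mvec_evec (@mmu n); have m2 := mvec_evec (@meps n).
apply: measurable_funM => //; apply: measurable_funB => //; apply: measurable_funM => //.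
apply: measurable_funD; first exact: measurable_sqn.
by apply: measurable_funM => //; exact: measurable_dot.
Qed.

(** Only measurability and the pathwise bound are asked of [est], so the same argument serves all
    three estimators. *)
Lemma cvg_dist_estimator (est : forall n, T -> R) : (forall n, measurable_fun setT (est n)) ->
  (forall n x b, (#|S n| <= u n)%N -> (u n <= p n)%N -> sparse_defect n x <= b ->
    (forall m : {set 'I_(p n)}, #|m| = u n ->
       \sum_(q <- gram_schmidt (evec (@mu n) x :: cols (Zmat n x) m)) dot q (evec (@eps n) x) ^+ 2 <= b) ->
    `|est n x - (sqn (evec (@mu n) x) + 2 * dot (evec (@mu n) x) (evec (@eps n) x)) / n%:R| <=
      (16 * b + 3 * (alpha * ((u n)%:R * ln (p n)%:R))) / n%:R) ->
  cvg_dist_normal0 P (fun n x => Num.sqrt n%:R * (est n x - s2)) v.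
Proof.
move=> mest close.
have mX n : measurable_fun setT (fun x => Num.sqrt n%:R * (est n x - s2)).
  by apply: measurable_funM => //; apply: measurable_funB.
apply: cvg_lipschitz_continuous => // f L M fL fM.
(* Gives |K| s <= 1 / 2, hence K^2 s^2 <= 1 / 4; the [+ 1] keeps [s] defined when K = 0. *)
pose s : R := (2 * (`|K| + 1))^-1.
have K1 : 0 < `|K| + 1 by rewrite ltr_wpDl.
have s0 : 0 < s by rewrite invr_gt0 mulr_gt0.
have Ks : K ^+ 2 * s ^+ 2 <= 1 / 2.
  rewrite -exprMn -real_normK ?num_real// normrM (gtr0_norm s0) /s.
  have h : `|K| / (2 * (`|K| + 1)) <= 1 / 2.
    by rewrite ler_pdivrMr ?mulr_gt0//; have := normr_ge0 K; lra.
  have h0 : 0 <= `|K| / (2 * (`|K| + 1)) by rewrite divr_ge0// mulr_ge0// ltW.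
  nra.
have [c c0 Cc] := @normal_exp_sqr_finite R.
pose N n b := noisy (fun i j => Z i j : T -> R) (fun i => @mu n i : T -> R)
  (fun i => @eps n i : T -> R) s (u n) b.
pose D n b : set T := [set x | b < sparse_defect n x].
(* The level b = (e / 32) sqrt n makes 16 b equal to half of the allowed error e sqrt n, on both the
   noise and the sparsity side. *)
pose bad (e : R) n := N n (e / 32 * Num.sqrt n%:R) `|` D n (e / 32 * Num.sqrt n%:R).
have mN n b : measurable (N n b) by exact: (measurable_noisy (@mZ n) (@mmu n) (@meps n)).
have mD n b : measurable (D n b).
  have -> : D n b = setT `&` sparse_defect n @^-1` [set` `]b, +oo[].
    by apply/seteqP; split => x; rewrite /D /= in_itv /= andbT => // -[].
  exact: mdefect.
have mbad e n : measurable (bad e n) by exact: measurableU.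
apply: (@cvg_slutsky_lipschitz _ _ _ P _ (linearized mu eps s2) bad f L M) => //.
- move=> e e0; have e32 : 0 < e / 32 by rewrite divr_gt0.
  apply/(cvg_measure0P P (mbad e)) => r r0.
  have r2 : 0 < r / 2 by rewrite divr_gt0.
  have k0 : 0 < s ^+ 2 / 2 * (e / 32) by rewrite mulr_gt0// divr_gt0// exprn_gt0.
  have hN := sparse_tail_cvg0 c0 k0 up rate r2.
  pose b n : R := e / 32 * Num.sqrt n%:R.
  have hD : \forall n \near \oo, (P (D n (b n)) <= (r / 2)%:E)%E.
    by apply: (cvg_measure0P P (fun n => mD n (b n))).2 r2; exact: sparse.
  near=> n.
  have upn : (u n <= p n)%N by near: n.
  apply: (@le_trans _ _ (P (N n (b n)) + P (D n (b n)))%E); first exact: measureU2.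
  have hDn : (P (D n (b n)) <= (r / 2)%:E)%E by near: n.
  have hNn : expR ((u n)%:R * ln (p n)%:R + (u n).+1%:R * c - s ^+ 2 / 2 * (e / 32) * Num.sqrt n%:R) <= r / 2.
    by near: n.
  rewrite [r]splitr EFinD; apply: (leeD _ hDn).
  apply: (le_trans (noisy_tail (@mZ n) (@mmu n) (@meps n) (@indX n) (@ind n) (@subG n) Ks c0 Cc _ upn)).
  by rewrite lee_fin /b mulrA.
- move=> e e0.
  (* This threshold on u ln p / sqrt n bounds the entropy term 3 alpha u ln p by the other half, (e
     / 2) sqrt n. *)
  have r0 : 0 < e / (6 * alpha) by rewrite divr_gt0// mulr_gt0.
  move/cvgrPdist_le : rate => /(_ _ r0) hr.
  near=> n => x nbad.
  have n0 : (0 < n)%N by near: n; exact: nbhs_infty_gt.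
  have nr0 : 0 < n%:R :> R by rewrite ltr0n.
  have sn0 : 0 < Num.sqrt n%:R :> R by rewrite sqrtr_gt0.
  have upn : (u n <= p n)%N by near: n.
  have Sun : (#|S n| <= u n)%N by near: n.
  have hD : sparse_defect n x <= e / 32 * Num.sqrt n%:R.
    by rewrite leNgt; apply/negP => h; apply: nbad; right.
  have hN : ~ N n (e / 32 * Num.sqrt n%:R) x by move=> h; apply: nbad; left.
  have := close n x _ Sun upn hD (fun m mu' => not_noisy_le s0 hN mu').
  have : `|0 - (u n)%:R * ln (p n)%:R / Num.sqrt n%:R| <= e / (6 * alpha) by near: n.
  rewrite sub0r normrN ler_norml => /andP[_]; rewrite ler_pdivrMr// => hL.
  have {}hL : 3 * (alpha * ((u n)%:R * ln (p n)%:R)) <= e / 2 * Num.sqrt n%:R.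
    have -> : e / 2 * Num.sqrt n%:R = 3 * (alpha * (e / (6 * alpha) * Num.sqrt n%:R)).
      by field; rewrite gt_eqF.
    by rewrite ler_pM2l// ler_pM2l.
  move=> h; rewrite /linearized -mulrBr opprB addrA subrK normrM (gtr0_norm sn0).
  apply: (le_trans (ler_wpM2l (ltW sn0) h)).
  rewrite [leLHS]mulrA ler_pdivrMr//.
  have E : e * Num.sqrt n%:R ^+ 2 = e * n%:R by rewrite sqr_sqrtr.
  rewrite -E; have := ler_wpM2l (ltW sn0) hL; nra.
- exact: clt fL fM.
Unshelve. all: by end_near. Qed.

End estimators_clt.

Theorem mainTheorem14
  (R : realType) (d : measure_display) (T : measurableType d)
  (P : probability T R)
  (p s_gamma u_gamma : nat -> nat)
  (Z : forall n : nat, 'I_n -> 'I_(p n) -> {RV P >-> R})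
  (mu eps : forall n : nat, 'I_n -> {RV P >-> R})
  (sigma2_mu kappa_mu sigma2_eps K_eps alpha_Y : R)
  (* variances *)
  (Hs2mu : forall n (i : 'I_n), ('V_P[mu n i] = sigma2_mu%:E)%E)
  (Hkmu : forall n (i : 'I_n), ('V_P[fun x => (mu n i x ^+ 2)%R] = kappa_mu%:E)%E)
  (Hs2eps : forall n (i : 'I_n), ('V_P[eps n i] = sigma2_eps%:E)%E)
  (Hs2mu_pos : 0 < sigma2_mu)
  (* (C1) entries of mu i.i.d. (common law for all n), mean zero,
     finite fourth moment *)
  (HC1_id : forall n (i : 'I_n) m (j : 'I_m) (A : set R), measurable A ->
     P (mu n i @^-1` A) = P (mu m j @^-1` A))
  (HC1_indep : forall n, mutually_indep P (mu n))
  (HC1_mean : forall n (i : 'I_n), ('E_P[mu n i] = 0)%E)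
  (HC1_m4 : forall n (i : 'I_n),
     (\int[P]_x (`|mu n i x| ^+ 4)%:E < +oo)%E)
  (* (C2) eps independent of (Z, mu), i.i.d. sub-Gaussian entries *)
  (HC2_indep_Zmu : forall n,
     indep_families P (eps n)
       (fun k : ('I_n * 'I_(p n)) + 'I_n =>
          match k with inl ij => (Z n ij.1 ij.2 : T -> R)
                     | inr i => (mu n i : T -> R) end))
  (HC2_id : forall n (i : 'I_n) m (j : 'I_m) (A : set R), measurable A ->
     P (eps n i @^-1` A) = P (eps m j @^-1` A))
  (HC2_indep : forall n, mutually_indep P (eps n))
  (HC2_mean : forall n (i : 'I_n), ('E_P[eps n i] = 0)%E)
  (HC2_subG : forall n (i : 'I_n) (lam : R),
     (\int[P]_x (expR (lam * eps n i x))%:E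
        <= (expR (K_eps ^+ 2 * lam ^+ 2 / 2))%:E)%E)
  (* (C3) weak sparsity of mu relative to Z at rate sqrt n *)
  (HC3_sparse : exists S : forall n, {set 'I_(p n)},
     (\forall n \near \oo, #|S n| = s_gamma n) /\
     (forall e : R, 0 < e ->
        P [set x | e * Num.sqrt n%:R <
                   sqn (projperp_cols (\matrix_(i, j) Z n i j x) (S n)
                                      (\col_i mu n i x))]
        @[n --> \oo] --> 0%E))
  (HC3_us : \forall n \near \oo, (s_gamma n <= u_gamma n)%N)
  (HC3_up : \forall n \near \oo, (u_gamma n <= p n)%N)
  (HC3_rate : ((u_gamma n)%:R : R) * ln ((p n)%:R : R) / Num.sqrt n%:R @[n --> \oo] --> 0)
  (* tuning constant *)
  (Halpha : 4 * K_eps ^+ 2 < alpha_Y) :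
  let Ymat n x := \col_(i < n) (mu n i x + eps n i x) in
  let Zmat n x := \matrix_(i < n, j < p n) Z n i j x in
  let v := kappa_mu + 4 * sigma2_eps * sigma2_mu in
  [/\ cvg_dist_normal0 P (fun n x => Num.sqrt n%:R *
        (sig2_I alpha_Y (u_gamma n) (Zmat n x) (Ymat n x) - sigma2_mu)) v,
      cvg_dist_normal0 P (fun n x => Num.sqrt n%:R *
        (sig2_II alpha_Y (u_gamma n) (Zmat n x) (Ymat n x) - sigma2_mu)) v &
      cvg_dist_normal0 P (fun n x => Num.sqrt n%:R *
        (sig2_III alpha_Y (u_gamma n) (Zmat n x) (Ymat n x) - sigma2_mu)) v].
Proof.
move=> Ymat Zmat v.
have alpha0 : 0 < alpha_Y by apply: le_lt_trans Halpha; rewrite mulr_ge0// sqr_ge0.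
have [S [Ss sparse]] := HC3_sparse.
have Su : \forall n \near \oo, (#|S n| <= u_gamma n)%N.
  by apply: filterS2 Ss HC3_us => n ->.
have ind n : mutually_indep P (fun i : 'I_n + 'I_n =>
    match i with inl i => eps n i : T -> R | inr i => mu n i : T -> R end).
  have h := indep_families_inr (HC2_indep_Zmu n).
  exact: (mutually_indep_sum (HC2_indep n) (HC1_indep n) h).
have clt := linearized_clt Hs2mu Hkmu Hs2eps HC1_id HC2_id HC1_mean HC2_mean ind.
have mu_eps n x : Ymat n x = evec (mu n) x + evec (eps n) x.
  by apply/matrixP => i j; rewrite !mxE.
have mY n : mvec (Ymat n).
  move=> i; apply: measurable_ext (measurable_funD (measurable_funPT (mu n i)) (measurable_funPT (eps n i))).
  by move=> x; rewrite mxE.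
have mZ n i j : measurable_fun setT (fun x => Zmat n x i j).
  by apply: measurable_ext (measurable_funPT (Z n i j)) => x; rewrite mxE.
have key := cvg_dist_estimator alpha0 HC2_indep_Zmu HC2_indep HC2_subG clt Su HC3_up sparse HC3_rate.
split; apply: key => [n|n x b Sun upn hb noise].
- exact: measurable_sig2_I.
- by rewrite mu_eps; have [] := estimators_deterministic alpha0 Sun upn hb noise.
- exact: measurable_sig2_II.
- by rewrite mu_eps; have [] := estimators_deterministic alpha0 Sun upn hb noise.
- exact: measurable_sig2_III.
- by rewrite mu_eps; have [] := estimators_deterministic alpha0 Sun upn hb noise.
Qed.
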